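(* Let $n$ be a positive integer. Put $G=GL(n,\mathbb{R})$ and $H=O(n)$. Let $\rho\colon G\to GL(\mathrm{Sym}(n,\mathbb{R}))$ be the representation $$\rho(g)S=gSg^{T}\qquad(S\in\mathrm{Sym}(n,\mathbb{R})).$$ Then $v_0:=I_n$ is $H$-fixed, and the family $\mathcal{P}$ obtained from $(G,H,\mathrm{Sym}(n,\mathbb{R}),v_0)$ by the method described in the context is the family of Wishart distributions on $X=G/H\simeq\mathrm{Sym}^+(n,\mathbb{R})$ (identification $gO(n)\mapsto gg^{T}$), $$\left\{\frac{(\det y)^\alpha}{\pi^{\frac{n(n-1)}{4}}\prod_{k=1}^n\Gamma\left(\alpha-\frac{k-1}{2}\right)}\exp(-\mathrm{Tr}(yx))(\det x)^{\alpha-\frac{n+1}{2}}dx\right\}_{(y,\alpha)},$$ where $(y,\alpha)$ ranges over all pairs in $\mathrm{Sym}^+(n,\mathbb{R})\times\mathbb{R}$ with $\alpha>\frac{n-1}{2}$.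
   Context: $\mathrm{Sym}(n,\mathbb{R})$ is the space of real symmetric $n\times n$ matrices and $\mathrm{Sym}^+(n,\mathbb{R})$ the set of positive definite ones. $dx=\prod_{1\le i\le j\le n}dx_{ij}$ is Lebesgue measure in the entries $x_{ij}$, $i\le j$. The method: let $G$ be a Lie group with finitely many connected components, $H$ a closed subgroup, $X:=G/H$, $\rho\colon G\to GL(V)$ a continuous finite dimensional real representation and $v_0\in V$ an $H$-fixed vector. Put $W_0(G,H):=\{\tau\colon G\to\mathbb{R}\mid\tau\text{ is a continuous group homomorphism with }\tau|_H=0\}$. Take a nonzero relatively $G$-invariant Radon measure $\nu$ on $X$ (i.e. for some $\chi\colon G\to\mathbb{R}_{>0}$ the pushforward satisfies $g\cdot\nu=\chi(g)^{-1}\nu$ for all $g\in G$), assumed to exist; the resulting family does not depend on the choice of $\nu$. For $\theta=(\varphi,\tau)\in V^\vee\times W_0(G,H)$ and $x=gH$, put $\rho(x)v_0:=\rho(g)v_0$, $\tau(x):=\tau(g)$ and $d\tilde p_\theta(x):=\exp(-\langle\varphi,\rho(x)v_0\rangle+\tau(x))\,d\nu(x)$. Let $\Theta:=\{\theta\in V^\vee\times W_0(G,H)\mid\int_Xd\tilde p_\theta<\infty\}$ and, for $\theta\in\Theta$, $p_\theta:=(\int_Xd\tilde p_\theta)^{-1}\tilde p_\theta$. The family obtained is the set $\mathcal{P}:=\{p_\theta\}_{\theta\in\Theta}$ of probability measures on $X$. *)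

(* Defs.v *)
From HB Require Import structures.
From mathcomp Require Import all_boot all_order all_algebra.
From mathcomp Require Import all_classical all_reals all_analysis.

Set Implicit Arguments.
Unset Strict Implicit.
Unset Printing Implicit Defensive.

Import Order.TTheory GRing.Theory Num.Theory.
Import numFieldNormedType.Exports.

Local Open Scope classical_set_scope.
Local Open Scope quotient_scope.
Local Open Scope ring_scope.

HB.mixin Record isTopologicalGroup G of Topological G & Group G := {
  mulg_continuous : continuous (fun x : G * G => (x.1 * x.2)%g);
  invg_continuous : continuous (fun x : G => (x^-1)%g)
}.

#[short(type="topologicalGroupType")]
HB.structure Definition TopologicalGroup :=
  {G of Topological G & Group G & isTopologicalGroup G}.

Section coset_space.
Variables (G : topologicalGroupType) (H : groupClosed G).

Definition coset_rel (g g' : G) : bool := (g^-1 * g')%g \in H.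

Lemma coset_rel_refl : reflexive coset_rel.
Proof. by move=> g; rewrite /coset_rel mulVg gpred1. Qed.

Lemma coset_rel_sym : symmetric coset_rel.
Proof.
by move=> g g'; rewrite /coset_rel -[in LHS]gpredV invgM invgK.
Qed.

Lemma coset_rel_trans : transitive coset_rel.
Proof.
move=> g' g g'' gg' g'g''; rewrite /coset_rel.
by have := gpredM _ _ gg' g'g''; rewrite mulgA mulgK.
Qed.

Canonical coset_equiv :=
  EquivRel coset_rel coset_rel_refl coset_rel_sym coset_rel_trans.

Definition coset_space : Type := quotient_topology {eq_quot coset_equiv}.

HB.instance Definition _ := Topological.on coset_space.
HB.instance Definition _ := Quotient.on coset_space.
HB.instance Definition _ :=
  isPointed.Build coset_space (\pi_coset_space (1%g : G)).

Lemma coset_repr (g : G) : ((repr (\pi_coset_space g))^-1 * g)%g \in H.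
Proof.
have /eqquotP : \pi_{eq_quot coset_equiv} (repr (\pi_coset_space g))
    = \pi_{eq_quot coset_equiv} g by exact: (reprK (\pi_coset_space g)).
by [].
Qed.

Definition coset_act (g : G) (x : coset_space) : coset_space :=
  \pi_coset_space (g * repr x)%g.

Lemma coset_actE (g g' : G) :
  coset_act g (\pi_coset_space g') = \pi_coset_space (g * g')%g.
Proof.
have : coset_rel (g * repr (\pi_coset_space g'))%g (g * g')%g.
  by rewrite /coset_rel invgM mulgA mulgVK coset_repr.
move=> h; suff : \pi_{eq_quot coset_equiv} (g * repr (\pi_coset_space g'))%g
  = \pi_{eq_quot coset_equiv} (g * g')%g by [].
exact/eqquotP.
Qed.

End coset_space.

Section representation.
Variables (R : realType) (G : topologicalGroupType) (V : preTopologicalLmodType R).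

(* For finite-dimensional V, continuity of G -> GL(V) is continuity of all the
   orbit maps. *)
Record representation := Representation {
  rep_fun :> G -> {linear V -> V} ;
  rep1 : forall v, rep_fun 1%g v = v ;
  repM : forall g h v, rep_fun (g * h)%g v = rep_fun g (rep_fun h v) ;
  rep_continuous : forall v, continuous (fun g => rep_fun g v)
}.

Definition fixed_by (H : groupClosed G) (rho : representation) (v : V) :=
  forall h, h \in H -> rho h v = v.

End representation.

Notation borel T := (g_sigma_algebraType (@open T)).

Definition radon (R : realType) (T : ptopologicalType)
    (mu : {measure set (borel T) -> \bar R}) :=
  [/\ forall K : set T, compact K -> (mu K < +oo)%E,
      forall A : set (borel T), measurable A ->
        mu A = ereal_inf [set mu U | U in [set U : set T | open U /\ A `<=` U]]
    & forall U : set T, open U ->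
        mu U = ereal_sup [set mu K | K in [set K : set T | compact K /\ K `<=` U]] ].

Section method.
Variables (R : realType) (G : topologicalGroupType) (H : groupClosed G).
Variables (V : preTopologicalLmodType R) (rho : representation G V) (v0 : V).

Let X : ptopologicalType := coset_space H.

Definition relatively_invariant (nu : {measure set (borel X) -> \bar R}) :=
  exists chi : G -> R, (forall g, 0 < chi g) /\
    forall g (A : set (borel X)), measurable A ->
      pushforward nu (coset_act g : borel X -> borel X) A
        = ((chi g)^-1%:E * nu A)%E.

Definition admissible_measure (nu : {measure set (borel X) -> \bar R}) :=
  [/\ nu [set: X] <> 0%E, radon nu & relatively_invariant nu].

Definition W0 : set (G -> R) := [set tau | [/\ continuous tau,
  forall g g', tau (g * g')%g = tau g + tau g'
  & forall h, h \in H -> tau h = 0] ].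

(* The value at x = gH is independent of g when v0 is fixed by H and tau
   vanishes on H; it is read off at the representative [repr x]. *)
Definition exp_density (theta : {linear V -> R^o} * (G -> R)) (x : X) : R :=
  expR (- theta.1 (rho (repr x) v0) + theta.2 (repr x)).

Variable nu : {measure set (borel X) -> \bar R}.

Definition ptilde (theta : {linear V -> R^o} * (G -> R)) (A : set (borel X)) :=
  (\int[nu]_(x in A) (exp_density theta x)%:E)%E.

Definition Theta : set ({linear V -> R^o} * (G -> R)) :=
  [set theta | W0 theta.2 /\ (ptilde theta [set: X] < +oo)%E].

Definition p_theta (theta : {linear V -> R^o} * (G -> R)) (A : set (borel X)) :=
  ((fine (ptilde theta [set: X]))^-1%:E * ptilde theta A)%E.

(* The normalized measures are kept as set functions; two of them are the same
   measure when they agree on Borel sets. *)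
Definition homogeneous_family : set (set (borel X) -> \bar R) :=
  [set p_theta theta | theta in Theta].

End method.

Definition homeomorphism (S T : topologicalType) (f : S -> T) :=
  continuous f /\
  exists g : T -> S, [/\ cancel f g, cancel g f & continuous g].

Section continuous_mx.
Variables (R : realType) (T : topologicalType).

Lemma continuous_mx (m n : nat) (f : T -> 'M[R]_(m, n)) :
  (forall i j, continuous (fun t => f t i j)) -> continuous f.
Proof.
move=> fc t A [P ftP PA].
have : \forall s \near t, forall ij, P ij.1 ij.2 (f s ij.1 ij.2).
  apply: filter_forall => -[i j] /=.
  exact: (fc i j t _ (ftP i j)).
by apply: filterS => s sP; apply: PA => i j; exact: (sP (i, j)).
Qed.

Lemma continuous_mulmx (m n p : nat) (f : T -> 'M[R]_(m, n))
    (g : T -> 'M[R]_(n, p)) :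
  continuous f -> continuous g -> continuous (fun t => f t *m g t).
Proof.
move=> fc gc; apply: continuous_mx => i j.
have -> : (fun t => (f t *m g t) i j) = (fun t => \sum_k f t i k * g t k j).
  by apply/funext => t; rewrite mxE.
apply: continuous_big; first exact: add_continuous.
move=> k _ t; apply: cvgM.
  exact: (continuous_comp (fc t) (@coord_continuous _ _ _ i k (f t))).
exact: (continuous_comp (gc t) (@coord_continuous _ _ _ k j (g t))).
Qed.

Lemma continuous_trmx (m n : nat) (f : T -> 'M[R]_(m, n)) :
  continuous f -> continuous (fun t => (f t)^T).
Proof.
move=> fc; apply: continuous_mx => i j.
have -> : (fun t => (f t)^T i j) = (fun t => f t j i).
  by apply/funext => t; rewrite mxE.
by move=> t; exact: (continuous_comp (fc t) (@coord_continuous _ _ _ j i (f t))).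
Qed.

Lemma continuous_det (n : nat) (f : T -> 'M[R]_n) :
  (forall i j, continuous (fun t => f t i j)) -> continuous (fun t => \det (f t)).
Proof.
move=> fc; apply: continuous_big; first exact: add_continuous.
move=> s _ t; apply: cvgM; first exact: cvg_cst.
by apply: cvg_big => [|i _]; [exact: mul_continuous|exact: fc].
Qed.

Lemma continuous_invmx (n : nat) (f : T -> 'M[R]_n) :
  (forall t, f t \in unitmx) -> continuous f ->
  continuous (fun t => invmx (f t)).
Proof.
move=> fU fc.
have fijc i j : continuous (fun t => f t i j).
  by move=> t; exact: (continuous_comp (fc t) (@coord_continuous _ _ _ i j (f t))).
apply: continuous_mx => i j.
have -> : (fun t => invmx (f t) i j)
    = (fun t => (\det (f t))^-1 * cofactor (f t) j i).
  by apply/funext => t; rewrite /invmx fU !mxE.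
move=> t; apply: cvgM.
  apply: cvgV; last exact: continuous_det.
  by rewrite -unitfE; exact: fU.
apply: cvgM; first exact: cvg_cst.
apply: continuous_det => k l.
have -> : (fun t => row' j (col' i (f t)) k l)
    = (fun t => f t (lift j k) (lift i l)).
  by apply/funext => u; rewrite !mxE.
exact: fijc.
Qed.

End continuous_mx.

Section general_linear_group.
Variables (R : realType) (n : nat).

Record GL := MkGL { GLmx :> 'M[R]_n ; GLmx_unit : GLmx \in unitmx }.

HB.instance Definition _ := [isSub for GLmx].
HB.instance Definition _ := [Choice of GL by <:].
HB.instance Definition _ := Topological.copy GL (initial_topology GLmx).

Lemma GL1_unit : (1%:M : 'M[R]_n) \in unitmx. Proof. exact: unitmx1. Qed.

Lemma GLM_unit (g h : GL) : g *m h \in unitmx.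
Proof. by rewrite unitmx_mul !GLmx_unit. Qed.

Lemma GLV_unit (g : GL) : invmx g \in unitmx.
Proof. by rewrite unitmx_inv GLmx_unit. Qed.

Definition GL1 := MkGL GL1_unit.
Definition GLM g h := MkGL (GLM_unit g h).
Definition GLV g := MkGL (GLV_unit g).

Lemma GLMA : associative GLM.
Proof. by move=> f g h; apply: val_inj; rewrite /= mulmxA. Qed.

Lemma GL1M : left_id GL1 GLM.
Proof. by move=> g; apply: val_inj; rewrite /= mul1mx. Qed.

Lemma GLM1 : right_id GL1 GLM.
Proof. by move=> g; apply: val_inj; rewrite /= mulmx1. Qed.

Lemma GLVM : left_inverse GL1 GLV GLM.
Proof. by move=> g; apply: val_inj; rewrite /= mulVmx// GLmx_unit. Qed.

Lemma GLMV : right_inverse GL1 GLV GLM.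
Proof. by move=> g; apply: val_inj; rewrite /= mulmxV// GLmx_unit. Qed.

HB.instance Definition _ := isGroup.Build GL GLMA GL1M GLM1 GLVM GLMV.

Lemma GLmx_continuous : continuous GLmx.
Proof. exact: initial_continuous. Qed.

Lemma GL_mulg_continuous : continuous (fun x : GL * GL => (x.1 * x.2)%g).
Proof.
apply: (@continuous_comp_initial GL _ _ GLmx).
apply: (@continuous_mulmx R _ n n n (fun x : GL * GL => GLmx x.1)
                                    (fun x : GL * GL => GLmx x.2)).
- by move=> x; apply: continuous_comp; [exact: cvg_fst|exact: GLmx_continuous].
- by move=> x; apply: continuous_comp; [exact: cvg_snd|exact: GLmx_continuous].
Qed.

Lemma GL_invg_continuous : continuous (fun x : GL => (x^-1)%g).
Proof.
apply: (@continuous_comp_initial GL _ _ GLmx).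
apply: (@continuous_invmx R _ n GLmx); first exact: GLmx_unit.
exact: GLmx_continuous.
Qed.

HB.instance Definition _ :=
  isTopologicalGroup.Build GL GL_mulg_continuous GL_invg_continuous.

Definition orthogonal_group : {pred GL} := [pred g : GL | (g *m g^T == 1%:M)].

Lemma orthogonal_groupM : mulg_closed orthogonal_group.
Proof.
move=> g h /eqP gO /eqP hO; apply/eqP.
by rewrite /= trmx_mul mulmxA -(mulmxA _ _ h^T) hO mulmx1.
Qed.

Lemma orthogonal_group1 : 1%g \in orthogonal_group.
Proof. by apply/eqP; rewrite /= trmx1 mulmx1. Qed.

Lemma orthogonal_groupV : invg_closed orthogonal_group.
Proof.
move=> g /eqP gO; apply/eqP => /=.
have -> : invmx g = g^T.
  by rewrite -[LHS]mulmx1 -gO mulmxA mulVmx ?GLmx_unit// mul1mx.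
by rewrite trmxK; exact: mulmx1C.
Qed.

HB.instance Definition _ := isMulClosed.Build GL orthogonal_group orthogonal_groupM.
HB.instance Definition _ := isMul1Closed.Build GL orthogonal_group orthogonal_group1.
HB.instance Definition _ := isInvClosed.Build GL orthogonal_group orthogonal_groupV.

Lemma orthogonal_group_closed : closed [set g | g \in orthogonal_group].
Proof.
have -> : [set g | g \in orthogonal_group]
    = \bigcap_ij [set g : GL | (g *m g^T) ij.1 ij.2 = 1%:M ij.1 ij.2].
  apply/seteqP; split => g /=.
    by move=> /eqP gO ij _ /=; rewrite gO.
  by move=> gO; apply/eqP/matrixP => i j; exact: (gO (i, j)).
apply: closed_bigI => -[i j] _ /=.
apply: (@closed_comp _ _ (fun g : GL => (g *m g^T) i j)
                         [set (1%:M : 'M[R]_n) i j]); last exact: closed_eq.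
have gramc : continuous (fun g : GL => g *m g^T).
  apply: (@continuous_mulmx R _ n n n GLmx (fun g : GL => g^T)).
    exact: GLmx_continuous.
  by apply: continuous_trmx; exact: GLmx_continuous.
by move=> g _; exact:
  (continuous_comp (gramc g) (@coord_continuous _ _ _ i j (g *m g^T))).
Qed.

End general_linear_group.

Section symmetric_matrices.
Variables (R : realType) (n : nat).

Definition symmetric_mx : {pred 'M[R]_n} := [pred A | A^T == A].

Lemma symmetric_mx_submod_closed : submod_closed symmetric_mx.
Proof.
split=> [|a A B /eqP AT /eqP BT]; apply/eqP => /=; first by rewrite trmx0.
by rewrite linearP/= AT BT.
Qed.

HB.instance Definition _ :=
  GRing.isSubmodClosed.Build R 'M[R]_n symmetric_mx symmetric_mx_submod_closed.

Record Sym := MkSym { Symmx :> 'M[R]_n ; Symmx_sym : Symmx \in symmetric_mx }.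

HB.instance Definition _ := [isSub for Symmx].
HB.instance Definition _ := [Choice of Sym by <:].
HB.instance Definition _ := [SubChoice_isSubLmodule of Sym by <:].
HB.instance Definition _ := Topological.copy Sym (initial_topology Symmx).
HB.instance Definition _ := isPointed.Build Sym 0.

Lemma Symmx_tr (S : Sym) : S^T = S :> 'M[R]_n.
Proof. by apply/eqP; exact: (Symmx_sym S). Qed.

Lemma Sym1_sym : (1%:M : 'M[R]_n) \in symmetric_mx.
Proof. by apply/eqP; rewrite trmx1. Qed.

Definition Sym1 := MkSym Sym1_sym.

Lemma congr_sym (g : GL R n) (S : Sym) : g *m S *m g^T \in symmetric_mx.
Proof.
apply/eqP; rewrite !trmx_mul trmxK mulmxA.
by rewrite Symmx_tr.
Qed.

Definition congr_act (g : GL R n) (S : Sym) : Sym := MkSym (congr_sym g S).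

Lemma congr_act_linear g : linear (congr_act g).
Proof.
move=> a S T; apply: val_inj.
by rewrite /= mulmxDr mulmxDl -scalemxAr -scalemxAl.
Qed.

HB.instance Definition _ (g : GL R n) :=
  GRing.isLinear.Build R Sym Sym *:%R (congr_act g) (congr_act_linear g).

Lemma congr_act1 S : congr_act 1%g S = S.
Proof. by apply: val_inj; rewrite /= mul1mx trmx1 mulmx1. Qed.

Lemma congr_actM g h S : congr_act (g * h)%g S = congr_act g (congr_act h S).
Proof. by apply: val_inj; rewrite /= trmx_mul !mulmxA. Qed.

Lemma congr_act_continuous S : continuous (fun g => congr_act g S).
Proof.
apply: (@continuous_comp_initial Sym _ _ Symmx).
apply: (@continuous_mulmx R _ n n n (fun g : GL R n => g *m S)
                                    (fun g : GL R n => g^T)).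
  apply: continuous_mulmx; first exact: GLmx_continuous.
  exact: (@cst_continuous _ _ (Symmx S)).
by apply: continuous_trmx; exact: GLmx_continuous.
Qed.

Definition congr_rep : representation (GL R n) Sym :=
  Representation congr_act1 congr_actM congr_act_continuous.

Definition posdef : set Sym :=
  [set S | forall v : 'rV[R]_n, v != 0 -> 0 < (v *m S *m v^T) 0 0].

Definition SymPos : Type := set_type posdef.

HB.instance Definition _ := Topological.on SymPos.

Lemma gram_posdef (g : GL R n) : congr_act g Sym1 \in posdef.
Proof.
apply/mem_set => v v0 /=; rewrite mulmx1.
have vg0 : v *m g != 0.
  apply: contra v0 => /eqP vg0.
  by rewrite -[v]mulmx1 -(mulmxV (GLmx_unit g)) mulmxA vg0 mul0mx.
have -> : v *m (g *m g^T) *m v^T = (v *m g) *m (v *m g)^T.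
  by rewrite trmx_mul !mulmxA.
rewrite mxE; under eq_bigr do rewrite [_^T _ _]mxE -expr2.
rewrite lt0r sumr_ge0 ?andbT; last by move=> i _; exact: sqr_ge0.
apply: contra vg0; rewrite psumr_eq0; last by move=> i _; exact: sqr_ge0.
move=> /allP vgE; apply/eqP/rowP => i.
have := vgE i (mem_index_enum i); rewrite /= sqrf_eq0 => /eqP ->.
by rewrite mxE.
Qed.

Definition gram (g : GL R n) : SymPos :=
  exist (fun S : Sym => S \in posdef) (congr_act g Sym1) (gram_posdef g).

HB.instance Definition _ := isPointed.Build SymPos (gram 1%g).

Definition coset_gram
  (x : coset_space (@orthogonal_group R n)) : SymPos := gram (repr x).

Lemma coset_gramE (g : GL R n) :
  val (coset_gram (\pi_(coset_space (@orthogonal_group R n)) g))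
    = g *m g^T :> 'M[R]_n.
Proof.
have := coset_repr (@orthogonal_group R n) g.
rewrite /coset_gram; move: (repr _) => h /eqP /= hgO; rewrite mulmx1.
have -> : g = h *m (invmx h *m g) :> 'M[R]_n.
  by rewrite mulmxA mulmxV ?GLmx_unit// mul1mx.
by rewrite trmx_mul mulmxA -(mulmxA h) hgO mulmx1.
Qed.

End symmetric_matrices.

Section wishart.
Variable R : realType.

Fixpoint lebesgue_tuple (N : nat) : set (N.-tuple R) -> \bar R :=
  match N with
  | 0 => \d_([tuple] : 0.-tuple R)
  | N'.+1 => pushforward (@lebesgue_measure R \x @lebesgue_tuple N')%E
               (fun xt => [tuple of xt.1 :: xt.2])
  end.

Definition Gamma (s : R) : R :=
  \int[@lebesgue_measure R]_(t in `]0, +oo[) (t `^ (s - 1) * expR (- t)).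

Variable n : nat.

Definition upper : predArgType := {ij : 'I_n * 'I_n | (ij.1 <= ij.2)%N}.

Lemma upper_index_subproof (i j : 'I_n) :
  let ij := if (i <= j)%N then (i, j) else (j, i) in (ij.1 <= ij.2)%N.
Proof. by case: leqP => // /ltnW. Qed.

Definition upper_index (i j : 'I_n) : upper :=
  Sub (if (i <= j)%N then (i, j) else (j, i)) (upper_index_subproof i j).

Lemma upper_indexC i j : upper_index i j = upper_index j i.
Proof.
by apply: val_inj => /=; case: ltngtP => // /val_inj ->.
Qed.

Lemma Sym_of_tuple_subproof (t : #|upper|.-tuple R) :
  \matrix_(i, j) tnth t (enum_rank (upper_index i j)) \in @symmetric_mx R n.
Proof. by apply/eqP/matrixP => i j; rewrite !mxE upper_indexC. Qed.

Definition Sym_of_tuple (t : #|upper|.-tuple R) : Sym R n :=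
  MkSym (Sym_of_tuple_subproof t).

(* The measure prod_(i <= j) dx_ij; the order in which the entries are
   enumerated is irrelevant. *)
Definition lebesgue_Sym : set (borel (Sym R n)) -> \bar R :=
  pushforward (@lebesgue_tuple #|upper|) (Sym_of_tuple : _ -> borel (Sym R n)).

Definition wishart_density (y : SymPos R n) (alpha : R) (x : Sym R n) : R :=
  (\det (val y)) `^ alpha
  / (pi `^ (n%:R * (n%:R - 1) / 4)
     * \prod_(1 <= k < n.+1) Gamma (alpha - (k%:R - 1) / 2))
  * expR (- \tr (val y *m x)) * (\det x) `^ (alpha - (n%:R + 1) / 2).

Definition wishart (y : SymPos R n) (alpha : R) (A : set (borel (SymPos R n)))
    : \bar R :=
  (\int[lebesgue_Sym]_(x in [set val z | z in A])
     (wishart_density y alpha x)%:E)%E.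

End wishart.

(* Main.v *)
(** The Cholesky factor is a continuous section of g |-> g g^T, which makes G/H homeomorphic to
Sym+ and turns Sym+ into a group (lower triangular matrices with positive diagonal).  Two relatively
invariant sigma-finite measures on this group differ by a constant times a quotient of their
characters: this is a Fubini argument, with exp(-tr) as an integrable reference function.  Every
multiplicative function on GL(n) that is trivial on O(n) and bounded near 1 is a power of |det|:
conjugation by diagonal matrices contracts unipotent matrices to 1.  Hence nu is a constant times
det(x)^r dx, a character tau in W_0 is s log|det|, and the unnormalized density is
exp(-Tr(yx)) det(x)^b dx.

By induction on n, through Schur complements, the integral of this density for y = 1 is a product of
a Gaussian integral, a Gamma integral and the same integral in dimension n - 1; in particular it is
infinite for b <= -1.  A congruence reduces the case of positive definite y to y = 1.  If y is not
positive definite, then after a congruence y_11 <= 0, and the integral over the entry x_11 alone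
diverges.

Conversely dx, transported to G/H, is an admissible measure.  It is a Radon measure because every open
set is an increasing union of compact sets, so that Borel sets of finite measure can be approximated by
closed sets from inside and by open sets from outside. *)

(* Loaded first, since its [Sym] would shadow the one of [Defs]. *)
From mathcomp Require Import perm.
From HB Require Import structures.
Require Import Defs.
From mathcomp Require Import all_boot all_order all_algebra.
From mathcomp Require Import all_classical all_reals all_analysis.
From mathcomp Require Import measurable_realfun ring lra.

Set Implicit Arguments.
Unset Strict Implicit.
Unset Printing Implicit Defensive.

Import Order.TTheory GRing.Theory Num.Theory.
Import numFieldNormedType.Exports.

Local Open Scope classical_set_scope.
Local Open Scope quotient_scope.
Local Open Scope ring_scope.

(** * Positive definite forms and Cholesky factors *)

(** G/H is not a group, and the multiplier chi of a relatively invariant measure is a priori an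
    arbitrary positive function on GL(n), with no continuity or measurability. It becomes accessible
    because congruence by g near 1 maps the set of matrices with eigenvalues in [1/m, m] into the
    corresponding set for 2m: comparing the masses of such sets bounds chi near 1, and the
    classification of homomorphisms applies.

    The same device replaces Jacobians. Translation invariance determines the image of dx under a
    congruence up to a constant, the constant is a power of |det g|, and congruence by 2I, applied
    to boxes of known volume, gives the exponent n + 1. Uniqueness of translation-invariant measures
    also splits dx into the coordinates of a block matrix.

    Integrals stay in the extended reals, since Theta is decided by where they diverge. In the end
    nu enters only through a constant, which normalization removes, and an exponent r, which shifts
    the free parameter of tau: alpha = s/2 + r + (n+1)/2. *)

Section quadratic_forms.
Variable R : realType.

Definition qf n (A : 'M[R]_n) (v : 'rV[R]_n) : R := (v *m A *m v^T) 0 0.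

(** Convertible with [posdef] on the underlying matrix; symmetry is not part of it, so that it also
    applies to the parameter y of a functional. *)
Definition pdmx n (A : 'M[R]_n) := forall v : 'rV[R]_n, v != 0 -> 0 < qf A v.

Lemma qf1E n (v : 'rV[R]_n) : qf 1%:M v = \sum_i v 0 i ^+ 2.
Proof.
by rewrite /qf mulmx1 mxE; apply: eq_bigr => i _; rewrite [_^T _ _]mxE expr2.
Qed.

Lemma qf1_ge0 n (v : 'rV[R]_n) : 0 <= qf 1%:M v.
Proof. by rewrite qf1E sumr_ge0// => i _; exact: sqr_ge0. Qed.

Lemma pdmx1 n : pdmx (1%:M : 'M[R]_n).
Proof.
move=> v v0; rewrite lt0r qf1_ge0 andbT qf1E.
apply: contra v0; rewrite psumr_eq0; last by move=> i _; exact: sqr_ge0.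
move=> /allP vE; apply/eqP/rowP => i.
by have := vE i (mem_index_enum i); rewrite /= sqrf_eq0 => /eqP ->; rewrite mxE.
Qed.

Lemma qf_congr n m (g : 'M[R]_(n, m)) A v : qf (g *m A *m g^T) v = qf A (v *m g).
Proof. by rewrite /qf trmx_mul !mulmxA. Qed.

Lemma qf_gram n m (g : 'M[R]_(n, m)) v : qf (g *m g^T) v = qf 1%:M (v *m g).
Proof. by rewrite -qf_congr mulmx1. Qed.

Lemma mulmx_unit_eq0 n (g : 'M[R]_n) (v : 'rV[R]_n) :
  g \in unitmx -> (v *m g == 0) = (v == 0).
Proof.
move=> gU; apply/eqP/eqP => [vg0|->]; last by rewrite mul0mx.
by rewrite -(mulmxK gU v) vg0 mul0mx.
Qed.

Lemma pdmx_congr n (g : 'M[R]_n) A : g \in unitmx ->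
  pdmx (g *m A *m g^T) <-> pdmx A.
Proof.
move=> gU; split=> pA v v0.
  have /pA : v *m invmx g != 0 by rewrite mulmx_unit_eq0// unitmx_inv.
  by rewrite qf_congr mulmxKV.
by rewrite qf_congr; apply: pA; rewrite mulmx_unit_eq0.
Qed.

Lemma pdmx_gram n (g : 'M[R]_n) : g \in unitmx -> pdmx (g *m g^T).
Proof. by move=> gU; rewrite -{1}(mulmx1 g); apply/pdmx_congr => //; exact: pdmx1. Qed.

Lemma qf_block n (a : R) (b : 'rV[R]_n) (C : 'M[R]_n) (t : R) (w : 'rV[R]_n) :
  qf (block_mx a%:M b b^T C : 'M[R]_(1 + n)) (row_mx t%:M w)
  = t ^+ 2 * a + t * (b *m w^T) 0 0 *+ 2 + qf C w.
Proof.
rewrite /qf mul_row_block tr_row_mx mul_row_col !mulmxDl tr_scalar_mx.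
have bw : w *m b^T = (b *m w^T)^T by rewrite trmx_mul trmxK.
rewrite !mul_scalar_mx !mul_mx_scalar -scalemxAl bw !mxE eqxx !mulr1n.
ring.
Qed.

Lemma pdmx_block_diag n (a : R) (C : 'M[R]_n) :
  pdmx (block_mx a%:M 0 0 C : 'M[R]_(1 + n)) <-> 0 < a /\ pdmx C.
Proof.
have qE t w : qf (block_mx a%:M 0 0 C : 'M[R]_(1 + n)) (row_mx t%:M w) = t ^+ 2 * a + qf C w.
  by have := qf_block a 0 C t w; rewrite trmx0 mul0mx mxE mulr0 mul0rn addr0.
split=> [pA|[a0 pC] v].
  split.
    have := pA (row_mx 1%:M 0); rewrite qE expr1n mul1r /qf !mul0mx mxE addr0.
    by apply; rewrite row_mx_eq0 negb_and oner_neq0.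
  move=> w w0; have := pA (row_mx 0%:M w); rewrite qE expr0n mul0r add0r.
  by apply; rewrite row_mx_eq0 negb_and w0 orbT.
rewrite -[v]hsubmxK (mx11_scalar (lsubmx v)); set t := lsubmx v 0 0; set w := rsubmx v.
rewrite row_mx_eq0 negb_and qE.
have [->|w0] := eqVneq w 0.
  rewrite orbF => t0; rewrite /qf !mul0mx mxE addr0 mulr_gt0// exprn_even_gt0//=.
  by apply: contraNneq t0 => ->; rewrite raddf0.
by move=> _; rewrite ltr_wpDl ?pC// mulr_ge0 ?sqr_ge0// ltW.
Qed.

(** The lower right block is written as C plus a correction so that the Schur complement C is a free
    parameter: passing to it is a translation, which Lebesgue measure ignores. *)
Lemma block_schur_ul n (a : R) (b : 'rV[R]_n) (C : 'M[R]_n) : a != 0 ->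
  let U : 'M[R]_(1 + n) := block_mx 1%:M 0 (a^-1 *: b^T) 1%:M in
  block_mx a%:M b b^T (C + a^-1 *: (b^T *m b)) = U *m block_mx a%:M 0 0 C *m U^T.
Proof.
move=> a0 /=; rewrite tr_block_mx !mulmx_block !trmx1 !trmx0 linearZ/= trmxK.
rewrite !(mulmx0,mul0mx,mulmx1,mul1mx,addr0,add0r).
rewrite -scalemxAr !mul_scalar_mx mul_mx_scalar -!scalemxAl !scalerA mulfV//.
rewrite mulVf// !scale1r.
by congr block_mx; rewrite addrC// -scalemxAr.
Qed.

(** The opposite elimination, in which the corner is the free parameter and C is fixed; it serves
    the divergence argument, where only the corner varies. *)
Lemma block_schur_dr n (a : R) (b : 'rV[R]_n) (C : 'M[R]_n) : C \in unitmx -> C^T = C ->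
  let U : 'M[R]_(1 + n) := block_mx 1%:M (b *m invmx C) 0 1%:M in
  block_mx (a + (b *m invmx C *m b^T) 0 0)%:M b b^T C
    = U *m block_mx a%:M 0 0 C *m U^T.
Proof.
move=> CU Cs /=; rewrite tr_block_mx !mulmx_block !trmx1 !trmx0 trmx_mul trmx_inv Cs.
rewrite !(mulmx0,mul0mx,mulmx1,mul1mx,addr0,add0r) mulmxKV// (mulKVmx CU).
by congr block_mx; rewrite raddfD/= mulmxA -mx11_scalar.
Qed.

Lemma lblock1_unit n (c : 'cV[R]_n) : (block_mx 1%:M 0 c 1%:M : 'M[R]_(1 + n)) \in unitmx.
Proof. by rewrite unitmxE det_lblock !det1 mulr1 unitr1. Qed.

Lemma ublock1_unit n (c : 'rV[R]_n) : (block_mx 1%:M c 0 1%:M : 'M[R]_(1 + n)) \in unitmx.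
Proof. by rewrite unitmxE det_ublock !det1 mulr1 unitr1. Qed.

Lemma pdmx_block_ul n (a : R) (b : 'rV[R]_n) (C : 'M[R]_n) : a != 0 ->
  pdmx (block_mx a%:M b b^T (C + a^-1 *: (b^T *m b)) : 'M[R]_(1 + n)) <-> 0 < a /\ pdmx C.
Proof.
by move=> a0; rewrite block_schur_ul// pdmx_congr ?lblock1_unit// pdmx_block_diag.
Qed.

Lemma det_block_ul n (a : R) (b : 'rV[R]_n) (C : 'M[R]_n) : a != 0 ->
  \det (block_mx a%:M b b^T (C + a^-1 *: (b^T *m b)) : 'M[R]_(1 + n)) = a * \det C.
Proof.
move=> a0; rewrite block_schur_ul// !det_mulmx det_tr !det_lblock !det1 det_scalar1.
by rewrite !mul1r mulr1.
Qed.

Lemma pdmx_block_dr n (a : R) (b : 'rV[R]_n) (C : 'M[R]_n) : C \in unitmx -> C^T = C ->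
  pdmx (block_mx (a + (b *m invmx C *m b^T) 0 0)%:M b b^T C : 'M[R]_(1 + n))
  <-> 0 < a /\ pdmx C.
Proof.
by move=> CU Cs; rewrite block_schur_dr// pdmx_congr ?ublock1_unit// pdmx_block_diag.
Qed.

Lemma det_block_dr n (a : R) (b : 'rV[R]_n) (C : 'M[R]_n) : C \in unitmx -> C^T = C ->
  \det (block_mx (a + (b *m invmx C *m b^T) 0 0)%:M b b^T C : 'M[R]_(1 + n)) = a * \det C.
Proof.
move=> CU Cs; rewrite block_schur_dr// !det_mulmx det_tr !det_ublock !det1 det_scalar1.
by rewrite !mul1r mulr1.
Qed.

Lemma pdmx_block_gt0 n (a : R) (b : 'rV[R]_n) (C : 'M[R]_n) :
  pdmx (block_mx a%:M b b^T C : 'M[R]_(1 + n)) -> 0 < a.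
Proof.
move=> /(_ (row_mx 1%:M 0)); rewrite qf_block expr1n mul1r trmx0 mulmx0 mxE mulr0.
rewrite mul0rn addr0 /qf !mul0mx mxE addr0; apply.
by rewrite row_mx_eq0 negb_and oner_neq0.
Qed.

(** One elimination step, then recursion on the Schur complement of the corner. Off the positive
    definite matrices the square root and the inverse produce junk values. *)
Fixpoint chol n : 'M[R]_n -> 'M[R]_n :=
  match n with
  | 0 => id
  | m.+1 => fun A : 'M[R]_(1 + m) =>
      let s := Num.sqrt (ulsubmx A 0 0) in
      let c := s^-1 *: dlsubmx A in
      block_mx s%:M 0 c (chol (drsubmx A - c *m c^T))
  end.

Lemma sym_block n (A : 'M[R]_(1 + n)) : A^T = A ->
  A = block_mx (A 0 0)%:M (ursubmx A) (ursubmx A)^T (drsubmx A).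
Proof.
move=> As; rewrite -[LHS]submxK; congr block_mx.
  by rewrite [LHS]mx11_scalar !mxE; congr (A _ _)%:M; exact/val_inj.
by rewrite trmx_ursub As.
Qed.

Definition cholesky_factor n (L : 'M[R]_n) := is_trig_mx L /\ forall i, 0 < L i i.

Lemma chol_block n (a : R) (b : 'rV[R]_n) (D : 'M[R]_n) : 0 < a ->
  let s := Num.sqrt a in
  chol (block_mx a%:M b b^T D : 'M[R]_(1 + n))
  = block_mx s%:M 0 (s^-1 *: b^T) (chol (D - a^-1 *: (b^T *m b))) :> 'M[R]_(1 + n).
Proof.
move=> a0 /=; rewrite block_mxKul block_mxKdl block_mxKdr mxE eqxx mulr1n.
congr block_mx; congr (chol (_ - _)).
rewrite linearZ/= trmxK -scalemxAl -scalemxAr scalerA -invfM -expr2 sqr_sqrtr//.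
exact: ltW.
Qed.

Lemma cholesky_factor_block n (s : R) (c : 'cV[R]_n) (L : 'M[R]_n) :
  0 < s -> cholesky_factor L ->
  cholesky_factor (block_mx s%:M 0 c L : 'M[R]_(1 + n)).
Proof.
move=> s0 [Lt Ld]; split; first by rewrite is_trig_block_mx// eqxx scalar_mx_is_trig.
move=> i; case: (split_ordP i) => j ->; last by rewrite block_mxEdr.
by rewrite block_mxEul ord1 mxE eqxx.
Qed.

Lemma cholP n (A : 'M[R]_n) : A^T = A -> pdmx A ->
  chol A *m (chol A)^T = A /\ cholesky_factor (chol A).
Proof.
elim: n A => [|n IH] A.
  by split; [rewrite !flatmx0|split; [apply/is_trig_mxP; case|case]].
change 'M[R]_(1 + n) in A => As Ap.
have := sym_block As.
set a := A 0 0; set b := ursubmx A; set D := drsubmx A => AE.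
have Ds : D^T = D by rewrite /D trmx_drsub As.
rewrite AE in Ap *; have a0 := pdmx_block_gt0 Ap.
set C := D - a^-1 *: (b^T *m b).
have DE : D = C + a^-1 *: (b^T *m b) by rewrite /C subrK.
have Cs : C^T = C by rewrite /C linearB linearZ/= trmx_mul trmxK Ds.
move: Ap; rewrite DE => /pdmx_block_ul -/(_ (lt0r_neq0 a0)) [_ pC].
have [CE [Ct Cd]] := IH C Cs pC.
rewrite chol_block// -DE -/C; set s := Num.sqrt a.
have s0 : 0 < s by rewrite sqrtr_gt0.
have ss : s * s = a by rewrite -expr2 sqr_sqrtr// ltW.
split.
  have -> : block_mx a%:M b b^T D = block_mx a%:M b b^T (C + a^-1 *: (b^T *m b)).
    by rewrite -DE.
  move: (chol C) CE => M CE.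
  pose X : 'M[R]_(1 + n) := block_mx s%:M 0 (s^-1 *: b^T) M.
  suff : X *m X^T = block_mx a%:M b b^T (C + a^-1 *: (b^T *m b)) by [].
  rewrite /X tr_block_mx mulmx_block tr_scalar_mx linearZ/= trmxK trmx0.
  rewrite !(mulmx0,mul0mx,addr0,add0r) CE -scalar_mxM ss mul_scalar_mx mul_mx_scalar.
  rewrite !scalerA divff ?lt0r_neq0// !scale1r -scalemxAl -scalemxAr scalerA.
  by rewrite -invfM ss [in RHS]addrC.
exact: cholesky_factor_block.
Qed.

(** Uniqueness of the Cholesky factor: since the diagonal is positive, the square root recovers the
    corner entry, and the recursion undoes the product block by block. *)
Lemma chol_gram n (L : 'M[R]_n) : cholesky_factor L -> chol (L *m L^T) = L.
Proof.
move=> [Lt]; elim/trigsqmx_ind: n L / Lt => [|n x c L Lt IH] Ld.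
  by rewrite !flatmx0.
have x0 : 0 < x 0 0.
  by have := Ld (lshift n 0); rewrite block_mxEul.
have {}IH : chol (L *m L^T) = L.
  apply: IH => i; have := Ld (rshift 1 i).
  by rewrite block_mxEdr.
rewrite (mx11_scalar x); set s := x 0 0 in x0 *.
rewrite tr_block_mx mulmx_block !trmx0 !(mulmx0,mul0mx,addr0,add0r).
rewrite tr_scalar_mx -scalar_mxM mul_scalar_mx mul_mx_scalar.
have -> : s *: c = (s *: c^T)^T by rewrite linearZ/= trmxK.
rewrite chol_block ?mulr_gt0// -expr2 sqrtr_sqr gtr0_norm//.
congr block_mx; first by rewrite linearZ/= trmxK scalerA mulVf ?scale1r ?lt0r_neq0.
rewrite [(s *: c^T)^T]linearZ/= trmxK -scalemxAl -scalemxAr !scalerA.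
have -> : (s ^+ 2)^-1 * s * s = 1 by rewrite -mulrA -expr2 mulVf// expf_neq0// lt0r_neq0.
by rewrite scale1r addrC addKr.
Qed.

Lemma cholesky_factor_unit n (L : 'M[R]_n) : cholesky_factor L -> L \in unitmx.
Proof.
move=> [Lt Ld]; rewrite unitmxE (det_trig Lt) unitfE prodf_seq_neq0/=.
by apply/allP => i _; rewrite lt0r_neq0.
Qed.

Lemma cholesky_factorM n (L M : 'M[R]_n) :
  cholesky_factor L -> cholesky_factor M -> cholesky_factor (L *m M).
Proof.
move=> [/is_trig_mxP Lt Ld] [/is_trig_mxP Mt Md]; split.
  apply/is_trig_mxP => i j ij; rewrite mxE big1// => k _.
  have [ik|ki] := ltnP i k; first by rewrite Lt// mul0r.
  by rewrite Mt ?mulr0// (leq_ltn_trans ki).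
move=> i; rewrite mxE (bigD1 i)//= big1 ?addr0 ?mulr_gt0// => k ki.
case: (ltngtP i k) => [ik|ki'|/val_inj ik]; first by rewrite Lt// mul0r.
  by rewrite Mt// mulr0.
by rewrite ik eqxx in ki.
Qed.

Lemma pdmx_det_gt0 n (A : 'M[R]_n) : A^T = A -> pdmx A -> 0 < \det A.
Proof.
move=> As Ap; have [AE /cholesky_factor_unit] := cholP As Ap.
by rewrite -[in X in _ -> X]AE det_mulmx det_tr -expr2 unitmxE unitfE exprn_even_gt0.
Qed.

Lemma pdmx_unit n (A : 'M[R]_n) : A^T = A -> pdmx A -> A \in unitmx.
Proof. by move=> As /(pdmx_det_gt0 As); rewrite unitmxE unitfE => /lt0r_neq0. Qed.

Lemma sumr_CauchySchwarz n (a b : 'I_n -> R) :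
  (\sum_i a i * b i) ^+ 2 <= (\sum_i a i ^+ 2) * (\sum_i b i ^+ 2).
Proof.
set A := \sum_i a i ^+ 2; set B := \sum_i b i ^+ 2; set p := \sum_i a i * b i.
have [A0|A0] := eqVneq A 0.
  have a0 i : a i = 0.
    move: A0 => /eqP; rewrite psumr_eq0 => [/allP/(_ i (mem_index_enum i))|j _].
      by rewrite /= sqrf_eq0 => /eqP.
    exact: sqr_ge0.
  by rewrite A0 mul0r /p big1 ?expr0n// => i _; rewrite a0 mul0r.
have {}A0 : 0 < A by rewrite lt0r A0 sumr_ge0// => i _; exact: sqr_ge0.
have : 0 <= \sum_i (p * a i - A * b i) ^+ 2 by apply: sumr_ge0 => i _; exact: sqr_ge0.
have -> : \sum_i (p * a i - A * b i) ^+ 2 = A * (A * B - p ^+ 2).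
  under eq_bigr => i _.
    rewrite (_ : _ ^+ 2 = p ^+ 2 * a i ^+ 2 - 2 * p * A * (a i * b i) + A ^+ 2 * b i ^+ 2); last by ring.
    over.
  rewrite big_split/= sumrB -!mulr_sumr -/A -/B -/p; ring.
by rewrite pmulr_rge0// subr_ge0.
Qed.

(** The square of the Frobenius norm, used as a bound for the square of the operator norm. *)
Definition frob n m (A : 'M[R]_(n, m)) := \sum_i \sum_j A i j ^+ 2.

Lemma frob_ge0 n m (A : 'M[R]_(n, m)) : 0 <= frob A.
Proof. by apply: sumr_ge0 => i _; apply: sumr_ge0 => j _; exact: sqr_ge0. Qed.

Lemma qf1_mul_le n m (A : 'M[R]_(n, m)) v : qf 1%:M (v *m A) <= frob A * qf 1%:M v.
Proof.
rewrite !qf1E /frob exchange_big/= mulr_suml ler_sum// => j _.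
by rewrite mxE mulrC; exact: sumr_CauchySchwarz.
Qed.

(** For symmetric A this says that all eigenvalues lie in [1/m, m]; the form by inequalities avoids
    any spectral theory and behaves well under congruence. *)
Definition pinched n (m : R) (A : 'M[R]_n) :=
  forall v, m^-1 * qf 1%:M v <= qf A v <= m * qf 1%:M v.

Lemma pinched_le n (m m' : R) (A : 'M[R]_n) : 0 < m -> m <= m' -> pinched m A -> pinched m' A.
Proof.
move=> m0 mm' pA v; have /andP[h1 h2] := pA v.
rewrite (le_trans _ h1) ?(le_trans h2) ?ler_wpM2r ?qf1_ge0//.
by rewrite lef_pV2// posrE// (lt_le_trans m0).
Qed.

Lemma pinched_pdmx n (m : R) (A : 'M[R]_n) : 0 < m -> pinched m A -> pdmx A.
Proof.
move=> m0 pA v v0; have /andP[+ _] := pA v; apply: lt_le_trans.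
by rewrite mulr_gt0 ?invr_gt0//; exact: pdmx1.
Qed.

Lemma pdmx_pinched n (A : 'M[R]_n) : A^T = A -> pdmx A ->
  exists m : nat, pinched m.+1%:R A.
Proof.
move=> As Ap; have [AE /cholesky_factor_unit LU] := cholP As Ap.
set L := chol A in AE LU.
(* With A = L L^T, the norm of L gives the upper bound and the norm of its inverse the lower one;
   the sum dominates both. *)
pose m := Num.trunc (frob L + frob (invmx L)).
have mle : frob L + frob (invmx L) <= m.+1%:R by apply: ltW; exact: truncnS_gt.
exists m => v; rewrite -AE qf_gram; apply/andP; split.
  rewrite ler_pdivrMl//; rewrite -{1}(mulmxK LU v).
  rewrite (le_trans (qf1_mul_le _ _))// ler_wpM2r ?qf1_ge0//.
  by rewrite (le_trans _ mle)// lerDr frob_ge0.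
rewrite (le_trans (qf1_mul_le _ _))// ler_wpM2r ?qf1_ge0//.
by rewrite (le_trans _ mle)// lerDl frob_ge0.
Qed.

End quadratic_forms.

(** * Homomorphisms from GL(n) to the reals *)

Section gl_characters.
Variable R : realType.

Lemma natmul_bounded_le0 (x B : R) : (forall N : nat, N%:R * x <= B) -> x <= 0.
Proof.
move=> NxB; rewrite leNgt; apply/negP => x0.
have := NxB (Num.trunc (B / x)).+1; rewrite -ler_pdivlMr//.
by apply/negP; rewrite -ltNge; exact: truncnS_gt.
Qed.

(** The defect f x - x f(1) is additive, and N times it equals its value at the fractional part of N
    x. It is therefore bounded uniformly in N, hence zero. *)
Lemma additive_locally_bounded (f : R -> R) (d M : R) : 0 < d ->
  (forall x y, f (x + y) = f x + f y) ->
  (forall x, `|x| < d -> `|f x| <= M) -> forall x, f x = x * f 1.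
Proof.
move=> d0 fD fM.
have f0 : f 0 = 0 by apply: (addrI (f 0)); rewrite -fD !addr0.
have fMn (k : nat) x : f (k%:R * x) = k%:R * f x.
  elim: k => [|k IH]; first by rewrite !mul0r.
  by rewrite -natr1 !mulrDl !mul1r fD IH.
have fN x : f (- x) = - f x by apply: (addrI (f x)); rewrite -fD !subrr.
pose K := (Num.trunc d^-1).+1.
have Kd : K%:R^-1 < d by rewrite invf_plt ?posrE//; exact: truncnS_gt.
have K0 : 0 < K%:R :> R by rewrite ltr0n.
have fb x : 0 <= x < 1 -> `|f x| <= K%:R * M.
  move=> /andP[x0 x1]; rewrite -{1}(mulVKf (lt0r_neq0 K0) x) fMn normrM.
  rewrite (gtr0_norm K0) ler_pM2l// fM// ger0_norm ?mulr_ge0 ?invr_ge0 ?(ltW K0)//.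
  by rewrite (le_lt_trans _ Kd)// ler_piMr ?invr_ge0 ?(ltW K0)// ltW.
have key x (N : nat) : 0 <= x -> N%:R * `|f x - x * f 1| <= K%:R * M + `|f 1|.
  move=> x0; have Nx0 : 0 <= N%:R * x by rewrite mulr_ge0.
  pose m := Num.trunc (N%:R * x).
  have /andP[m1 m2] : m%:R <= N%:R * x < m.+1%:R by exact: truncn_itv.
  have -> : N%:R * `|f x - x * f 1| = `|N%:R * (f x - x * f 1)|.
    by rewrite normrM normr_nat.
  have -> : N%:R * (f x - x * f 1) = f (N%:R * x - m%:R) - (N%:R * x - m%:R) * f 1.
    by rewrite fD fN fMn -{1}(mulr1 m%:R) fMn; ring.
  have b0 : 0 <= N%:R * x - m%:R < 1.
    by rewrite subr_ge0 m1/= ltrBlDr addrC natr1.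
  rewrite (le_trans (ler_normB _ _))// lerD ?fb// normrM ler_piMl//.
  by have /andP[b1 b2] := b0; rewrite ger0_norm// ltW.
have pos x : 0 <= x -> f x = x * f 1.
  move=> x0; apply/eqP; rewrite -subr_eq0 -normr_le0.
  by apply: natmul_bounded_le0 => N; exact: key.
move=> x; have [/pos//|x0] := leP 0 x.
by rewrite -{1}(opprK x) fN pos ?oppr_ge0 ?(ltW x0)// mulNr opprK.
Qed.

Lemma ln_prod (I : finType) (a : I -> R) : (forall i, 0 < a i) ->
  ln (\prod_i a i) = \sum_i ln (a i).
Proof.
move=> a0; suff [] : 0 < \prod_i a i /\ ln (\prod_i a i) = \sum_i ln (a i) by [].
elim/big_ind2: _ => [|x1 x2 y1 y2 [x10 xE] [y10 yE]|i _]; first by rewrite ln1.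
  by rewrite mulr_gt0// lnM ?posrE// xE yE.
by [].
Qed.

Definition unipotent n (A : 'M[R]_n) := is_trig_mx A /\ forall i, A i i = 1.

Lemma unipotent_unit n (A : 'M[R]_n) : unipotent A -> A \in unitmx.
Proof.
by move=> [At Ad]; apply: cholesky_factor_unit; split=> // i; rewrite Ad.
Qed.

Lemma unipotentM n (A B : 'M[R]_n) : unipotent A -> unipotent B -> unipotent (A *m B).
Proof.
move=> [/is_trig_mxP At Ad] [/is_trig_mxP Bt Bd]; split.
  apply/is_trig_mxP => i j ij; rewrite mxE big1// => k _.
  have [ik|ki] := ltnP i k; first by rewrite At// mul0r.
  by rewrite Bt ?mulr0// (leq_ltn_trans ki).
move=> i; rewrite mxE (bigD1 i)//= big1 ?addr0 ?Ad ?Bd ?mulr1// => k ki.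
case: (ltngtP i k) => [ik|ki'|/val_inj ik]; first by rewrite At// mul0r.
  by rewrite Bt// mulr0.
by rewrite ik eqxx in ki.
Qed.

Lemma diag_mx_unit n (d : 'rV[R]_n) : (forall i, d 0 i != 0) -> diag_mx d \in unitmx.
Proof.
move=> d0; rewrite unitmxE det_diag unitfE prodf_seq_neq0.
by apply/allP => i _ /=; exact: d0.
Qed.

Section hom.
Variables (n : nat) (F : 'M[R]_n -> R).
(** F is defined on all matrices and multiplicative only on units, which keeps dependent pairs out
    of the matrix computations. *)
Hypothesis FM : forall A B, A \in unitmx -> B \in unitmx -> F (A *m B) = F A + F B.

Let F1 : F 1%:M = 0.
Proof. by apply: (addrI (F 1%:M)); rewrite -FM ?unitmx1// mulmx1 addr0. Qed.

Let FV A : A \in unitmx -> F (invmx A) = - F A.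
Proof.
by move=> AU; apply: (addrI (F A)); rewrite -FM ?unitmx_inv// mulmxV// F1 subrr.
Qed.

Lemma gl_hom_conj A D : A \in unitmx -> D \in unitmx ->
  F (D *m A *m invmx D) = F A.
Proof.
move=> AU DU; rewrite !FM ?unitmx_mul ?AU ?DU ?unitmx_inv// FV//; ring.
Qed.

Variables (e M : R).
Hypothesis e0 : 0 < e.
Hypothesis Fb : forall A, A \in unitmx ->
  (forall i j, `|A i j - (1%:M : 'M[R]_n) i j| < e) -> `|F A| <= M.

(* Conjugating by diag(t^i) with t small contracts the off-diagonal part. *)
Let unipotent_bounded A : unipotent A -> `|F A| <= M.
Proof.
move=> UA; have [/is_trig_mxP At Ad] := UA.
pose S := \sum_i \sum_j `|A i j|.
have Sij i j : `|A i j| <= S.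
  rewrite /S (bigD1 i)//= (bigD1 j)//= -addrA lerDl addr_ge0//.
    by apply: sumr_ge0.
  by apply: sumr_ge0 => k _; exact: sumr_ge0.
have S0 : 0 <= S by apply: sumr_ge0 => k _; exact: sumr_ge0.
pose t := Num.min 1 (e / (S + 1)).
have t0 : 0 < t by rewrite lt_min ltr01 divr_gt0// ltr_wpDl.
have t1 : t <= 1 by rewrite ge_min lexx.
have tS : t * S < e.
  rewrite (@le_lt_trans _ _ (e / (S + 1) * S))//.
    by rewrite ler_wpM2r// ge_min lexx orbT.
  by rewrite mulrAC ltr_pdivrMr ?ltr_wpDl// ltr_pM2l// ltrDl.
pose D : 'M[R]_n := diag_mx (\row_i t ^+ i).
have DU : D \in unitmx.
  by apply: diag_mx_unit => i; rewrite mxE expf_neq0// lt0r_neq0.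
have DE : invmx D = diag_mx (\row_i (t ^+ i)^-1).
  rewrite -[RHS]mul1mx -(mulVmx DU) -mulmxA.
  rewrite mulmx_diag (_ : diag_mx _ = 1%:M) ?mulmx1//.
  rewrite -diag_const_mx; congr diag_mx; apply/rowP => i; rewrite !mxE divff//.
  by rewrite expf_neq0// lt0r_neq0.
rewrite -(gl_hom_conj (unipotent_unit UA) DU) Fb//.
  by rewrite !unitmx_mul DU unitmx_inv DU unipotent_unit.
move=> i j; rewrite DE mul_mx_diag mul_diag_mx !mxE.
case: (ltngtP i j) => [ij|ji|/val_inj ->].
- by rewrite At// mulr0 mul0r (negbTE (_ : i != j)) ?subr0 ?normr0// neq_ltn ij.
- have -> : (i == j) = false by apply/negbTE; rewrite neq_ltn ji orbT.
  rewrite subr0 mulrAC -expfB// normrM mulrC (le_lt_trans _ tS)//.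
  rewrite mulrC ler_pM// ger0_norm ?exprn_ge0 ?(ltW t0)//.
  by rewrite -(subnSK ji) exprS ler_piMr ?exprn_ile1 ?(ltW t0).
- by rewrite eqxx Ad mulr1 divff ?subrr ?normr0// expf_neq0// lt0r_neq0.
Qed.

(** All powers of A are unipotent, so N |F A| stays below M for every N. *)
Let unipotent_eq0 A : unipotent A -> F A = 0.
Proof.
move=> UA; apply/eqP; rewrite -normr_le0; apply: (@natmul_bounded_le0 _ M) => N.
have [B UB FB] : exists2 B, unipotent B & F B = N%:R * F A.
  elim: N => [|N [B UB FB]].
    exists 1%:M; last by rewrite F1 mul0r.
    by split=> [|i]; [exact: scalar_mx_is_trig|rewrite mxE eqxx].
  exists (B *m A); first exact: unipotentM.
  by rewrite FM ?unipotent_unit// FB -natr1 mulrDl mul1r.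
by have := unipotent_bounded UB; rewrite FB normrM normr_nat.
Qed.

Let F_diag_part L : cholesky_factor L -> F L = F (diag_mx (\row_i L i i)).
Proof.
move=> [/is_trig_mxP Lt Ld]; set D := diag_mx _.
have DU : D \in unitmx by apply: diag_mx_unit => i; rewrite mxE lt0r_neq0.
pose D' : 'M[R]_n := diag_mx (\row_i (L i i)^-1).
have DD' : D *m D' = 1%:M.
  rewrite mulmx_diag -diag_const_mx; congr diag_mx; apply/rowP => i.
  by rewrite !mxE divff// lt0r_neq0.
have D'U : D' \in unitmx.
  by apply: diag_mx_unit => i; rewrite mxE invr_eq0 lt0r_neq0.
have UL : unipotent (D' *m L).
  split; [apply/is_trig_mxP => i j ij|move=> i]; rewrite mul_diag_mx !mxE.
    by rewrite (Lt i j ij) mulr0.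
  by rewrite mulVf// lt0r_neq0.
have -> : L = D *m (D' *m L) by rewrite mulmxA DD' mul1mx.
by rewrite FM// ?unipotent_unit// (unipotent_eq0 UL) addr0.
Qed.

Hypothesis FO : forall A, A *m A^T = 1%:M -> F A = 0.

Let dil (i : 'I_n) (a : R) : 'M[R]_n := diag_mx (\row_j if j == i then a else 1).

Let dil_unit i a : a != 0 -> dil i a \in unitmx.
Proof.
by move=> a0; apply: diag_mx_unit => j; rewrite mxE; case: ifP => // _; exact: oner_neq0.
Qed.

(** In the variable t = ln a this is an additive function, bounded near 0 because the dilation is
    then close to 1. *)
Let F_dil i a : 0 < a -> F (dil i a) = ln a * F (dil i (expR 1)).
Proof.
move=> a0; pose f t := F (dil i (expR t)).
have fD x y : f (x + y) = f x + f y.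
  rewrite /f -FM ?dil_unit ?gt_eqF ?expR_gt0//; congr F.
  rewrite mulmx_diag; congr diag_mx; apply/rowP => j; rewrite !mxE expRD.
  by case: ifP => // _; rewrite mulr1.
have [d d0 fb] : exists2 d, 0 < d & forall x, `|x| < d -> `|f x| <= M.
  have : {for 0, continuous (@expR R)} by exact: continuous_expR.
  move=> /cvgrPdist_lt /(_ e e0) /nbhs_norm0P [d d0 dP].
  exists d => // x xd; apply: Fb; first by rewrite dil_unit// gt_eqF// expR_gt0.
  move=> j k; rewrite !mxE; have [->|jk] := eqVneq j k; last by rewrite subrr normr0.
  rewrite !mulr1n; case: ifP => _; last by rewrite subrr normr0.
  by have := dP x xd; rewrite /= expR0 distrC.
by rewrite -{1}(lnK a0) -/(f (ln a)) (additive_locally_bounded d0 fD fb).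
Qed.

(** A transposition matrix is orthogonal, hence killed by F, and it conjugates one dilation into the
    other. This is what makes a single exponent s serve all diagonal entries. *)
Let F_dil_swap i j a : a != 0 -> F (dil i a) = F (dil j a).
Proof.
move=> a0; pose P : 'M[R]_n := perm_mx (tperm i j).
have PT : P^T = P by rewrite /P tr_perm_mx tpermV.
have PP : P *m P = 1%:M by rewrite /P -perm_mxM tperm2 perm_mx1.
have PU : P \in unitmx by rewrite unitmx_perm.
have F_P : F P = 0 by apply: FO; rewrite PT.
have -> : dil i a = P *m dil j a *m P.
  have {2}-> : P = perm_mx (tperm i j)^-1%g by rewrite tpermV.
  rewrite -mulmxA -col_permE -row_permE; apply/matrixP => k l; rewrite !mxE.
  rewrite (inj_eq perm_inj); congr (_ *+ _).
  by rewrite (canF_eq (tpermK i j)) tpermR.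
by rewrite !FM ?unitmx_mul ?PU ?dil_unit// F_P add0r addr0.
Qed.

Let F_diag (a : 'I_n -> R) : (forall i, 0 < a i) ->
  F (diag_mx (\row_i a i)) = \sum_i F (dil i (a i)).
Proof.
move=> a0.
have key (s : seq 'I_n) : uniq s ->
    F (diag_mx (\row_i if i \in s then a i else 1)) = \sum_(i <- s) F (dil i (a i)).
  elim: s => [_|i s IH /= /andP[nis us]].
    rewrite big_nil -F1; congr F; rewrite -diag_const_mx; congr diag_mx.
    by apply/rowP => j; rewrite !mxE.
  rewrite big_cons -IH// -FM ?dil_unit ?lt0r_neq0//; last first.
    by apply: diag_mx_unit => j; rewrite mxE; case: ifP => _; rewrite ?lt0r_neq0 ?oner_neq0.
  congr F; rewrite mulmx_diag; congr diag_mx; apply/rowP => j; rewrite !mxE in_cons.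
  have [->|ji] /= := eqVneq j i; first by rewrite (negbTE nis) mulr1.
  by rewrite mul1r.
rewrite -key ?index_enum_uniq//; congr (F (diag_mx _)); apply/rowP => j.
by rewrite !mxE mem_index_enum.
Qed.

(** Write A = L k with L the Cholesky factor of A A^T and k orthogonal. F sees only the diagonal of
    L, and |det A| = det L. *)
Lemma gl_hom_ln_det : exists s, forall A, A \in unitmx -> F A = s * ln `|\det A|.
Proof.
have [s sP] : exists s, forall i a, 0 < a -> F (dil i a) = s * ln a.
  have [i0|n0] := pickP (fun i : 'I_n => true); last by exists 0 => i; have := n0 i.
  move=> _; exists (F (dil i0 (expR 1))) => i a a0.
  by rewrite (F_dil_swap i i0) ?lt0r_neq0// F_dil// mulrC.
exists s => A AU.
have GU : A *m A^T \in unitmx by rewrite unitmx_mul unitmx_tr AU.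
have Gs : (A *m A^T)^T = A *m A^T by rewrite trmx_mul trmxK.
have [LE Lc] := cholP Gs (pdmx_gram AU).
set L := chol _ in LE Lc.
have LU := cholesky_factor_unit Lc.
have [Lt Ld] := Lc.
have detL : 0 < \det L by rewrite (det_trig Lt) prodr_gt0.
have -> : `|\det A| = \det L.
  apply/eqP; rewrite -(@eqrXn2 _ 2%N)// ?(ltW detL)//; apply/eqP.
  rewrite real_normK ?num_real// !expr2 -{2}(det_tr A) -{2}(det_tr L) -!det_mulmx.
  by rewrite LE.
have -> : F A = F L.
  (* L and A have the same Gram matrix, so L^-1 A is orthogonal. *)
  have kO : (invmx L *m A) *m (invmx L *m A)^T = 1%:M.
    rewrite trmx_mul mulmxA -(mulmxA (invmx L)) -LE mulmxA mulVmx// mul1mx.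
    by rewrite trmx_inv mulmxV// unitmx_tr.
  rewrite -{1}(mulKVmx LU A) FM// ?unitmx_mul ?unitmx_inv ?LU//.
  by rewrite (FO kO) addr0.
rewrite F_diag_part// F_diag// (det_trig Lt) ln_prod// mulr_sumr.
by apply: eq_bigr => i _; exact: sP.
Qed.

End hom.
End gl_characters.

(** * Cholesky group structure on Sym+ *)

Section cholesky_group.
Variable R : realType.

Lemma pdmx_schur n (A : 'M[R]_(1 + n)) : A^T = A -> pdmx A ->
  let c := (Num.sqrt (ulsubmx A 0 0))^-1 *: dlsubmx A in
  let C := drsubmx A - c *m c^T in 0 < ulsubmx A 0 0 /\ C^T = C /\ pdmx C.
Proof.
move=> As + /=; rewrite (sym_block As).
set a := A 0 0; set b := ursubmx A; set D := drsubmx A => Ap.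
have a0 := pdmx_block_gt0 Ap.
have Ds : D^T = D by rewrite /D trmx_drsub As.
rewrite block_mxKul block_mxKdl block_mxKdr mxE eqxx mulr1n.
have -> : ((Num.sqrt a)^-1 *: b^T) *m ((Num.sqrt a)^-1 *: b^T)^T = a^-1 *: (b^T *m b).
  rewrite [X in _ *m X]linearZ/= trmxK -scalemxAl -scalemxAr scalerA -invfM -expr2 sqr_sqrtr//.
  exact: ltW.
split=> //; split; first by rewrite linearB/= linearZ/= trmx_mul trmxK Ds.
move: Ap; rewrite -{1}(subrK (a^-1 *: (b^T *m b)) D).
by move=> /(pdmx_block_ul _ _ (lt0r_neq0 a0)) [].
Qed.

(** Stated for families so that the induction can pass to the Schur complement, which is again a
    continuous family of positive definite matrices. Positivity of the corner makes the division
    continuous. *)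
Lemma chol_continuous (T : topologicalType) n (F : T -> 'M[R]_n) :
  (forall t, (F t)^T = F t) -> (forall t, pdmx (F t)) ->
  continuous F -> continuous (fun t => chol (F t)).
Proof.
elim: n F => [|n IH] F.
  by move=> _ _ Fc; exact: Fc.
change (T -> 'M[R]_(1 + n)) in F => Fs Fp Fc.
have Fij i j : continuous (fun t => F t i j).
  by move=> t; exact: (continuous_comp (Fc t) (@coord_continuous _ _ _ i j (F t))).
pose s t := Num.sqrt (ulsubmx (F t) 0 0).
have sc : continuous s.
  move=> t; apply: continuous_comp; last exact: sqrt_continuous.
  rewrite (_ : (fun t => _) = (fun t => F t (lshift n 0) (lshift n 0))); first exact: Fij.
  by apply/funext => u; rewrite !mxE.
have s0 t : 0 < s t by rewrite sqrtr_gt0; have [] := pdmx_schur (Fs t) (Fp t).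
pose c t := (s t)^-1 *: dlsubmx (F t).
have cc : continuous c.
  apply: continuous_mx => i j.
  rewrite (_ : (fun t => _) = (fun t => (s t)^-1 * F t (rshift 1 i) (lshift n j))); last first.
    by apply/funext => u; rewrite !mxE.
  move=> t; apply: cvgM; last exact: Fij.
  by apply: cvgV; [rewrite lt0r_neq0|exact: sc].
have Cc : continuous (fun t => chol (drsubmx (F t) - c t *m (c t)^T)).
  apply: IH => [t|t|]; try by have [_ []] := pdmx_schur (Fs t) (Fp t).
  have Dc : continuous (fun t => drsubmx (F t)).
    apply: continuous_mx => i j.
    rewrite (_ : (fun t => _) = (fun t => F t (rshift 1 i) (rshift 1 j))); first exact: Fij.
    by apply/funext => u; rewrite !mxE.
  have ccT : continuous (fun t => c t *m (c t)^T).
    by apply: continuous_mulmx => //; exact: continuous_trmx.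
  by move=> t; apply: cvgB; [exact: Dc|exact: ccT].
apply: (@continuous_mx R T (1 + n) (1 + n)) => i j.
case: (split_ordP i) => i' ->; case: (split_ordP j) => j' ->.
- rewrite (_ : (fun t => _) = s)//; apply/funext => t.
  by rewrite /= block_mxEul (ord1 i') (ord1 j') mxE eqxx.
- have -> : (fun t => chol (F t) (lshift n i') (rshift 1 j')) = cst 0.
    by apply/funext => t; rewrite /= block_mxEur mxE.
  exact: cst_continuous.
- rewrite (_ : (fun t => _) = (fun t => c t i' j')).
    by move=> t; exact: (continuous_comp (cc t) (@coord_continuous _ _ _ i' j' (c t))).
  by apply/funext => t; rewrite /= block_mxEdl.
- rewrite (_ : (fun t => _) = (fun t => chol (drsubmx (F t) - c t *m (c t)^T) i' j')).
    by move=> t; exact: (continuous_comp (Cc t) (@coord_continuous _ _ _ i' j' _)).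
  by apply/funext => t; rewrite /= block_mxEdr.
Qed.

Lemma chol1 n : chol (1%:M : 'M[R]_n) = 1%:M.
Proof.
rewrite -{1}(mulmx1 1%:M) -{2}trmx1 chol_gram//; split=> [|i].
  exact: scalar_mx_is_trig.
by rewrite mxE eqxx.
Qed.

(** If M is the Cholesky factor of L^-1 L^-T, then L M is a Cholesky factor with Gram matrix 1.
    Uniqueness gives L M = 1, with no computation of the inverse of a triangular matrix. *)
Lemma cholesky_factorV n (L : 'M[R]_n) : cholesky_factor L -> cholesky_factor (invmx L).
Proof.
move=> Lc; have LU := cholesky_factor_unit Lc.
have VU : invmx L \in unitmx by rewrite unitmx_inv.
have Gs : (invmx L *m (invmx L)^T)^T = invmx L *m (invmx L)^T by rewrite trmx_mul trmxK.
have [ME Mc] := cholP Gs (pdmx_gram VU); set M := chol _ in ME Mc.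
have : L *m M = 1%:M.
  rewrite -(chol_gram (cholesky_factorM Lc Mc)) -[RHS]chol1; congr chol.
  rewrite trmx_mul mulmxA -(mulmxA L) ME mulmxA mulmxV// mul1mx.
  by rewrite -trmx_mul mulmxV// trmx1.
by move=> LM; rewrite -[invmx L]mulmx1 -LM mulKmx.
Qed.

Section SymPos.
Variable n : nat.
Implicit Types (x y z : SymPos R n) (g h : GL R n).

Definition posmx z : 'M[R]_n := val z.

Lemma posmx_inj : injective posmx.
Proof. by move=> x y xy; apply/val_inj/val_inj. Qed.

Lemma posmx_sym z : (posmx z)^T = posmx z. Proof. exact: Symmx_tr. Qed.

Lemma posmx_pd z : pdmx (posmx z).
Proof. by have /set_mem := valP z. Qed.

Lemma det_posmx_gt0 z : 0 < \det (posmx z).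
Proof. exact: (pdmx_det_gt0 (posmx_sym z) (posmx_pd z)). Qed.

Lemma choleskyP z : cholesky_factor (chol (posmx z)).
Proof. by have [] := cholP (posmx_sym z) (posmx_pd z). Qed.

Lemma cholesky_gram z : chol (posmx z) *m (chol (posmx z))^T = posmx z.
Proof. by have [] := cholP (posmx_sym z) (posmx_pd z). Qed.

Definition cholesky z : GL R n := MkGL (cholesky_factor_unit (choleskyP z)).

Lemma posmx_gram g : posmx (gram g) = g *m g^T.
Proof. by rewrite /posmx /= mulmx1. Qed.

Lemma gram_cholesky z : gram (cholesky z) = z.
Proof. by apply: posmx_inj; rewrite posmx_gram cholesky_gram. Qed.

Lemma pos_act_subproof g z : congr_act g (val z) \in @posdef R n.
Proof. by apply/mem_set => /=; apply/(pdmx_congr _ (GLmx_unit g)); exact: posmx_pd. Qed.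

Definition pos_act g z : SymPos R n := exist _ (congr_act g (val z)) (pos_act_subproof g z).

Lemma posmx_act g z : posmx (pos_act g z) = g *m posmx z *m g^T.
Proof. by []. Qed.

Lemma pos_actM g h z : pos_act (g * h)%g z = pos_act g (pos_act h z).
Proof. by apply/val_inj; rewrite /= congr_actM. Qed.

Lemma pos_act1 z : pos_act 1%g z = z.
Proof. by apply/val_inj; rewrite /= congr_act1. Qed.

Lemma pos_act_gram g h : pos_act g (gram h) = gram (g * h)%g.
Proof. by apply/val_inj; rewrite /= congr_actM. Qed.

(* [SymPos] is made a group by transporting the product of Cholesky factors. *)
Definition pos_mul x y := pos_act (cholesky x) y.
Definition pos_inv x := gram (cholesky x)^-1%g.

Lemma cholesky_gramK g : cholesky_factor (GLmx g) -> cholesky (gram g) = g.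
Proof. by move=> gc; apply/val_inj; rewrite /= posmx_gram chol_gram. Qed.

(** Cholesky factors are closed under products, so [cholesky] is a homomorphism; the group laws
    below are inherited from GL(n) through it. *)
Lemma cholesky_mul x y : cholesky (pos_mul x y) = (cholesky x * cholesky y)%g.
Proof.
rewrite /pos_mul -[y in pos_act _ y]gram_cholesky pos_act_gram cholesky_gramK//.
exact: cholesky_factorM (choleskyP x) (choleskyP y).
Qed.

Lemma cholesky_inv x : cholesky (pos_inv x) = (cholesky x)^-1%g.
Proof. by rewrite cholesky_gramK//; exact: cholesky_factorV (choleskyP x). Qed.

Lemma pos_mulA x y z : pos_mul (pos_mul x y) z = pos_mul x (pos_mul y z).
Proof. by rewrite {1}/pos_mul cholesky_mul pos_actM. Qed.

Lemma pos_mulVK x y : pos_mul (pos_inv x) (pos_mul x y) = y.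
Proof. by rewrite /pos_mul cholesky_inv -pos_actM mulVg pos_act1. Qed.

Lemma pos_invK x : pos_inv (pos_inv x) = x.
Proof. by rewrite {1}/pos_inv cholesky_inv invgK gram_cholesky. Qed.

Lemma pos_invM x y : pos_inv (pos_mul x y) = pos_mul (pos_inv y) (pos_inv x).
Proof. by rewrite {1}/pos_inv cholesky_mul invgM /pos_mul cholesky_inv pos_act_gram. Qed.

Lemma Symmx_continuous : continuous (@Symmx R n).
Proof. exact: initial_continuous. Qed.

Lemma SymPos_val_continuous : continuous (val : SymPos R n -> Sym R n).
Proof. exact: (@initial_continuous (set_type (@posdef R n)) _ set_val). Qed.

Lemma posmx_continuous : continuous posmx.
Proof.
move=> z; apply: (@continuous_comp _ _ _ (val : SymPos R n -> Sym R n) (@Symmx R n)).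
  exact: SymPos_val_continuous.
exact: Symmx_continuous.
Qed.

Lemma cholesky_continuous : continuous cholesky.
Proof.
apply: (@continuous_comp_initial (GL R n) _ _ (@GLmx R n)).
by apply: chol_continuous; [exact: posmx_sym|exact: posmx_pd|exact: posmx_continuous].
Qed.

Lemma gram_continuous : continuous (@gram R n).
Proof.
apply: (@continuous_comp_initial (set_type (@posdef R n)) _ _ set_val).
exact: congr_act_continuous.
Qed.

Local Notation pi_X := (\pi_(coset_space (@orthogonal_group R n))).

Lemma coset_gram_pi g : coset_gram (pi_X g) = gram g.
Proof. by apply: posmx_inj; rewrite posmx_gram /posmx coset_gramE. Qed.

(** A representative h and the Cholesky factor L of h h^T have the same Gram matrix, so L^-1 h is
    orthogonal and both lie in one coset. *)
Lemma coset_gramK : cancel (@coset_gram R n) (fun z => pi_X (cholesky z)).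
Proof.
move=> x; rewrite -[RHS]reprK; set h := repr x; rewrite -[x]reprK -/h coset_gram_pi.
apply/eqquotP; rewrite /= /coset_rel; apply/eqP => /=.
have hU := GLmx_unit h; set L := chol _.
have LU : L \in unitmx := cholesky_factor_unit (choleskyP (gram h)).
have LE : L *m L^T = h *m h^T by rewrite /L cholesky_gram posmx_gram.
rewrite trmx_mul mulmxA -(mulmxA (invmx L)) -LE mulmxA mulVmx// mul1mx.
by rewrite -trmx_mul mulVmx// trmx1.
Qed.

Lemma coset_gram_cholesky : cancel (fun z => pi_X (cholesky z)) (@coset_gram R n).
Proof. by move=> z; rewrite coset_gram_pi gram_cholesky. Qed.

Lemma coset_gram_continuous : continuous (@coset_gram R n).
Proof.
apply/quotient_continuous; rewrite (_ : _ \o _ = @gram R n); last first.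
  by apply/funext => g /=; exact: coset_gram_pi.
exact: gram_continuous.
Qed.

Lemma coset_gram_homeomorphism : homeomorphism (@coset_gram R n).
Proof.
split; first exact: coset_gram_continuous.
exists (fun z => pi_X (cholesky z)); split.
- exact: coset_gramK.
- exact: coset_gram_cholesky.
- move=> z; apply: continuous_comp; first exact: cholesky_continuous.
  exact: pi_continuous.
Qed.

Lemma coset_gram_act g (x : coset_space (@orthogonal_group R n)) : coset_gram (coset_act g x) = pos_act g (coset_gram x).
Proof. by rewrite -[x]reprK coset_actE !coset_gram_pi pos_act_gram. Qed.

End SymPos.
End cholesky_group.

(** * Borel measurability *)

Section borel_sets.
Variable R : realType.

Lemma open_borel_measurable (T : ptopologicalType) (U : set T) :
  open U -> measurable (U : set (borel T)).
Proof. exact: sub_sigma_algebra. Qed.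

Lemma closed_borel_measurable (T : ptopologicalType) (U : set T) :
  closed U -> measurable (U : set (borel T)).
Proof.
move=> cU; rewrite -(setCK U); apply: measurableC.
by apply: open_borel_measurable; exact: closed_openC.
Qed.

Lemma borel_measurable_fun d (T : measurableType d) (S : ptopologicalType)
    (f : T -> borel S) :
  (forall U : set S, open U -> measurable (f @^-1` U)) -> measurable_fun setT f.
Proof.
move=> fU; apply: (@measurability _ _ T (borel S) setT f (@open S)) => //.
by move=> _ [U oU <-]; rewrite setTI; exact: fU.
Qed.

Lemma continuous_borel (S T : ptopologicalType) (f : S -> T) : continuous f ->
  measurable_fun setT (f : borel S -> borel T).
Proof.
move=> /continuousP fc; apply: borel_measurable_fun => U oU.
by apply: open_borel_measurable; exact: fc.
Qed.

Lemma continuous_borel_real (S : ptopologicalType) (f : S -> R) : continuous f ->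
  measurable_fun setT (f : borel S -> R).
Proof.
move=> /continuousP fc; apply: (measurability _ (RGenOpens.measurableE R)).
move=> _ [_ [a [b ->] <-]]; rewrite setTI.
by apply: open_borel_measurable; apply: fc; exact: interval_open.
Qed.

(* Open sets of matrices are countable unions of rational boxes. *)
Lemma measurable_preimage_open_mx d (T : measurableType d) m n (f : T -> 'M[R]_(m, n)) :
  (forall i j, measurable_fun setT (fun t => f t i j)) ->
  forall U : set 'M[R]_(m, n), open U -> measurable (f @^-1` U).
Proof.
move=> mf U oU.
pose box (qr : 'M[rat]_(m, n) * rat) : set 'M[R]_(m, n) :=
  [set A | forall i j, `|ratr (qr.1 i j) - A i j| < ratr qr.2].
pose F qr : set T := [set t | box qr `<=` U /\ box qr (f t)].
have -> : f @^-1` U = \bigcup_qr F qr.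
  apply/seteqP; split => [t Ut|t [qr _ [bU bt]]]; last exact: bU.
  have /nbhs_ballP[e /= e0 eU] : nbhs (f t) U by exact: open_nbhs_nbhs.
  have [r] : exists r : rat, ratr r \in `]0, (e / 2)[ by apply: rat_in_itvoo; rewrite divr_gt0.
  rewrite in_itv/= => /andP[r0 re].
  have H i j : exists q : rat, `|ratr q - f t i j| < ratr r.
    have [q] : exists q : rat, ratr q \in `]f t i j - ratr r, f t i j + ratr r[.
      by apply: rat_in_itvoo; lra.
    by rewrite in_itv/= => qP; exists q; rewrite ltr_distl.
  pose Q : 'M[rat]_(m, n) := \matrix_(i, j) projT1 (cid (H i j)).
  have QP i j : `|ratr (Q i j) - f t i j| < ratr r.
    by rewrite mxE; case: cid.
  exists (Q, r) => //; split => //= A bA; apply: eU; split => // i j /=.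
  rewrite /ball/= (le_lt_trans (ler_distD (ratr (Q i j)) _ _))// distrC.
  by have := QP i j; have := bA i j => /=; lra.
apply: countable_bigcupT_measurable => [|qr]; first exact: countableP.
have [bU|nbU] := pselect (box qr `<=` U); last first.
  by rewrite (_ : F qr = set0) -?subset0// => t [].
have -> : F qr = \bigcap_ij (fun t => f t ij.1 ij.2) @^-1`
    [set x | `|ratr (qr.1 ij.1 ij.2) - x| < ratr qr.2].
  apply/seteqP; split => [t [_ bt] ij _ /=|t bt]; first exact: bt.
  by split => // i j; exact: (bt (i, j)).
apply: fin_bigcap_measurable => // ij _.
rewrite -[X in measurable X]setTI; apply: mf => //.
set q := ratr _; set r := ratr _.
rewrite (_ : mkset _ = `]q - r, q + r[%classic)//.
by apply/seteqP; split => x /=; rewrite in_itv/= distrC ltr_distl.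
Qed.

(** The topology of [Sym] is initial for [Symmx], so every open set is the preimage of an open set
    of matrices and it suffices to look at entries. *)
Lemma measurable_Sym d (T : measurableType d) n (f : T -> borel (Sym R n)) :
  (forall i j, measurable_fun setT (fun t => Symmx (f t) i j)) -> measurable_fun setT f.
Proof.
move=> mf; apply: borel_measurable_fun => _ [U oU <-].
exact: (measurable_preimage_open_mx mf).
Qed.

Lemma measurable_SymPos d (T : measurableType d) n (f : T -> borel (SymPos R n)) :
  (forall i j, measurable_fun setT (fun t => posmx (f t) i j)) -> measurable_fun setT f.
Proof.
move=> mf; apply: borel_measurable_fun => _ [_ [U oU <-] <-].
exact: (measurable_preimage_open_mx mf).
Qed.

Lemma measurable_Sym_coord n i j : measurable_fun setT (fun S : borel (Sym R n) => Symmx S i j).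
Proof.
apply: continuous_borel_real => S.
exact: (continuous_comp (@Symmx_continuous R n S) (@coord_continuous _ _ _ i j _)).
Qed.

Lemma measurable_SymPos_coord n i j :
  measurable_fun setT (fun z : borel (SymPos R n) => posmx z i j).
Proof.
apply: continuous_borel_real => z.
exact: (continuous_comp (@posmx_continuous R n z) (@coord_continuous _ _ _ i j _)).
Qed.

Lemma measurable_mulmx d (T : measurableType d) m n p
    (f : T -> 'M[R]_(m, n)) (g : T -> 'M[R]_(n, p)) :
  (forall i j, measurable_fun setT (fun t => f t i j)) ->
  (forall i j, measurable_fun setT (fun t => g t i j)) ->
  forall i j, measurable_fun setT (fun t => (f t *m g t) i j).
Proof.
move=> mf mg i j; under eq_fun do rewrite mxE.
by apply: measurable_sum => k; exact: measurable_funM.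
Qed.

Lemma measurable_trmx d (T : measurableType d) m n (f : T -> 'M[R]_(m, n)) :
  (forall i j, measurable_fun setT (fun t => f t i j)) ->
  forall i j, measurable_fun setT (fun t => (f t)^T i j).
Proof. by move=> mf i j; under eq_fun do rewrite mxE; exact: mf. Qed.

Lemma measurable_cst_mx d (T : measurableType d) m n (A : 'M[R]_(m, n)) :
  forall i j, measurable_fun setT (fun t : T => A i j).
Proof. by move=> i j; exact: measurable_cst. Qed.

End borel_sets.

Lemma measurable_funV_gt0 d (T : measurableType d) (R : realType) (f : T -> R) :
  (forall t, 0 < f t) -> measurable_fun setT f -> measurable_fun setT (fun t => (f t)^-1).
Proof.
move=> f0 mf; rewrite (_ : (fun t => _) = (fun t => expR (- ln (f t)))).
  by apply: measurableT_comp => //; apply: measurableT_comp => //; exact: measurableT_comp.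
by apply/funext => t; rewrite expRN lnK ?posrE.
Qed.

(** * Uniqueness of relatively invariant measures *)

Section invariant_measures.
Local Open Scope ereal_scope.
Context d (T : measurableType d) (R : realType).
Variables (mul : T -> T -> T) (inv : T -> T).
Hypothesis mulVK : forall x y, mul (inv x) (mul x y) = y.
Hypothesis mulKV : forall x y, mul (mul y (inv x)) x = y.
Hypothesis invK : forall x, inv (inv x) = x.
Hypothesis invM : forall x y, inv (mul x y) = mul (inv y) (inv x).
Hypothesis mmul : measurable_fun setT (fun p : T * T => mul p.1 p.2).
Hypothesis minv : measurable_fun setT inv.

Let mmul2 d' (S : measurableType d') (f g : S -> T) :
  measurable_fun setT f -> measurable_fun setT g ->
  measurable_fun setT (fun s => mul (f s) (g s)).
Proof. by move=> mf mg; exact: (measurableT_comp mmul (measurable_fun_pair mf mg)). Qed.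

Definition character (c : T -> R) :=
  [/\ measurable_fun setT c, forall x, (0 < c x)%R
    & forall x y, c (mul x y) = (c x * c y)%R].

(** Phrased with integrals of nonnegative functions, the form in which the Fubini argument uses
    invariance. *)
Definition rel_invariant (mu : set T -> \bar R) (c : T -> R) :=
  forall x (f : T -> \bar R), measurable_fun setT f -> (forall y, 0 <= f y) ->
    \int[mu]_y f (mul x y) = ((c x)^-1)%:E * \int[mu]_y f y.

Lemma characterV c : character c -> forall x, c (inv x) = (c x)^-1%R.
Proof.
move=> [_ c0 cM] x; apply: (mulfI (lt0r_neq0 (c0 x))).
rewrite divff ?lt0r_neq0//; apply: (mulfI (lt0r_neq0 (c0 (inv x)))).
by rewrite mulr1 -!cM mulVK.
Qed.

Section two_measures.
Variables mu nu : {sigma_finite_measure set T -> \bar R}.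
Variables cm cn : T -> R.
Hypotheses (Cm : character cm) (Cn : character cn).
Hypotheses (Im : rel_invariant mu cm) (In : rel_invariant nu cn).

(* (x, y) |-> (y^-1, x y) is the composite of two shears, each of which acts on
   the product measure through one of the two characters only. *)
Lemma shear_integral (F : T * T -> \bar R) :
  measurable_fun setT F -> (forall p, 0 <= F p) ->
  \int[mu]_x \int[nu]_y F (inv y, mul x y)
  = \int[nu]_y \int[mu]_x ((cm y / (cn y * cn x))%:E * F (x, y)).
Proof.
move=> mF F0; have [mcm cm0 cmM] := Cm; have [mcn cn0 cnM] := Cn.
have m1 : measurable_fun setT (fun p : T * T => F (mul (inv p.2) p.1, p.2)).
  apply: measurableT_comp => //; apply: measurable_fun_pair => //.
  by apply: mmul2 => //; exact: measurableT_comp.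
have mV (c : T -> R) : (forall x, (0 < c x)%R) -> measurable_fun setT c ->
    measurable_fun setT (fun x => (c x)^-1%:E : \bar R).
  by move=> c0 mc; apply/measurable_EFinP; exact: measurable_funV_gt0.
transitivity (\int[mu]_x \int[nu]_y ((cn x)^-1%:E * F (mul (inv y) x, y))).
  apply: eq_integral => x _.
  have mg : measurable_fun setT (fun y => F (mul (inv y) x, y)).
    exact: (measurable_fun_pair2 x m1).
  rewrite ge0_integralZl_EFin//; last by rewrite invr_ge0 ltW.
  by rewrite -(In x mg)//; apply: eq_integral => y _ /=; rewrite invM mulKV.
rewrite (fubini_tonelli (fun p : T * T => (cn p.1)^-1%:E * F (mul (inv p.2) p.1, p.2)))/=; last 2 first.
- apply: emeasurable_funM => //.
  by apply: (@measurableT_comp _ _ _ _ _ _ (fun x => (cn x)^-1%:E)) => //; exact: mV.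
- by move=> p; rewrite mule_ge0// lee_fin invr_ge0 ltW.
apply: eq_integral => y _.
pose k x := (cn (mul y x))^-1%:E * F (x, y).
have mk : measurable_fun setT k.
  apply: emeasurable_funM; last exact: measurable_fun_pair1.
  under eq_fun do rewrite cnM.
  apply: (mV (fun x => cn y * cn x)%R) => // [x|]; first by rewrite mulr_gt0.
  exact: measurable_funM.
have k0 x : 0 <= k x by rewrite mule_ge0// lee_fin invr_ge0 ltW.
transitivity (\int[mu]_x k (mul (inv y) x)).
  apply: eq_integral => x _; rewrite /k.
  by have := mulVK (inv y) x; rewrite invK => ->.
rewrite Im// characterV// invrK -ge0_integralZl_EFin ?(ltW (cm0 y))//.
by apply: eq_integral => x _; rewrite /k cnM muleA -EFinM.
Qed.

(** [shear_integral] for a product function: on one side the integral separates, on the other the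
    inner integral is that of a translate of e. *)
Lemma invariant_convolution (f e : T -> \bar R) :
  measurable_fun setT f -> (forall x, 0 <= f x) ->
  measurable_fun setT e -> (forall x, 0 <= e x) ->
  (\int[mu]_x f x) * (\int[nu]_y ((cm y / cn y)%:E * e y))
  = \int[nu]_y ((cn y)^-1%:E * f (inv y) * \int[mu]_x e (mul x y)).
Proof.
move=> mf f0 me e0; have [mcm cm0 cmM] := Cm; have [mcn cn0 cnM] := Cn.
(* The weight cn cancels the factor 1 / cn x that the shear produces. *)
pose F p := (cn p.1)%:E * f p.1 * e p.2.
have mcnE : measurable_fun setT (EFin \o cn) by exact/measurable_EFinP.
have mF : measurable_fun setT F.
  apply: emeasurable_funM; last exact: (measurableT_comp me).
  apply: emeasurable_funM; last exact: (measurableT_comp mf).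
  exact: (measurableT_comp mcnE).
have F0 p : 0 <= F p by rewrite !mule_ge0// lee_fin ltW.
have := shear_integral mF F0; rewrite /F/=.
have mi : measurable_fun setT (fun p : T * T => F (inv p.2, mul p.1 p.2)).
  apply: (measurableT_comp mF); apply: measurable_fun_pair => //.
  exact: measurableT_comp.
rewrite (fubini_tonelli (fun p : T * T => F (inv p.2, mul p.1 p.2)))//= => E.
transitivity (\int[nu]_y \int[mu]_x
    ((cm y / (cn y * cn x))%:E * ((cn x)%:E * f x * e y))); last first.
  rewrite -E; apply: eq_integral => y _; rewrite /F/= characterV//.
  rewrite ge0_integralZl//; first last.
  - by rewrite mule_ge0// lee_fin invr_ge0 ltW.
  - apply: (measurableT_comp me).
    exact: (measurable_fun_pair1 y mmul).
rewrite -ge0_integralZl//; first last.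
- exact: integral_ge0.
- by move=> y _; rewrite mule_ge0// lee_fin divr_ge0 ?ltW.
- apply: emeasurable_funM => //; apply/measurable_EFinP; apply: measurable_funM => //.
  exact: measurable_funV_gt0.
apply: eq_integral => y _.
transitivity (\int[mu]_x (f x * ((cm y / cn y)%:E * e y))).
  by rewrite ge0_integralZr// mule_ge0// lee_fin divr_ge0 ?ltW.
apply: eq_integral => x _; rewrite [RHS]muleC -!muleA muleCA.
congr (_ * _); rewrite [X in _ = _ * X]muleC muleA -EFinM.
by congr (_%:E * _); field; rewrite !lt0r_neq0.
Qed.

End two_measures.

(** With e fixed, this says that nu is a constant multiple of (cn / cm) mu. The identity of
    [invariant_convolution] is used for (mu, nu) and for (mu, mu) with the same f, and the integral
    of f is eliminated. *)
Theorem invariant_unique (mu nu : {sigma_finite_measure set T -> \bar R}) (cm cn : T -> R)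
    (e h : T -> \bar R) :
  character cm -> character cn -> rel_invariant mu cm -> rel_invariant nu cn ->
  measurable_fun setT e -> (forall x, 0 <= e x) ->
  (forall y, 0 < \int[mu]_x e (mul x y) < +oo) ->
  measurable_fun setT h -> (forall x, 0 <= h x) ->
  (\int[mu]_x e x) * (\int[nu]_y h y)
  = (\int[nu]_y ((cm y / cn y)%:E * e y)) * (\int[mu]_y ((cn y / cm y)%:E * h y)).
Proof.
move=> Cm Cn Im In me e0 De mh h0.
have [mcm cm0 cmM] := Cm; have [mcn cn0 cnM] := Cn.
pose D y := fine (\int[mu]_x e (mul x y)).
have DE y : \int[mu]_x e (mul x y) = (D y)%:E.
  have /andP[D0 Dy] := De y; rewrite /D fineK// ge0_fin_numE//; exact: ltW.
have D0 y : (0 < D y)%R by rewrite -lte_fin -DE; have /andP[] := De y.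
have mD : measurable_fun setT D.
  apply: (measurableT_comp (f := fine)) => //.
  apply: (measurable_fun_fubini_tonelli_G (fun p : T * T => e (mul p.1 p.2))) => //.
  exact: (measurableT_comp me mmul).
(* Chosen so that (cn y)^-1 f(y^-1) times the integral of e(x y) in x is exactly h y; this needs D
   to be finite and positive. *)
pose f x := (cn (inv x) / D (inv x))%:E * h (inv x).
have mf : measurable_fun setT f.
  apply: emeasurable_funM; last exact: (measurableT_comp mh).
  apply/measurable_EFinP; apply: measurable_funM; first exact: (measurableT_comp mcn).
  by apply: measurable_funV_gt0 => //; exact: (measurableT_comp mD).
have f0 x : 0 <= f x by rewrite mule_ge0// lee_fin divr_ge0// ltW.
have K c y : c^-1%:E * f (inv y) * \int[mu]_x e (mul x y) = (cn y / c)%:E * h y.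
  rewrite DE /f !invK [LHS]muleC !muleA -!EFinM; congr (_%:E * _).
  by rewrite mulrAC mulrCA divff ?lt0r_neq0// mulr1.
have := invariant_convolution Cm Cn Im In mf f0 me e0.
under [X in _ = X -> _]eq_integral do rewrite K divff ?lt0r_neq0// mul1e.
move=> <-.
have := invariant_convolution Cm Cm Im Im mf f0 me e0.
under [X in _ = X -> _]eq_integral do rewrite K.
under [X in _ * X = _ -> _]eq_integral do rewrite divff ?lt0r_neq0// mul1e.
by move=> <-; rewrite muleA muleC [X in _ * X]muleC.
Qed.

End invariant_measures.

(** * Lebesgue measure on Sym *)

Section image_measure.
Context d1 d2 (T1 : measurableType d1) (T2 : measurableType d2) (R : realType).
Variables (f : T1 -> T2) (mf : measurable_fun setT f).

Definition image_measure (m : {measure set T1 -> \bar R}) : {measure set T2 -> \bar R} :=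
  measure_function_pushforward__canonical__measure_function_Measure m mf.

Lemma image_measureE (m : {measure set T1 -> \bar R}) A : image_measure m A = m (f @^-1` A).
Proof. by []. Qed.

End image_measure.

Section mk_sigma_finite.
Context d (T : measurableType d) (R : realType) (m : {measure set T -> \bar R}).
Hypothesis sm : sigma_finite setT m.

Let f : set T -> \bar R := m.
HB.instance Definition _ := Measure.on f.
HB.instance Definition _ := Measure_isSigmaFinite.Build _ _ _ f sm.

Definition mk_sigma_finite : {sigma_finite_measure set T -> \bar R} := f.

End mk_sigma_finite.

(* The canonical sigma-finite structure of a product is shadowed in the library
   by the one for subprobabilities. *)
Lemma sigma_finite_prod d1 d2 (T1 : measurableType d1) (T2 : measurableType d2)
    (R : realType) (m1 : {sigma_finite_measure set T1 -> \bar R})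
    (m2 : {sigma_finite_measure set T2 -> \bar R}) :
  sigma_finite setT (m1 \x m2)%E.
Proof.
by case: (lebesgue_integral_fubini.measure_function_Measure_isSigmaFinite__to__measure_function_isSigmaFinite m1 m2).
Qed.

Section lebesgue.
Variable R : realType.

(** [R] and [measurableTypeR R] have the same measurable sets but are different measurable types;
    the identity maps are used to pass between them. *)
Lemma mTypeR_id : measurable_fun setT (idfun : measurableTypeR R -> R).
Proof. by move=> _ A mA; rewrite setTI. Qed.

Lemma Rid_mType : measurable_fun setT (idfun : R -> measurableTypeR R).
Proof. by move=> _ A mA; rewrite setTI. Qed.

(** The measurable left inverse g carries a cover of the source to the target: the preimage of
    g^-1(F k) under f is F k again. *)
Lemma sigma_finite_image d1 d2 (T1 : measurableType d1) (T2 : measurableType d2)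
    (f : T1 -> T2) (g : T2 -> T1) (mf : measurable_fun setT f)
    (m : {sigma_finite_measure set T1 -> \bar R}) :
  measurable_fun setT g -> cancel f g -> sigma_finite setT (image_measure mf m).
Proof.
move=> mg fK; have [F FT Foo] := sigma_finiteT m.
exists (fun k => g @^-1` F k); first by rewrite -preimage_bigcup -FT preimage_setT.
move=> k; have [mF Fk] := Foo k; split.
  by rewrite -[X in measurable X]setTI; exact: mg.
by rewrite image_measureE -comp_preimage (_ : g \o f = id)//; apply/funext.
Qed.

Lemma tcons_measurable N : measurable_fun setT
  (fun xt : measurableTypeR R * N.-tuple R => [the N.+1.-tuple R of xt.1 :: xt.2]).
Proof.
by apply: measurable_cons => //; exact: (measurableT_comp mTypeR_id measurable_fst).
Qed.

(** [lebesgue_tuple] is a bare set function; the induction equips it with the structure of a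
    sigma-finite measure, needed for Fubini. *)
Lemma lebesgue_tuple_sigma_finite N :
  {mu : {sigma_finite_measure set (N.-tuple R) -> \bar R} |
    forall A, mu A = lebesgue_tuple A}.
Proof.
elim: N => [|N [mu muE]].
  by exists (\d_([tuple] : 0.-tuple R)).
have muE' : lebesgue_tuple (N:=N) = mu by apply/funext => A.
pose p := mk_sigma_finite (sigma_finite_prod (@lebesgue_measure R) mu).
pose uncons (t : N.+1.-tuple R) : measurableTypeR R * N.-tuple R :=
  (thead t, [tuple of behead t]).
have sm : sigma_finite setT (image_measure (@tcons_measurable N) p).
  apply: (sigma_finite_image (g := uncons)).
    apply: measurable_fun_pair; last exact: measurable_behead.
    by apply: (measurableT_comp Rid_mType); exact: measurable_tnth.
  by move=> [x t]; congr pair; apply/val_inj.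
exists (mk_sigma_finite sm) => A.
by rewrite /= muE'.
Qed.

Definition leb N := sval (lebesgue_tuple_sigma_finite N).

Lemma lebE N A : leb N A = lebesgue_tuple A.
Proof. by rewrite /leb; case: lebesgue_tuple_sigma_finite. Qed.

End lebesgue.

(** * Iterated integrals and translation invariance for tuples *)

Section lebesgue_tuple_integral.
Variable R : realType.
Local Open Scope ereal_scope.

Lemma integral_image d1 d2 (T1 : measurableType d1) (T2 : measurableType d2)
    (f : T1 -> T2) (mf : measurable_fun setT f) (m : {measure set T1 -> \bar R})
    (h : T2 -> \bar R) : measurable_fun setT h -> (forall y, 0 <= h y) ->
  \int[image_measure mf m]_y h y = \int[m]_x h (f x).
Proof. by move=> mh h0; rewrite ge0_integral_pushforward// preimage_setT. Qed.

(** The translated measure agrees with Lebesgue measure on half-open intervals, which determine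
    it. *)
Lemma lebesgue_integral_shift (a : R) (f : R -> \bar R) :
  measurable_fun setT f -> (forall x, 0 <= f x) ->
  \int[lebesgue_measure]_x f (a + x)%R = \int[lebesgue_measure]_x f x.
Proof.
move=> mf f0.
have ma : measurable_fun setT ((fun x => a + x)%R : measurableTypeR R -> measurableTypeR R).
  by apply: measurable_funD => //; exact: measurable_cst.
have mf' : measurable_fun setT (f : measurableTypeR R -> \bar R).
  exact: (measurableT_comp mf (@mTypeR_id R)).
rewrite -(integral_image ma (@lebesgue_measure R) mf' f0).
apply: eq_measure_integral => A mA _; symmetry.
apply: lebesgue_measure_unique => // _ [[x y]] _ <-.
rewrite /image_measure /= /pushforward.
rewrite (_ : _ @^-1` _ = `](x - a)%R, (y - a)%R]%classic); last first.
  by apply/seteqP; split => z /=; rewrite !in_itv/= ltrBlDl lerBrDl.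
rewrite !lebesgue_measure_itv/= !lte_fin ltrD2r; case: ifPn => // _.
by rewrite -!EFinB; congr EFin; ring.
Qed.

Lemma leb_integralS N (F : N.+1.-tuple R -> \bar R) :
  measurable_fun setT F -> (forall t, 0 <= F t) ->
  \int[leb R N.+1]_t F t
  = \int[lebesgue_measure]_x \int[leb R N]_t F [tuple of x :: t].
Proof.
move=> mF F0.
have mF' : measurable_fun setT
    (fun xt : measurableTypeR R * N.-tuple R => F [tuple of xt.1 :: xt.2]).
  exact: (measurableT_comp mF (@tcons_measurable R N)).
pose p := image_measure (@tcons_measurable R N) (@lebesgue_measure R \x leb R N).
transitivity (\int[p]_t F t).
  apply: eq_measure_integral => A mA _; rewrite lebE /= /pushforward.
  by rewrite (_ : lebesgue_tuple (N:=N) = leb R N)//; apply/funext => B; rewrite lebE.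
rewrite integral_image//.
exact: (@fubini_tonelli1 _ _ _ _ _ (@lebesgue_measure R) (leb R N)
  _ mF' (fun xt => F0 [tuple of xt.1 :: xt.2])).
Qed.

Definition tadd N (s t : N.-tuple R) : N.-tuple R := [tuple (tnth s i + tnth t i)%R | i < N].

Lemma tadd_measurable N (s : N.-tuple R) : measurable_fun setT (tadd s).
Proof.
apply/measurable_fun_tnthP => i.
rewrite (_ : _ \o _ = fun t => tnth s i + tnth t i)%R.
  by apply: measurable_funD => //; exact: measurable_tnth.
by apply/funext => t /=; rewrite tnth_mktuple.
Qed.

Lemma leb_integral_shift N (s : N.-tuple R) (F : N.-tuple R -> \bar R) :
  measurable_fun setT F -> (forall t, 0 <= F t) ->
  \int[leb R N]_t F (tadd s t) = \int[leb R N]_t F t.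
Proof.
elim: N s F => [|N IH] s F mF F0.
  by apply: eq_integral => t _; rewrite (tuple0 t) (tuple0 (tadd _ _)).
have mFt : measurable_fun setT (fun t => F (tadd s t)).
  exact: (measurableT_comp mF (tadd_measurable s)).
rewrite !leb_integralS//.
have cE (x : R) (t : N.-tuple R) :
  tadd s [tuple of x :: t] = [tuple of (thead s + x)%R :: tadd [tuple of behead s] t].
  apply: eq_from_tnth => i; rewrite tnth_mktuple.
  have [j ->|->] := unliftP ord0 i; last by rewrite !tnth0.
  rewrite !tnthS tnth_mktuple !tnth_behead /=; congr (tnth _ _ + _)%R.
  by apply/val_inj; rewrite /= inordK// ltnS ltn_ord.
have mFx x : measurable_fun setT (fun t : N.-tuple R => F [tuple of x :: t]).
  apply: (measurableT_comp mF); apply: measurable_cons => //; exact: measurable_cst.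
transitivity (\int[lebesgue_measure]_x \int[leb R N]_t F [tuple of (thead s + x)%R :: t]).
  apply: eq_integral => x _; under eq_integral do rewrite cE.
  exact: (IH [tuple of behead s] (fun t => F [tuple of (thead s + x)%R :: t])).
pose G (x : R) := \int[leb R N]_t F [tuple of x :: t].
have mG : measurable_fun setT G.
  have mF' : measurable_fun setT (fun xt : R * N.-tuple R => F [tuple of xt.1 :: xt.2]).
    by apply: (measurableT_comp mF); exact: measurable_cons.
  exact: (measurable_fun_fubini_tonelli_F (m2 := leb R N) _ mF' (fun xt => F0 _)).
by apply: (lebesgue_integral_shift (thead s) mG) => x; exact: integral_ge0.
Qed.

Definition tbox N (r : R) : set (N.-tuple R) := [set t | forall i, (0 <= tnth t i <= r)%R].

Lemma measurable_tbox N r : measurable (@tbox N r).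
Proof.
rewrite (_ : tbox r = \bigcap_i (fun t : N.-tuple R => tnth t i) @^-1` `[0%R, r]).
  apply: fin_bigcap_measurable => // i _.
  by rewrite -[X in measurable X]setTI; apply: measurable_tnth.
by apply/seteqP; split=> [t tP i _|t tP i]; have := tP i; rewrite /= in_itv/=; auto.
Qed.

Lemma leb_tbox N (r : R) : (0 <= r)%R -> leb R N (tbox r) = (r ^+ N)%:E.
Proof.
move=> r0; elim: N => [|N IH].
  by rewrite lebE /= diracE (_ : _ \in _)// inE; case.
rewrite lebE /= /pushforward (_ : lebesgue_tuple (N:=N) = leb R N); last first.
  by apply/funext => B; rewrite lebE.
rewrite (_ : _ @^-1` _ = `[0%R, r] `*` tbox r); last first.
  apply/seteqP; split=> [[x t] /= tP|[x t] /= [+ tP] i].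
    split; first by have := tP ord0; rewrite tnth0 in_itv.
    by move=> i; have := tP (lift ord0 i); rewrite tnthS.
  rewrite in_itv/= => xP.
  by have [j ->|->] := unliftP ord0 i; rewrite ?tnth0 ?tnthS.
rewrite product_measure1E//; last exact: measurable_tbox.
have I0r : lebesgue_measure `[0%R, r] = r%:E.
  rewrite lebesgue_measure_itv/= lte_fin; case: ltgtP r0 => // [_ _|<- _] //.
  by rewrite oppr0 adde0.
by rewrite IH [X in X * _]I0r exprS EFinM.
Qed.

End lebesgue_tuple_integral.

Section lebesgue_Sym.
Variables (R : realType) (n : nat).
Local Open Scope ereal_scope.

Definition Sym_coords (S : Sym R n) : #|upper n|.-tuple R :=
  [tuple S (val (enum_val k)).1 (val (enum_val k)).2 | k < #|upper n|].

Lemma Sym_of_tupleK : cancel (@Sym_of_tuple R n) Sym_coords.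
Proof.
move=> t; apply: eq_from_tnth => k; rewrite tnth_mktuple mxE -[in RHS](enum_valK k).
congr (tnth t (enum_rank _)); apply/val_inj => /=.
by case: (enum_val k) => -[i j] /= ->.
Qed.

Lemma Sym_coordsK : cancel Sym_coords (@Sym_of_tuple R n).
Proof.
move=> S; apply/val_inj/matrixP => i j; rewrite /= mxE tnth_mktuple enum_rankK /=.
by case: ifP => // _ /=; rewrite -[in LHS](Symmx_tr S) mxE.
Qed.

Lemma Sym_of_tuple_measurable :
  measurable_fun setT (@Sym_of_tuple R n : _ -> borel (Sym R n)).
Proof.
apply: measurable_Sym => i j.
have -> : (fun t : #|upper n|.-tuple R => Sym_of_tuple t i j) = (fun t => tnth t (enum_rank (upper_index i j))).
  by apply/funext => t; rewrite /= mxE.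
exact: measurable_tnth.
Qed.

Lemma Sym_coords_measurable :
  measurable_fun setT (Sym_coords : borel (Sym R n) -> _).
Proof.
apply/measurable_fun_tnthP => k.
rewrite (_ : _ \o _ = fun S : Sym R n => S (val (enum_val k)).1 (val (enum_val k)).2).
  exact: measurable_Sym_coord.
by apply/funext => S /=; rewrite tnth_mktuple.
Qed.

Lemma sigma_finite_lebesgue_Sym :
  sigma_finite setT (image_measure Sym_of_tuple_measurable (leb R #|upper n|)).
Proof.
exact: (sigma_finite_image Sym_of_tuple_measurable (leb R #|upper n|)
  Sym_coords_measurable Sym_of_tupleK).
Qed.

Definition lebS : {sigma_finite_measure set (borel (Sym R n)) -> \bar R} :=
  mk_sigma_finite sigma_finite_lebesgue_Sym.

Lemma lebSE : @lebesgue_Sym R n = lebS.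
Proof. by apply/funext => A; rewrite /lebesgue_Sym /pushforward -lebE. Qed.

Lemma lebS_integral (F : Sym R n -> \bar R) :
  measurable_fun setT (F : borel (Sym R n) -> \bar R) -> (forall S, 0 <= F S) ->
  \int[lebS]_S F S = \int[leb R #|upper n|]_t F (Sym_of_tuple t).
Proof. by move=> mF F0; rewrite -(integral_image Sym_of_tuple_measurable). Qed.

Lemma SymmxD (S T : Sym R n) : Symmx (S + T)%R = (Symmx S + Symmx T)%R.
Proof. by []. Qed.

Lemma measurable_Sym_add :
  measurable_fun setT (fun p : borel (Sym R n) * borel (Sym R n) => (p.1 + p.2 : Sym R n)%R : borel _).
Proof.
apply: measurable_Sym => i j; under eq_fun do rewrite SymmxD mxE.
by apply: measurable_funD; apply: (measurableT_comp (@measurable_Sym_coord R n i j)).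
Qed.

Lemma measurable_Sym_opp :
  measurable_fun setT (fun S : borel (Sym R n) => (- S : Sym R n)%R : borel _).
Proof.
apply: measurable_Sym => i j.
rewrite (_ : (fun t => _) = fun S : borel (Sym R n) => (- Symmx S i j)%R).
  by apply: measurableT_comp => //; exact: measurable_Sym_coord.
by apply/funext => S; rewrite -[Symmx _]/(- Symmx S)%R mxE.
Qed.

Lemma lebS_shift (S0 : Sym R n) (F : Sym R n -> \bar R) :
  measurable_fun setT (F : borel (Sym R n) -> \bar R) -> (forall S, 0 <= F S) ->
  \int[lebS]_S F (S0 + S)%R = \int[lebS]_S F S.
Proof.
move=> mF F0.
have mFS : measurable_fun setT (fun S : borel (Sym R n) => F (S0 + S)%R).
  apply: (measurableT_comp mF).
  exact: (measurable_fun_pair2 (S0 : borel (Sym R n)) measurable_Sym_add).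
rewrite !lebS_integral//.
have mFt : measurable_fun setT (F \o @Sym_of_tuple R n).
  exact: (measurableT_comp mF Sym_of_tuple_measurable).
rewrite -[RHS](leb_integral_shift (Sym_coords S0) mFt); last by move=> t /=.
apply: eq_integral => t _; congr F; apply/val_inj/matrixP => i j.
rewrite -{1}(Sym_coordsK S0) -[val (_ + _)%R]/(Symmx _ + Symmx _)%R.
by rewrite /= !mxE !tnth_mktuple.
Qed.

Definition Sbox (r : R) : set (Sym R n) := [set S | forall i j, (0 <= S i j <= r)%R].

Lemma measurable_Sbox r : measurable (Sbox r : set (borel (Sym R n))).
Proof.
rewrite (_ : Sbox r = \bigcap_ij (fun S : borel (Sym R n) => S ij.1 ij.2) @^-1` `[0%R, r]).
  apply: fin_bigcap_measurable => // ij _.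
  by rewrite -[X in measurable X]setTI; apply: measurable_Sym_coord.
apply/seteqP; split=> [S SP ij _|S SP i j]; first by rewrite /= in_itv/=.
by have := SP (i, j) I; rewrite /= in_itv.
Qed.

Lemma lebS_box r : (0 <= r)%R -> lebS (Sbox r) = (r ^+ #|upper n|)%:E.
Proof.
move=> r0; rewrite /= /image_measure /= /pushforward -leb_tbox//; congr (leb _ _ _).
apply/seteqP; split=> [t tP k|t tP i j]; last by rewrite mxE.
have := tP (val (enum_val k)).1 (val (enum_val k)).2.
by rewrite -[in X in _ -> X](Sym_of_tupleK t) tnth_mktuple.
Qed.

(** An instance of [invariant_unique] for the additive group of symmetric matrices, with trivial
    characters and the indicator of the unit box, of volume 1, as reference function. *)
Lemma lebS_unique (nu : {sigma_finite_measure set (borel (Sym R n)) -> \bar R}) :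
  (forall S0 (F : Sym R n -> \bar R), measurable_fun setT (F : borel (Sym R n) -> \bar R) ->
    (forall S, 0 <= F S) -> \int[nu]_S F (S0 + S)%R = \int[nu]_S F S) ->
  forall F : Sym R n -> \bar R, measurable_fun setT (F : borel (Sym R n) -> \bar R) ->
    (forall S, 0 <= F S) -> \int[nu]_S F S = nu (Sbox 1) * \int[lebS]_S F S.
Proof.
move=> nuT F mF F0.
have char1 : character (fun S T : borel (Sym R n) => (S + T : Sym R n)%R) (cst 1%R : _ -> R).
  by split=> [|//|x y]; [exact: measurable_cst|rewrite /= mulr1].
pose e (S : Sym R n) := (\1_(Sbox 1) S)%:E : \bar R.
have me : measurable_fun setT (e : borel (Sym R n) -> \bar R).
  by apply/measurable_EFinP; apply: measurable_indic; exact: measurable_Sbox.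
have e0 S : 0 <= e S by rewrite lee_fin.
have eint (m : {sigma_finite_measure set (borel (Sym R n)) -> \bar R}) :
    \int[m]_S e S = m (Sbox 1).
  by rewrite integral_indic ?setIT//; exact: measurable_Sbox.
have box1 : lebS (Sbox 1) = 1 by rewrite lebS_box// expr1n.
have := @invariant_unique _ (borel (Sym R n)) R (fun S T => (S + T : Sym R n)%R)
  (fun S => (- S : Sym R n)%R) _ _ _ _ _ _ lebS nu (cst 1%R) (cst 1%R) e F.
rewrite eint box1 mul1e.
move=> H; transitivity (\int[nu]_y ((cst 1 y / cst 1 y)%:E * e y) *
    \int[lebS]_y ((cst 1 y / cst 1 y)%:E * F y)); last first.
  congr (_ * _); last by apply: eq_integral => y _; rewrite divr1 mul1e.
  by rewrite -eint; apply: eq_integral => y _; rewrite divr1 mul1e.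
apply: H => //.
- by move=> x y; rewrite addKr.
- by move=> x y; rewrite addrNK.
- by move=> x; rewrite opprK.
- by move=> x y; rewrite opprD addrC.
- exact: measurable_Sym_add.
- exact: measurable_Sym_opp.
- by move=> S0 G mG G0; rewrite invr1 mul1e; exact: lebS_shift.
- by move=> S0 G mG G0; rewrite invr1 mul1e; exact: nuT.
- move=> y; have -> : \int[lebS]_x e (x + y)%R = 1.
    under eq_integral do rewrite addrC.
    by rewrite lebS_shift// eint.
  by rewrite lte01 ltry.
Qed.

End lebesgue_Sym.

(** * Block coordinates (corner, row, lower right block) on symmetric matrices *)

Section block_decomposition.
Variables (R : realType) (n : nat).
Local Open Scope ereal_scope.

Definition trow (t : n.-tuple R) : 'rV[R]_n := \row_i tnth t i.

Lemma Sym_block_subproof (a : R) (b : 'rV[R]_n) (C : Sym R n) :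
  (block_mx a%:M b b^T C : 'M[R]_(1 + n)) \in @symmetric_mx R (1 + n).
Proof. by apply/eqP; rewrite tr_block_mx tr_scalar_mx trmxK Symmx_tr. Qed.

Definition Sym_block (a : R) (b : 'rV[R]_n) (C : Sym R n) : Sym R (1 + n) :=
  MkSym (Sym_block_subproof a b C).

Local Notation triple := (measurableTypeR R * (n.-tuple R * borel (Sym R n)))%type.

Definition of_triple (p : triple) : borel (Sym R (1 + n)) :=
  Sym_block p.1 (trow p.2.1) p.2.2.

Lemma drsub_sym (S : Sym R (1 + n)) : drsubmx (S : 'M[R]_(1 + n)) \in @symmetric_mx R n.
Proof. by apply/eqP; rewrite trmx_drsub Symmx_tr. Qed.

Definition to_triple (S : borel (Sym R (1 + n))) : triple :=
  (S ord0 ord0, ([tuple S ord0 (rshift 1 i) | i < n], MkSym (drsub_sym S))).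

Lemma of_tripleK : cancel of_triple to_triple.
Proof.
move=> [a [t C]]; congr (_, (_, _)).
- have : (block_mx a%:M (trow t) (trow t)^T C : 'M[R]_(1 + n)) (lshift n ord0) (lshift n ord0) = a.
    by rewrite block_mxEul mxE eqxx.
  by rewrite /= (_ : lshift n ord0 = ord0)//; exact/val_inj.
- apply: eq_from_tnth => i; rewrite tnth_mktuple.
  have : (block_mx a%:M (trow t) (trow t)^T C : 'M[R]_(1 + n)) (lshift n ord0) (rshift 1 i) = tnth t i.
    by rewrite block_mxEur mxE.
  by rewrite /= (_ : lshift n ord0 = ord0)//; exact/val_inj.
- by apply/val_inj; rewrite /= block_mxKdr.
Qed.

Lemma to_tripleK : cancel to_triple of_triple.
Proof.
move=> S; apply/val_inj; rewrite /= [RHS]sym_block ?Symmx_tr//.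
have -> : trow [tuple S ord0 (rshift 1 i) | i < n] = ursubmx (S : 'M[R]_(1 + n)).
  apply/rowP => i; rewrite !mxE tnth_mktuple; congr (Symmx S _ _); exact/val_inj.
by congr block_mx; congr (Symmx S _ _)%:M; exact/val_inj.
Qed.

Lemma of_triple_measurable : measurable_fun setT of_triple.
Proof.
apply: measurable_Sym => i j.
case: (split_ordP i) => i' ->; case: (split_ordP j) => j' ->.
- have -> : (fun t => of_triple t (lshift n i') (lshift n j')) = idfun \o fst.
    by apply/funext => t; rewrite /= block_mxEul (ord1 i') (ord1 j') mxE eqxx.
  by apply: (measurableT_comp (@mTypeR_id R)).
- have -> : (fun t => of_triple t (lshift n i') (rshift 1 j'))
      = (fun t : n.-tuple R => tnth t j') \o (fst \o snd).
    by apply/funext => t; rewrite /= block_mxEur (ord1 i') mxE.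
  by apply: measurableT_comp; [exact: measurable_tnth|exact: measurableT_comp].
- have -> : (fun t => of_triple t (rshift 1 i') (lshift n j'))
      = (fun t : n.-tuple R => tnth t i') \o (fst \o snd).
    by apply/funext => t; rewrite /= block_mxEdl (ord1 j') !mxE.
  by apply: measurableT_comp; [exact: measurable_tnth|exact: measurableT_comp].
- have -> : (fun t => of_triple t (rshift 1 i') (rshift 1 j'))
      = (fun S : borel (Sym R n) => S i' j') \o (snd \o snd).
    by apply/funext => t; rewrite /= block_mxEdr.
  by apply: measurableT_comp; [exact: measurable_Sym_coord|exact: measurableT_comp].
Qed.

Lemma to_triple_measurable : measurable_fun setT to_triple.
Proof.
apply: measurable_fun_pair.
  by apply: (measurableT_comp (@Rid_mType R)); exact: measurable_Sym_coord.
apply: measurable_fun_pair.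
  apply/measurable_fun_tnthP => i.
  rewrite (_ : _ \o _ = fun S : borel (Sym R (1 + n)) => S ord0 (rshift 1 i)).
    exact: measurable_Sym_coord.
  by apply/funext => S /=; rewrite tnth_mktuple.
apply: measurable_Sym => i j.
have -> : (fun t : Sym R (1 + n) => @MkSym R n (drsubmx t) (drsub_sym t) i j)
    = (fun S : borel (Sym R (1 + n)) => S (rshift 1 i) (rshift 1 j)).
  by apply/funext => S; rewrite /= !mxE.
exact: measurable_Sym_coord.
Qed.

Let m23 := mk_sigma_finite (sigma_finite_prod (leb R n) (lebS R n)).
Let m123 := mk_sigma_finite (sigma_finite_prod (@lebesgue_measure R) m23).

Let sigma_finite_triple : sigma_finite setT (image_measure of_triple_measurable m123).
Proof. exact: (sigma_finite_image of_triple_measurable m123 to_triple_measurable of_tripleK). Qed.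

Let nu := mk_sigma_finite sigma_finite_triple.

Let nu_integral (F : Sym R (1 + n) -> \bar R) :
  measurable_fun setT (F : borel (Sym R (1 + n)) -> \bar R) -> (forall S, 0 <= F S) ->
  \int[nu]_S F S
  = \int[lebesgue_measure]_a \int[leb R n]_t \int[lebS R n]_C F (Sym_block a (trow t) C).
Proof.
move=> mF F0.
have mFt : measurable_fun setT (fun p : triple => F (of_triple p)).
  exact: (measurableT_comp mF of_triple_measurable).
transitivity (\int[m123]_p F (of_triple p)).
  exact: (integral_image of_triple_measurable m123 mF F0).
rewrite (@fubini_tonelli1 _ _ _ _ _ (@lebesgue_measure R) m23 _ mFt)//.
apply: eq_integral => a _; rewrite /fubini_F.
have mFa : measurable_fun setT (fun q => F (of_triple (a, q))).
  exact: (measurable_fun_pair2 a mFt).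
exact: (@fubini_tonelli1 _ _ _ _ _ (leb R n) (lebS R n) _ mFa (fun q => F0 _)).
Qed.

Let measurable_tC (F : Sym R (1 + n) -> \bar R) a :
  measurable_fun setT (F : borel (Sym R (1 + n)) -> \bar R) -> (forall S, 0 <= F S) ->
  measurable_fun setT (fun t => \int[lebS R n]_C F (Sym_block a (trow t) C)).
Proof.
move=> mF F0.
have mFt : measurable_fun setT (fun p : triple => F (of_triple p)).
  exact: (measurableT_comp mF of_triple_measurable).
have mFa : measurable_fun setT (fun q => F (of_triple (a, q))).
  exact: (measurable_fun_pair2 a mFt).
exact: (@measurable_fun_fubini_tonelli_F _ _ _ _ _ (lebS R n) _ mFa (fun q => F0 _)).
Qed.

Let measurable_atC (F : Sym R (1 + n) -> \bar R) :
  measurable_fun setT (F : borel (Sym R (1 + n)) -> \bar R) -> (forall S, 0 <= F S) ->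
  measurable_fun setT
    (fun a : R => \int[leb R n]_t \int[lebS R n]_C F (Sym_block a (trow t) C)).
Proof.
move=> mF F0.
have mFt : measurable_fun setT (fun p : triple => F (of_triple p)).
  exact: (measurableT_comp mF of_triple_measurable).
have := @measurable_fun_fubini_tonelli_F _ _ _ _ _ m23 _ mFt (fun q => F0 _).
move=> /measurableT_comp/(_ (@Rid_mType R)); congr (measurable_fun _ _).
apply/funext => a /=; rewrite /fubini_F.
have mFa : measurable_fun setT (fun q => F (of_triple (a, q))).
  exact: (measurable_fun_pair2 (a : measurableTypeR R) mFt).
exact: (@fubini_tonelli1 _ _ _ _ _ (leb R n) (lebS R n) _ mFa (fun q => F0 _)).
Qed.

Let nu_shift (S0 : Sym R (1 + n)) (F : Sym R (1 + n) -> \bar R) :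
  measurable_fun setT (F : borel (Sym R (1 + n)) -> \bar R) -> (forall S, 0 <= F S) ->
  \int[nu]_S F (S0 + S)%R = \int[nu]_S F S.
Proof.
move=> mF F0.
have mFS : measurable_fun setT (fun S : borel (Sym R (1 + n)) => F (S0 + S)%R).
  apply: (measurableT_comp mF).
  exact: (measurable_fun_pair2 (S0 : borel (Sym R (1 + n))) (@measurable_Sym_add R (1 + n))).
rewrite (nu_integral mFS (fun S => F0 _)) (nu_integral mF F0).
case E : (to_triple S0) => [a0 [t0 C0]].
have S0E : S0 = Sym_block a0 (trow t0) C0.
  by have := to_tripleK S0; rewrite E => /esym.
have addE a t C : (S0 + Sym_block a (trow t) C)%R
    = Sym_block (a0 + a) (trow (tadd t0 t)) (C0 + C)%R.
  rewrite S0E; apply/val_inj.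
  rewrite -[LHS]/(block_mx _ _ _ _ + block_mx _ _ _ _)%R add_block_mx /=.
  have -> : trow (tadd t0 t) = (trow t0 + trow t)%R.
    by apply/rowP => i; rewrite !mxE tnth_mktuple.
  by rewrite raddfD/= linearD.
pose G (a : R) := \int[leb R n]_t \int[lebS R n]_C F (Sym_block a (trow t) C).
rewrite -[RHS](@lebesgue_integral_shift R a0 G); last 2 first.
- exact: measurable_atC.
- by move=> a; apply: integral_ge0 => t _; exact: integral_ge0.
apply: eq_integral => a _; rewrite /G.
rewrite -[RHS](leb_integral_shift t0 (measurable_tC _ mF F0)); last first.
  by move=> t; exact: integral_ge0.
apply: eq_integral => t _.
under eq_integral do rewrite addE.
have mFC : measurable_fun setT (fun C : borel (Sym R n) =>
    F (Sym_block (a0 + a) (trow (tadd t0 t)) C)).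
  have mFt : measurable_fun setT (fun p : triple => F (of_triple p)).
    exact: (measurableT_comp mF of_triple_measurable).
  exact: (measurable_fun_pair2 _ (measurable_fun_pair2 _ mFt)).
exact: (lebS_shift C0 mFC).
Qed.

Let nu_box : nu (Sbox 1) = 1.
Proof.
rewrite /nu /= /image_measure /= /pushforward.
rewrite (_ : _ @^-1` _ = `[0%R, 1%R] `*` (tbox 1 `*` Sbox 1)).
  have I01 : lebesgue_measure `[0%R, 1%R] = 1%:E :> \bar R.
    by rewrite lebesgue_measure_itv/= lte_fin ltr01 oppr0 adde0.
  rewrite [LHS](product_measure1E (@lebesgue_measure R) m23)//; last first.
    by apply: measurableX; [exact: measurable_tbox|exact: measurable_Sbox].
  rewrite [X in _ * X](product_measure1E (leb R n) (lebS R n)); last 2 first.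
  - exact: measurable_tbox.
  - exact: measurable_Sbox.
  by rewrite leb_tbox// lebS_box// !expr1n !mule1.
apply/seteqP; split=> [[a [t C]] /= SP|[a [t C]] /= [+ [tP CP]]].
  split; first by have := SP (lshift n ord0) (lshift n ord0); rewrite block_mxEul mxE eqxx in_itv.
  split=> [i|i j].
    by have := SP (lshift n ord0) (rshift 1 i); rewrite block_mxEur mxE.
  by have := SP (rshift 1 i) (rshift 1 j); rewrite block_mxEdr.
rewrite in_itv/= => aP i j.
case: (split_ordP i) => i' ->; case: (split_ordP j) => j' -> /=.
- by rewrite block_mxEul (ord1 i') (ord1 j') mxE eqxx.
- by rewrite block_mxEur mxE.
- by rewrite block_mxEdl !mxE.
- by rewrite block_mxEdr.
Qed.

(** The enumeration of the entries of a matrix of size 1 + n is unrelated to its blocks. Instead of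
    comparing enumerations, the product measure in block coordinates is seen to be translation
    invariant and to give the unit box mass 1. *)
Lemma lebS_block_integral (F : Sym R (1 + n) -> \bar R) :
  measurable_fun setT (F : borel (Sym R (1 + n)) -> \bar R) -> (forall S, 0 <= F S) ->
  \int[lebS R (1 + n)]_S F S
  = \int[lebesgue_measure]_a \int[leb R n]_t \int[lebS R n]_C F (Sym_block a (trow t) C).
Proof.
by move=> mF F0; rewrite -nu_integral// (lebS_unique nu_shift)// nu_box mul1e.
Qed.

Lemma measurable_Sym_block (F : Sym R (1 + n) -> \bar R) :
  measurable_fun setT (F : borel (Sym R (1 + n)) -> \bar R) ->
  measurable_fun setT (fun p : triple => F (Sym_block p.1 (trow p.2.1) p.2.2)).
Proof. by move=> mF; exact: (measurableT_comp mF of_triple_measurable). Qed.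

End block_decomposition.

(** * Compact exhaustion of Sym+ and characters of measures *)

Section pinched_sets.
Variables (R : realType) (n : nat).

Definition Kset (m : R) : set (Sym R n) := [set S | pinched m (Symmx S)].

Lemma qf_continuous (v : 'rV[R]_n) : continuous (fun S : Sym R n => qf (Symmx S) v).
Proof.
have c : continuous (fun S : Sym R n => v *m Symmx S *m v^T).
  apply: continuous_mulmx; last exact: cst_continuous.
  by apply: continuous_mulmx; [exact: cst_continuous|exact: Symmx_continuous].
by move=> S; exact: (continuous_comp (c S) (@coord_continuous _ _ _ 0 0 _)).
Qed.

Lemma Kset_closed m : closed (Kset m).
Proof.
have -> : Kset m = \bigcap_v
    ((fun S : Sym R n => qf (Symmx S) v) @^-1` `[m^-1 * qf 1%:M v, m * qf 1%:M v]).
  apply/seteqP; split=> [S SP v _ /=|S SP v]; first by rewrite in_itv; exact: SP.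
  by have := SP v I; rewrite /= in_itv.
apply: closed_bigI => v _; apply: closed_comp; first by move=> S _; exact: qf_continuous.
exact: interval_closed.
Qed.

Lemma measurable_Kset m : measurable (Kset m : set (borel (Sym R n))).
Proof. exact: (closed_borel_measurable (@Kset_closed m)). Qed.

Lemma posdefE : @posdef R n = \bigcup_(m : nat) Kset m.+1%:R.
Proof.
apply/seteqP; split=> [S Sp|S [m _] /pinched_pdmx]; last exact.
by have [m mP] := pdmx_pinched (Symmx_tr S) Sp; exists m.
Qed.

Lemma measurable_posdef : measurable (@posdef R n : set (borel (Sym R n))).
Proof. by rewrite posdefE; apply: bigcupT_measurable => m; exact: measurable_Kset. Qed.

Lemma qf_delta (A : 'M[R]_n) i j c : A^T = A ->
  qf A (delta_mx 0 i + c *: delta_mx 0 j) = A i i + c * A i j *+ 2 + c ^+ 2 * A j j.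
Proof.
move=> As.
have E k l : (delta_mx 0 k *m A *m delta_mx l 0 : 'M[R]_1) 0 0 = A k l.
  by rewrite -rowE -colE !mxE.
have Aji : A j i = A i j by rewrite -[in LHS]As mxE.
have dE (B C D F : 'M[R]_1) : B + c *: C + (c *: D + c *: (c *: F))
    = (B 0 0 + c * C 0 0 + (c * D 0 0 + c * (c * F 0 0)))%:M.
  by rewrite [LHS]mx11_scalar !mxE.
rewrite /qf linearD/= linearZ/= !trmx_delta mulmxDr !mulmxDl -!scalemxAr -!scalemxAl.
by rewrite dE mxE eqxx mulr1n !E Aji; ring.
Qed.

Lemma const_sym (r : R) : (const_mx r : 'M[R]_n) \in @symmetric_mx R n.
Proof. by apply/eqP; rewrite trmx_const. Qed.

Definition Sball (r : R) : set (Sym R n) := [set S | forall i j, `|S i j| <= r].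

Lemma measurable_Sball r : measurable (Sball r : set (borel (Sym R n))).
Proof.
rewrite (_ : Sball r = \bigcap_ij (fun S : borel (Sym R n) => S ij.1 ij.2) @^-1` `[-r, r]).
  apply: fin_bigcap_measurable => // ij _.
  by rewrite -[X in measurable X]setTI; apply: measurable_Sym_coord.
apply/seteqP; split=> [S SP ij _|S SP i j]; first by rewrite /= in_itv/= -ler_norml.
by have := SP (i, j) I; rewrite /= in_itv/= -ler_norml.
Qed.

Lemma lebS_ball r : (lebS R n (Sball r) < +oo)%E.
Proof.
wlog r0 : r / 0 <= r => [fin|].
  apply: (@le_lt_trans _ _ (lebS R n (Sball `|r|))); last exact: fin.
  apply: le_measure; rewrite ?inE; [exact: measurable_Sball|exact: measurable_Sball|].
  by move=> S SP i j; rewrite (le_trans (SP i j))// ler_norm.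
(* Translation by the constant matrix -r carries the box with entries in [0, 2r] onto the ball. *)
pose S0 : Sym R n := MkSym (const_sym (- r)).
have m1 : measurable_fun setT (fun S : borel (Sym R n) => (\1_(Sball r) S)%:E : \bar R).
  by apply/measurable_EFinP; apply: measurable_indic; exact: measurable_Sball.
rewrite -(setIT (Sball r)) -integral_indic//; last exact: measurable_Sball.
rewrite -(lebS_shift S0 m1)//.
have -> : (fun S : Sym R n => (\1_(Sball r) (S0 + S)%R)%:E : \bar R)
    = (fun S => (\1_(Sbox (r *+ 2)) S)%:E).
  apply/funext => S; rewrite !indicE; congr (nat_of_bool _)%:R%:E.
  apply/idP/idP; rewrite !inE => SP i j; have := SP i j; rewrite SymmxD !mxE ler_norml.
    by rewrite mulr2n; lra.
  by rewrite mulr2n; lra.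
rewrite integral_indic//; last exact: measurable_Sbox.
by rewrite setIT lebS_box ?ltry// mulrn_wge0.
Qed.

(** Test the form on e_i + e_j and e_i - e_j, whose squared lengths are at most 4 (attained for i =
    j). As the diagonal entries are nonnegative, |S i j| is at most 2m. *)
Lemma Kset_Sball m : 0 < m -> Kset m `<=` Sball (m *+ 2).
Proof.
move=> m0 S SP i j.
have key c : c = 1 \/ c = -1 -> 0 <= S i i + c * S i j *+ 2 + c ^+ 2 * S j j <= m * 4.
  move=> cE; have c2 : c ^+ 2 = 1 by case: cE => ->; rewrite ?sqrrN expr1n.
  have := SP (delta_mx 0 i + c *: delta_mx 0 j).
  rewrite !qf_delta ?Symmx_tr ?trmx1// => /andP[h1 h2].
  have : 0 <= (1%:M : 'M[R]_n) i i + c * (1%:M : 'M[R]_n) i j *+ 2 + c ^+ 2 * (1%:M : 'M[R]_n) j j <= 4.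
    by rewrite !mxE !eqxx c2 !mulr2n; case: cE => ->; case: (i == j) => /=; lra.
  move=> /andP[h3 h4]; rewrite (le_trans _ h1) ?mulr_ge0 ?invr_ge0 ?(ltW m0)//=.
  by rewrite (le_trans h2)// ler_pM2l.
have Skk k : 0 <= S k k.
  have := SP (delta_mx 0 k + 0 *: delta_mx 0 k).
  rewrite !qf_delta ?Symmx_tr ?trmx1// !mul0r mul0rn !addr0 expr0n !mul0r !addr0.
  by rewrite !mxE eqxx mulr1 => /andP[+ _]; apply: le_trans; rewrite invr_ge0 ltW.
have := key _ (or_introl erefl); have := key _ (or_intror erefl) => k1 k2.
move: k1 k2; rewrite sqrrN !expr1n => k1 k2.
have := Skk i; have := Skk j; rewrite ler_norml; move: k1 k2.
by rewrite !mulr2n; lra.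
Qed.

Lemma lebS_Kset m : 0 < m -> (lebS R n (Kset m) < +oo)%E.
Proof.
move=> m0; apply: (@le_lt_trans _ _ (lebS R n (Sball (m *+ 2)))); last exact: lebS_ball.
apply: le_measure; rewrite ?inE; [exact: measurable_Kset|exact: measurable_Sball|].
exact: Kset_Sball.
Qed.

Lemma measurable_congr_act g :
  measurable_fun setT (congr_act g : borel (Sym R n) -> borel (Sym R n)).
Proof.
apply: measurable_Sym; apply: measurable_mulmx; last exact: measurable_cst_mx.
by apply: measurable_mulmx; [exact: measurable_cst_mx|exact: measurable_Sym_coord].
Qed.

Lemma congr_actK g : cancel (congr_act g) (congr_act (g^-1)%g : Sym R n -> Sym R n).
Proof. by move=> S; rewrite -congr_actM mulVg congr_act1. Qed.

Lemma congr_actVK g : cancel (congr_act (g^-1)%g) (congr_act g : Sym R n -> Sym R n).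
Proof. by move=> S; rewrite -congr_actM mulgV congr_act1. Qed.

Lemma orthogonal_Kset k m : k \in @orthogonal_group R n -> 
  congr_act k @^-1` Kset m = Kset m.
Proof.
have sub h : h \in @orthogonal_group R n -> Kset m `<=` congr_act h @^-1` Kset m.
  move=> /eqP hO S SP v; rewrite /= qf_congr.
  have -> : qf 1%:M v = qf 1%:M (v *m h) by rewrite -qf_gram hO.
  exact: SP.
move=> kO; apply/seteqP; split; last exact: sub.
have kV : (k^-1)%g \in @orthogonal_group R n by rewrite gpredV.
by move=> S /(sub _ kV); rewrite /= congr_actK.
Qed.

(** Congruence by g replaces v by v g, so it suffices that the squared lengths of v and v g differ
    by a factor of at most 2 when g is near 1. *)
Lemma Kset_near1 : exists2 e : R, 0 < e & forall g : GL R n,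
  (forall i j, `|g i j - (1%:M : 'M[R]_n) i j| < e) ->
  forall m, 0 < m -> congr_act g @^-1` Kset m `<=` Kset (m * 2) /\
                  Kset m `<=` congr_act g @^-1` Kset (m * 2).
Proof.
pose c := n%:R * n%:R : R.
have c0 : 0 <= c by rewrite mulr_ge0.
(* As e is at most 1, squared entries of g - 1 are at most e, and their n^2 terms add up to at most
   1/12. The value 1/12 is exactly what turns the bounds [h1] and [h2] below, with coefficients 3/2
   and 3, into the factor 2. *)
pose e := Num.min 1 ((c * 12 + 1)^-1) : R.
have e0 : 0 < e by rewrite lt_min ltr01 invr_gt0 ltr_wpDl// mulr_ge0.
exists e => // g gP m m0.
pose N := (g : 'M[R]_n) - 1%:M.
have fN : frob N <= 12^-1.
  have -> : frob N = \sum_(i < n) \sum_(j < n) N i j ^+ 2 by [].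
  apply: (@le_trans _ _ (\sum_(i < n) \sum_(j < n) e)).
    apply: ler_sum => i _; apply: ler_sum => j _; rewrite !mxE.
    have /ltW := gP i j; rewrite !mxE -real_normK ?num_real//.
    have : e <= 1 by rewrite ge_min lexx.
    have := normr_ge0 ((g : 'M[R]_n) i j - (i == j)%:R).
    by set x := `|_|; nra.
  have -> : \sum_(i < n) \sum_(j < n) e = e * c.
    by rewrite !sumr_const card_ord -!mulrnA -mulr_natr natrM.
  have : e <= (c * 12 + 1)^-1 by rewrite ge_min lexx orbT.
  move=> /(ler_wpM2r c0)/le_trans; apply.
  by rewrite mulrC ler_pdivrMr ?ltr_wpDl ?mulr_ge0//; lra.
have V v : qf 1%:M v <= 2 * qf 1%:M (v *m g) /\ qf 1%:M (v *m g) <= 2 * qf 1%:M v.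
  have gE : v *m g = v + v *m N by rewrite mulmxBr mulmx1 addrC subrK.
  have := qf1_mul_le N v; move: (v *m N) gE => w gE wle.
  have wv : qf 1%:M w <= 12^-1 * qf 1%:M v.
    by rewrite (le_trans wle)// ler_wpM2r ?qf1_ge0.
  have h1 : qf 1%:M (v *m g) <= (3 / 2) * qf 1%:M v + 3 * qf 1%:M w.
    rewrite gE !qf1E !mulr_sumr -big_split/=; apply: ler_sum => i _; rewrite !mxE.
    by have := sqr_ge0 (v 0 i - 2 * w 0 i); rewrite !expr2; lra.
  have h2 : qf 1%:M v <= (3 / 2) * qf 1%:M (v *m g) + 3 * qf 1%:M w.
    rewrite gE !qf1E !mulr_sumr -big_split/=; apply: ler_sum => i _; rewrite !mxE.
    by have := sqr_ge0 (v 0 i + 3 * w 0 i); rewrite !expr2; lra.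
  have := qf1_ge0 v; lra.
have gU := GLmx_unit g.
split=> [S SP v|S SP v].
  have := SP (v *m invmx g); rewrite /= qf_congr mulmxKV//.
  have [v1 v2] := V (v *m invmx g); rewrite mulmxKV// in v1 v2.
  move=> /andP[h1 h2]; apply/andP; split.
    apply: le_trans h1; rewrite invfM -mulrA ler_pM2l ?invr_gt0//.
    by rewrite ler_pdivrMl.
  by rewrite (le_trans h2)// -mulrA ler_pM2l.
rewrite /= qf_congr; have := SP (v *m g); have [v1 v2] := V v.
move=> /andP[h1 h2]; apply/andP; split.
  apply: le_trans h1; rewrite invfM -mulrA ler_pM2l ?invr_gt0//.
  by rewrite ler_pdivrMl.
by rewrite (le_trans h2)// -mulrA ler_pM2l.
Qed.

End pinched_sets.

(** * Multipliers of measures under congruence *)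

Section measure_characters.
Variables (R : realType) (n : nat).
Local Open Scope ereal_scope.

(** A set of finite nonzero mass shows that chi is multiplicative and trivial on O(n). Sandwiching
    [Kset m0] and [Kset (m0 * 2)] bounds chi g and its inverse by the ratio of their masses for g
    near 1. *)
Lemma measure_character (nu : {measure set (borel (Sym R n)) -> \bar R}) (chi : GL R n -> R) :
  (forall g, (0 < chi g)%R) ->
  (forall g (A : set (borel (Sym R n))), measurable A ->
    nu (congr_act g @^-1` A) = (chi g)^-1%:E * nu A) ->
  (forall m : R, (0 < m)%R -> nu (@Kset R n m) < +oo) ->
  nu (@posdef R n) != 0 ->
  exists s : R, forall g : GL R n, chi g = (`|\det g| `^ s)%R.
Proof.
move=> chi0 nuchi nuK nup.
have [m nuKm] : exists m : nat, nu (@Kset R n m.+1%:R) != 0.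
  apply: contrapT => /forallNP nuK0; move/eqP: nup; apply.
  have Km0 m : nu (@Kset R n m.+1%:R) = 0 by have /negP := nuK0 m; rewrite negbK => /eqP.
  rewrite posdefE; apply/eqP; rewrite eq_le measure_ge0 andbT.
  apply: (le_trans (@measure_sigma_subadditive _ _ _ nu _ (fun m : nat => Kset m.+1%:R) _ _ _)) => //.
  - by move=> k; exact: measurable_Kset.
  - by apply: bigcupT_measurable => k; exact: measurable_Kset.
  - by rewrite eseries0.
pose m0 : R := m.+1%:R.
have m0_gt0 : (0 < m0)%R by rewrite ltr0n.
pose b (r : R) := fine (nu (@Kset R n r)).
have bE (r : R) : (0 < r)%R -> nu (@Kset R n r) = (b r)%:E.
  by move=> r0; rewrite /b fineK// ge0_fin_numE ?nuK.
have bm0 : (0 < b m0)%R by rewrite -lte_fin -bE// lt0e nuKm measure_ge0.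
have mK r : measurable (Kset r : set (borel (Sym R n))) by exact: measurable_Kset.
have mpre g (A : set (borel (Sym R n))) : measurable A ->
    measurable (congr_act g @^-1` A : set (borel (Sym R n))).
  by move=> mA; rewrite -[X in measurable X]setTI; exact: measurable_congr_act.
have chiM g h : chi (g * h)%g = (chi g * chi h)%R.
  have := nuchi (g * h)%g _ (mK m0).
  have -> : congr_act (g * h)%g @^-1` Kset m0 = congr_act h @^-1` (congr_act g @^-1` @Kset R n m0).
    by apply/seteqP; split=> S /=; rewrite congr_actM.
  rewrite nuchi; last exact: mpre.
  rewrite nuchi// muleA bE// -!EFinM => -[] /(mulIf (lt0r_neq0 bm0)) /esym/(congr1 GRing.inv).
  by rewrite invfM !invrK mulrC.
have chiO k : k \in @orthogonal_group R n -> chi k = 1%R.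
  move=> kO; have := nuchi k _ (mK m0); rewrite orthogonal_Kset// bE// -EFinM => -[].
  rewrite -{1}(mul1r (b m0)) => /(mulIf (lt0r_neq0 bm0)) /(congr1 GRing.inv).
  by rewrite invr1 invrK.
have [e e0 eP] := @Kset_near1 R n.
pose B := (b (m0 * 2) / b m0)%R.
have chiB (g : GL R n) : (forall i j, `|g i j - (1%:M : 'M[R]_n) i j| < e)%R ->
    (`|ln (chi g)| <= ln B)%R.
  move=> gP; have [s1 s2] := eP g gP m0 m0_gt0.
  have m20 : (0 < m0 * 2)%R by rewrite mulr_gt0.
  have h1 : ((chi g)^-1 <= B)%R.
    have : nu (congr_act g @^-1` Kset m0) <= nu (Kset (m0 * 2)).
      by apply: le_measure; rewrite ?inE//; exact: mpre.
    by rewrite nuchi// !bE// -EFinM lee_fin /B ler_pdivlMr.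
  have h2 : (chi g <= B)%R.
    have : nu (Kset m0) <= nu (congr_act g @^-1` Kset (m0 * 2)).
      by apply: le_measure; rewrite ?inE//; exact: mpre.
    by rewrite nuchi// !bE// -EFinM lee_fin ler_pdivlMl// /B ler_pdivlMr.
  have B0 : (0 < B)%R by rewrite (lt_le_trans _ h2).
  rewrite ler_norml lerNl -lnV ?posrE// !ler_ln ?posrE ?invr_gt0//.
  by rewrite h1 h2.
(* Singular matrices receive the value at the identity. *)
pose F (A : 'M[R]_n) := ln (chi (insubd (1%g : GL R n) A)).
have FE (g : GL R n) : F g = ln (chi g) by rewrite /F (valKd (1%g : GL R n) g).
have FM A A' : A \in unitmx -> A' \in unitmx -> F (A *m A') = (F A + F A')%R.
  move=> AU AU'; rewrite -[A]/(GLmx (MkGL AU)) -[A']/(GLmx (MkGL AU')).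
  rewrite -[_ *m _]/(GLmx (MkGL AU * MkGL AU')%g) !FE chiM lnM ?posrE//.
have [||s sP] := @gl_hom_ln_det R n F FM e (ln B) e0.
- by move=> A AU; rewrite -[A]/(GLmx (MkGL AU)) FE; exact: chiB.
- move=> A AO; have AU : A \in unitmx by have [] := mulmx1_unit AO.
  rewrite -[A]/(GLmx (MkGL AU)) FE chiO ?ln1//; exact/eqP.
exists s => g; apply: ln_inj; rewrite ?posrE ?chi0 ?powR_gt0//.
  by rewrite normr_gt0 -unitfE -unitmxE GLmx_unit.
by rewrite ln_powR -FE sP// GLmx_unit.
Qed.

(* Translation invariance alone determines the image of Lebesgue measure up to a
   constant; its value is found in [lebS_congr_act]. *)
Lemma lebS_congr_char : exists2 c : GL R n -> R, (forall g, (0 < c g)%R) &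
  forall g (F : Sym R n -> \bar R),
    measurable_fun setT (F : borel (Sym R n) -> \bar R) -> (forall S, 0 <= F S) ->
    \int[lebS R n]_S F (congr_act g S) = (c g)^-1%:E * \int[lebS R n]_S F S.
Proof.
pose C g := lebS R n (congr_act g @^-1` Sbox 1).
have key g (F : Sym R n -> \bar R) :
    measurable_fun setT (F : borel (Sym R n) -> \bar R) -> (forall S, 0 <= F S) ->
    \int[lebS R n]_S F (congr_act g S) = C g * \int[lebS R n]_S F S.
  move=> mF F0; have mg := @measurable_congr_act R n g.
  have sf := sigma_finite_image mg (lebS R n) (@measurable_congr_act R n (g^-1)%g)
    (@congr_actK R n g).
  pose nu := mk_sigma_finite sf.
  have nuE (G : Sym R n -> \bar R) :
      measurable_fun setT (G : borel (Sym R n) -> \bar R) -> (forall S, 0 <= G S) ->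
      \int[nu]_S G S = \int[lebS R n]_S G (congr_act g S).
    exact: (integral_image mg (lebS R n)).
  rewrite -nuE// (@lebS_unique _ _ nu) => // S0 G mG G0.
  have mGS : measurable_fun setT (fun S : borel (Sym R n) => G (S0 + S)%R).
    apply: (measurableT_comp mG).
    exact: (measurable_fun_pair2 (S0 : borel (Sym R n)) (@measurable_Sym_add R n)).
  rewrite (nuE _ mGS (fun=> G0 _)) (nuE _ mG G0).
  have mGg : measurable_fun setT (fun S : borel (Sym R n) => G (congr_act g S)).
    exact: (measurableT_comp mG mg).
  rewrite -[RHS](lebS_shift (congr_act (g^-1)%g S0) mGg)//.
  by apply: eq_integral => S _; rewrite linearD/= congr_actVK.
have me : measurable_fun setT (fun S : borel (Sym R n) => (\1_(Sbox 1) S)%:E : \bar R).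
  by apply/measurable_EFinP; apply: measurable_indic; exact: measurable_Sbox.
have box1 : \int[lebS R n]_S (\1_(Sbox 1) S)%:E = 1.
  by rewrite integral_indic ?setIT ?lebS_box ?expr1n//; exact: measurable_Sbox.
(* Applying the scaling by g after that by g^-1 gives the identity; hence no C g is 0 or
   infinite. *)
have CV g : C (g^-1)%g * C g = 1.
  have := key g (fun S => (\1_(Sbox 1) (congr_act (g^-1)%g S))%:E).
  have mV : measurable_fun setT (fun S : borel (Sym R n) =>
      (\1_(Sbox 1) (congr_act (g^-1)%g S))%:E : \bar R).
    exact: (measurableT_comp me (@measurable_congr_act R n (g^-1)%g)).
  move=> /(_ mV (fun S => _)).
  have := key (g^-1)%g (fun S => (\1_(Sbox 1) S)%:E) me (fun S => _).
  rewrite box1 mule1 => -> //; rewrite muleC => <-//.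
  rewrite -[RHS]box1; apply: eq_integral => S _; rewrite congr_actK//.
have C0 g : 0 <= C g by [].
have Cfin g : C g < +oo.
  rewrite ltey; apply/eqP => Cg; have := CV g; rewrite Cg.
  have := C0 (g^-1)%g; rewrite le_eqVlt => /predU1P[<-|Cg0].
    by rewrite mul0e => /esym/eqP; rewrite onee_eq0.
  by rewrite gt0_muley// => /eqP.
have Cgt0 g : 0 < C g.
  rewrite lt0e C0 andbT; apply/eqP => Cg; have := CV g.
  by rewrite Cg mule0 => /esym/eqP; rewrite onee_eq0.
have CE g : C g = (fine (C g))%:E by rewrite fineK// ge0_fin_numE.
exists (fun g => (fine (C g))^-1%R) => [g|g F mF F0].
  by rewrite invr_gt0 -lte_fin -CE.
by rewrite invrK -CE; exact: key.
Qed.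

End measure_characters.

(** * Gamma and Gaussian integrals *)

Section gamma_integral.
Variable R : realType.
Local Notation mu := (@lebesgue_measure R).

Lemma powR_is_derive (s x : R) : 0 < x ->
  is_derive x 1 ((fun t : R => t `^ s) : R -> R) (s * x `^ (s - 1)).
Proof.
move=> x0; have xin : x \in `]0, +oo[ by rewrite in_itv/= x0.
split; first exact: derivable_powR.
by rewrite -derive1E powR_derive1.
Qed.

Lemma is_derive_continuous (F : R -> R) (x d : R) : is_derive x 1 F d -> {for x, continuous F}.
Proof. by move=> [Fx _]; apply: differentiable_continuous; exact/derivable1_diffP. Qed.

Lemma powR_continuous_pos (s x : R) : 0 < x -> {for x, continuous (fun t : R => t `^ s : R)}.
Proof. by move=> x0; exact: is_derive_continuous (powR_is_derive s x0). Qed.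

Lemma integral_derive_pos (F f : R -> R) (a b : R) : 0 < a -> a < b ->
  (forall x : R, 0 < x -> is_derive x 1 F (f x)) -> (forall x : R, 0 < x -> {for x, continuous f}) ->
  (\int[mu]_(x in `[a, b]) (f x)%:E = (F b - F a)%:E)%E.
Proof.
move=> a0 ab dF cf; rewrite EFinB; apply: continuous_FTC2 => //.
- apply: continuous_in_subspaceT => x /set_mem; rewrite /= in_itv/= => /andP[ax _].
  by apply: cf; exact: lt_le_trans ax.
- split.
  + by move=> x; rewrite in_itv/= => /andP[ax _]; have [] := dF x (lt_trans a0 ax).
  + by apply: cvg_at_right_filter; exact: is_derive_continuous (dF a a0).
  + by apply: cvg_at_left_filter; exact: is_derive_continuous (dF b (lt_trans a0 ab)).
- move=> x; rewrite in_itv/= => /andP[ax _].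
  by rewrite derive1E; have [_] := dF x (lt_trans a0 ax).
Qed.

Lemma integral_inv (a b : R) : 0 < a -> a < b ->
  (\int[mu]_(x in `[a, b]) (x `^ (-1))%:E = (ln b - ln a)%:E)%E.
Proof.
move=> a0 ab; apply: integral_derive_pos => // x x0; last exact: powR_continuous_pos.
by rewrite powR_inv1 ?ltW//; exact: is_derive1_ln.
Qed.

Lemma measurable_EFin_powR (s : R) (D : set R) :
  measurable D -> measurable_fun D (fun x : R => (x `^ s)%:E : \bar R).
Proof.
by move=> mD; apply/measurable_EFinP/measurable_funTS; exact: measurable_powR.
Qed.

Lemma ereal_ge_natr_pinfty (x : \bar R) (c : R) : 0 < c ->
  (forall N : nat, (c * N.+1%:R)%:E <= x)%E -> x = +oo%E.
Proof.
move=> c0 Nx; apply: eq_infty => r.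
apply: le_trans (Nx (Num.truncn (r / c))); rewrite lee_fin mulrC -ler_pdivrMr//.
by apply: ltW; exact: truncnS_gt.
Qed.

(* Compare with [1 / x] near infinity when [-1 <= s] and near 0 otherwise. *)
Lemma integral_powR_pinfty (s : R) :
  (\int[mu]_(x in `]0%R, +oo[) (x `^ s)%:E = +oo)%E.
Proof.
apply: (@ereal_ge_natr_pinfty _ 1) => // N; rewrite mul1r.
have [e1|e1] := leP (-1) s.
  apply: (@le_trans _ _ (\int[mu]_(x in `[1%R, expR N.+1%:R]) (x `^ (-1))%:E)%E).
    rewrite integral_inv ?ltr01 ?expR_gt1 ?ltr0n//.
    by rewrite ln1 subr0 expRK.
  apply: (@le_trans _ _ (\int[mu]_(x in `[1%R, expR N.+1%:R]) (x `^ s)%:E)%E).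
    apply: ge0_le_integral => //.
    - by move=> x _; rewrite lee_fin powR_ge0.
    - exact: measurable_EFin_powR.
    - exact: measurable_EFin_powR.
    - move=> x; rewrite /= in_itv/= lee_fin => /andP[x1 _].
      by rewrite ler_powR.
  apply: ge0_subset_integral => //; first exact: measurable_EFin_powR.
  by move=> x _; rewrite lee_fin powR_ge0.
  by move=> x /=; rewrite !in_itv/= andbT => /andP[x1 _]; exact: lt_le_trans x1.
apply: (@le_trans _ _ (\int[mu]_(x in `[expR (- N.+1%:R), 1%R]) (x `^ (-1))%:E)%E).
  rewrite integral_inv ?expR_gt0 ?expR_lt1 ?oppr_lt0 ?ltr0n//.
  by rewrite ln1 expRK opprK add0r.
apply: (@le_trans _ _ (\int[mu]_(x in `[expR (- N.+1%:R), 1%R]) (x `^ s)%:E)%E).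
  apply: ge0_le_integral => //.
  - by move=> x _; rewrite lee_fin powR_ge0.
  - exact: measurable_EFin_powR.
  - exact: measurable_EFin_powR.
  - move=> x; rewrite /= in_itv/= lee_fin => /andP[x0 x1].
    have {}x0 : 0 < x by apply: lt_le_trans x0; exact: expR_gt0.
    by rewrite /powR !gt_eqF// ler_expR ler_wnM2r ?ln_le0// ltW.
apply: ge0_subset_integral => //; first exact: measurable_EFin_powR.
  by move=> x _; rewrite lee_fin powR_ge0.
move=> x /=; rewrite !in_itv/= andbT => /andP[x0 _].
by apply: lt_le_trans x0; exact: expR_gt0.
Qed.

Definition gamma_fun (s t : R) := t `^ (s - 1) * expR (- t).

(** The extended-real integral records divergence, which the real-valued [Gamma] turns into a
    default value. *)
Definition GammaE (s : R) := (\int[mu]_(t in `]0%R, +oo[) (gamma_fun s t)%:E)%E.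

Lemma measurable_gamma_fun s (D : set R) : measurable D ->
  measurable_fun D (fun t => (gamma_fun s t)%:E : \bar R).
Proof.
move=> mD; apply/measurable_EFinP/measurable_funTS.
apply: measurable_funM; first exact: measurable_powR.
by apply: measurableT_comp.
Qed.

Lemma gamma_fun_ge0 s t : 0 <= gamma_fun s t.
Proof. by rewrite mulr_ge0 ?powR_ge0 ?expR_ge0. Qed.

Lemma GammaE_gt0 s : (0 < GammaE s)%E.
Proof.
(* The minimum of the two endpoint values bounds t^(s-1) on [1, 2] whether the power increases or
   decreases. *)
pose c := Num.min (1 `^ (s - 1)) (2 `^ (s - 1)) * expR (- 2) : R.
have c0 : 0 < c by rewrite mulr_gt0 ?expR_gt0// lt_min !powR_gt0.
have sub : [set` `[1%R, 2%R]] `<=` ([set` `]0%R, +oo[] : set R).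
  by move=> t /=; rewrite !in_itv/= andbT => /andP[t1 _]; exact: lt_le_trans t1.
apply: (@lt_le_trans _ _ (\int[mu]_(t in `[1%R, 2%R]) (gamma_fun s t)%:E)%E); last first.
  apply: ge0_subset_integral => //; first exact: measurable_gamma_fun.
  by move=> t _; rewrite lee_fin gamma_fun_ge0.
apply: (@lt_le_trans _ _ (\int[mu]_(t in `[1%R, 2%R]) (cst c%:E t))%E).
  rewrite integral_cst//= lebesgue_measure_itv/= lte_fin ltr1n -EFinB -EFinM lte_fin.
  by rewrite mulr_gt0//; lra.
apply: ge0_le_integral => //.
- by move=> t _; rewrite lee_fin ltW.
- exact: measurable_gamma_fun.
- move=> t; rewrite /= in_itv/= lee_fin => /andP[t1 t2].
  apply: ler_pM; rewrite ?expR_ge0 ?le_min ?powR_ge0 ?ler_expR ?lerN2//.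
  have [s1|s1] := leP 0 (s - 1).
    by rewrite ge_min ge0_ler_powR// nnegrE ?ler01// (le_trans ler01 t1).
  have t0 : 0 < t by exact: lt_le_trans t1.
  rewrite ge_min; apply/orP; right.
  by rewrite /powR !gt_eqF// ler_expR ler_wnM2l ?ler_ln ?posrE// ltW.
Qed.

End gamma_integral.

Section gamma_finite.
Variable R : realType.
Local Notation mu := (@lebesgue_measure R).

Lemma bigcup_itv_inv : \bigcup_k [set` `[k.+2%:R^-1 : R, 1%R]] = [set` `]0%R, 1%R]].
Proof.
apply/seteqP; split => [x [k _] /=|x /=]; rewrite !in_itv/=.
  by move=> /andP[x0 ->]; rewrite andbT; apply: lt_le_trans x0; rewrite invr_gt0.
move=> /andP[x0 x1]; exists (Num.truncn x^-1) => //=; rewrite in_itv/= x1 andbT.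
rewrite -[leRHS]invrK lef_pV2 ?posrE ?invr_gt0//.
by apply: ltW; apply: lt_trans (truncnS_gt _) _; rewrite ltr_nat.
Qed.

(** The fundamental theorem is applied away from 0, on [1/(k+2), 1], and then k goes to infinity; k
    + 2 keeps the left endpoint strictly below 1. *)
Lemma integral_powR01 (s : R) : 0 < s ->
  (\int[mu]_(x in `]0%R, 1%R]) (x `^ (s - 1))%:E <= (s^-1)%:E)%E.
Proof.
move=> s0; rewrite -bigcup_itv_inv; set F := (fun k : nat => [set` _]).
have h : ((\int[mu]_(x in F k) (x `^ (s - 1))%:E) @[k --> \oo] -->
    \int[mu]_(x in \bigcup_k F k) (x `^ (s - 1))%:E)%E.
  apply: ge0_nondecreasing_set_cvg_integral => //.
  - move=> k l kl; apply/subsetPset => x; rewrite /F /=; rewrite !in_itv/= => /andP[kx ->].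
    by rewrite andbT; apply: le_trans kx; rewrite lef_pV2 ?posrE// ler_nat !ltnS.
  - by move=> k; rewrite /F.
  - by move=> k; apply: measurable_EFin_powR; rewrite /F.
  - by move=> k x _; rewrite lee_fin powR_ge0.
rewrite -(cvg_lim _ h)//; apply: lime_le; first by apply/cvg_ex; eexists; exact: h.
apply: nearW => k.
have k0 : 0 < k.+2%:R^-1 :> R by rewrite invr_gt0.
have k1 : k.+2%:R^-1 < 1 :> R by rewrite invf_lt1// ltr1n.
have dF (x : R) : 0 < x ->
    is_derive x 1 ((fun t : R => s^-1 * t `^ s) : R -> R) (x `^ (s - 1)).
  move=> x0; have := is_deriveZ s^-1 (powR_is_derive s x0).
  by rewrite /GRing.scale/= mulrA mulVf ?gt_eqF// mul1r.
rewrite (integral_derive_pos k0 k1 dF (@powR_continuous_pos R (s - 1))).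
by rewrite powR1 mulr1 lee_fin gerBl mulr_ge0 ?powR_ge0 ?invr_ge0 ?ltW.
Qed.

Lemma integral_expRN2 : (\int[mu]_(x in `[0%R, +oo[) (expR (- (2^-1 * x)))%:E = 2%:E)%E.
Proof.
have r0 : 0 < 2^-1 :> R by rewrite invr_gt0.
have /(congr1 (fun z => 2%:E * z)%E) := integral_exponential_pdf r0.
rewrite mule1 => <-; rewrite -ge0_integralZl//.
- rewrite [RHS](_ : _ = \int[mu]_x (((fun x => (expR (- (2^-1 * x)))%:E) \_ `[0%R, +oo[) x))%E.
    by rewrite -integral_mkcond.
  apply: eq_integral => x _; rewrite /exponential_pdf !patchE; case: ifP => _.
    by rewrite -EFinM mulrA divff// mul1r mulNr.
  by rewrite mule0.
- by apply/measurable_EFinP; exact: measurable_exponential_pdf.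
- by move=> x _; rewrite lee_fin exponential_pdf_ge0 ?ltW.
Qed.

(** With a = 2|s| + 1, write ln t = ln(t/a) + ln a and bound ln(t/a) by t/a; a is chosen so that
    |s|/a is at most 1/2. Half of the decay of exp(-t) thus survives. *)
Lemma powR_le_expR (s t : R) : 1 <= t ->
  t `^ s <= expR (`|s| * ln (2 * `|s| + 1)) * expR (2^-1 * t).
Proof.
move=> t1; have t0 : 0 < t by exact: lt_le_trans t1.
have a0 : 0 < 2 * `|s| + 1 by rewrite ltr_wpDl// mulr_ge0.
rewrite -expRD /powR gt_eqF// ler_expR.
apply: (@le_trans _ _ (`|s| * ln t)).
  by rewrite ler_wpM2r ?ln_ge0// ler_norm.
have -> : ln t = ln (t / (2 * `|s| + 1)) + ln (2 * `|s| + 1).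
  by rewrite -lnM ?posrE ?divr_gt0// divfK// gt_eqF.
rewrite mulrDr addrC lerD2l.
apply: (@le_trans _ _ (`|s| * (t / (2 * `|s| + 1)))).
  by rewrite ler_wpM2l//; apply: ltW; apply: ln_sublinear; rewrite divr_gt0.
rewrite mulrCA mulrC ler_pM2r// ler_pdivrMr//.
by have := normr_ge0 s; move: (`|s|) => u; lra.
Qed.

Lemma GammaE_lty (s : R) : 0 < s -> (GammaE s < +oo)%E.
Proof.
move=> s0; rewrite /GammaE.
have -> : [set` `]0%R, +oo[] = [set` `]0%R, 1%R]] `|` ([set` `]1%R, +oo[] : set R).
  apply/seteqP; split=> x /=; rewrite !in_itv/= !andbT.
    by move=> x0; case: (leP x 1) => x1; [left; rewrite x0|right].
  by case=> [/andP[]//|]; exact: lt_trans.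
rewrite ge0_integral_setU//; first last.
- apply/disj_setPS => x /=; rewrite !in_itv/= => -[/andP[_ x1]].
  by rewrite andbT ltNge x1.
- by move=> x _; rewrite lee_fin gamma_fun_ge0.
- by apply: measurable_gamma_fun; exact: measurableU.
apply: lte_add_pinfty.
  apply: le_lt_trans (ltry s^-1); apply: le_trans (integral_powR01 s0).
  apply: ge0_le_integral => //.
  - by move=> x _; rewrite lee_fin gamma_fun_ge0.
  - exact: measurable_gamma_fun.
  - exact: measurable_EFin_powR.
  - move=> x; rewrite /= in_itv/= lee_fin => /andP[x0 _].
    by rewrite ler_piMr ?powR_ge0// -expR0 ler_expR oppr_le0 ltW.
pose K := expR (`|s - 1| * ln (2 * `|s - 1| + 1)) : R.
have mE : measurable_fun setT (fun x : R => (expR (- (2^-1 * x)))%:E : \bar R).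
  apply/measurable_EFinP; apply: measurableT_comp => //.
  by apply: measurableT_comp => //; exact: measurable_funM.
apply: (@le_lt_trans _ _ (\int[mu]_(x in `]1%R, +oo[) (K%:E * (expR (- (2^-1 * x)))%:E))%E).
  apply: ge0_le_integral => //.
  - by move=> x _; rewrite lee_fin gamma_fun_ge0.
  - exact: measurable_gamma_fun.
  - by apply: measurable_funTS; exact: measurable_funeM.
  - move=> x; rewrite /= in_itv/= andbT lee_fin => x1.
    apply: le_trans (_ : K * expR (2^-1 * x) * expR (- x) <= _).
      by rewrite ler_wpM2r ?expR_ge0// powR_le_expR// ltW.
    by rewrite -mulrA -expRD ler_wpM2l ?expR_ge0// ler_expR; lra.
rewrite ge0_integralZl//; first last.
- by rewrite lee_fin expR_ge0.
- exact: measurable_funTS.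
- apply: (@le_lt_trans _ _ (K%:E * 2%:E)%E); last by rewrite -EFinM ltry.
  rewrite lee_pmul2l ?lte_fin ?expR_gt0// -integral_expRN2.
  apply: ge0_subset_integral => //; first exact: measurable_funTS.
  by move=> x /=; rewrite !in_itv/= !andbT => /ltW; exact: le_trans.
Qed.

(** On ]0, 1] the integrand is at least exp(-1) / x, whose integral over [exp(-N), 1] grows linearly
    in N. *)
Lemma GammaE_pinfty (s : R) : s <= 0 -> GammaE s = +oo%E.
Proof.
move=> s0; apply: (@ereal_ge_natr_pinfty _ _ (expR (-1))) => [|N]; first exact: expR_gt0.
apply: (@le_trans _ _ (\int[mu]_(x in `[expR (- N.+1%:R) : R, 1%R]) ((expR (-1))%:E * (x `^ (-1))%:E))%E).
  rewrite ge0_integralZl//; first last.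
  - by move=> x _; rewrite lee_fin powR_ge0.
  - exact: measurable_EFin_powR.
  rewrite integral_inv ?expR_gt0 ?expR_lt1 ?oppr_lt0 ?ltr0n//.
  by rewrite ln1 expRK opprK add0r.
apply: (@le_trans _ _ (\int[mu]_(x in `[expR (- N.+1%:R) : R, 1%R]) (gamma_fun s x)%:E)%E).
  apply: ge0_le_integral => //.
  - by move=> x _; rewrite -EFinM lee_fin mulr_ge0 ?expR_ge0 ?powR_ge0.
  - by apply: measurable_funeM; exact: measurable_EFin_powR.
  - exact: measurable_gamma_fun.
  - move=> x; rewrite /= in_itv/= => /andP[x0 x1]; rewrite -EFinM lee_fin mulrC.
    have {}x0 : 0 < x by apply: lt_le_trans x0; exact: expR_gt0.
    rewrite ler_pM ?expR_ge0 ?powR_ge0 ?ler_expR ?lerN2//.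
    by rewrite /powR !gt_eqF// ler_expR ler_wnM2r ?ln_le0// gerDr.
apply: ge0_subset_integral => //; first exact: measurable_gamma_fun.
  by move=> x _; rewrite lee_fin gamma_fun_ge0.
move=> x /=; rewrite !in_itv/= andbT => /andP[x0 _].
by apply: lt_le_trans x0; exact: expR_gt0.
Qed.

Lemma GammaE_fin (s : R) : 0 < s -> GammaE s = (Gamma s)%:E.
Proof.
move=> s0; rewrite /Gamma /Rintegral fineK//.
by rewrite ge0_fin_numE ?GammaE_lty// ltW// GammaE_gt0.
Qed.

Lemma integral_gaussian (a : R) : 0 < a ->
  (\int[mu]_x (expR (- (a^-1 * x ^+ 2)))%:E = (Num.sqrt (pi * a))%:E)%E.
Proof.
(* The integrand is a multiple of the centred normal density of variance a / 2. *)
move=> a0; have s0 : Num.sqrt (a / 2) != 0 by rewrite gt_eqF// sqrtr_gt0 divr_gt0.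
have /(congr1 (fun z => (Num.sqrt (pi * a))%:E * z)%E) := integral_normal_pdf 0 (Num.sqrt (a / 2)).
rewrite mule1 => <-; rewrite -ge0_integralZl//.
- apply: eq_integral => x _; rewrite -EFinM normal_pdfE//; congr EFin.
  rewrite /normal_peak /normal_fun sqr_sqrtr ?divr_ge0 ?ltW// subr0.
  have -> : a / 2 * pi *+ 2 = pi * a by rewrite -mulr_natr mulrAC divfK// mulrC.
  rewrite -mulr_natr divfK// mulVKf; first by rewrite mulNr mulrC.
  by rewrite gt_eqF// sqrtr_gt0 mulr_gt0// pi_gt0.
- by apply/measurable_EFinP; exact: measurable_normal_pdf.
- by move=> x _; rewrite lee_fin normal_pdf_ge0.
Qed.

End gamma_finite.

Section gaussian_tuple.
Variable R : realType.

Lemma measurable_gauss_tuple N (a : R) : measurable_fun setT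
  (fun t : N.-tuple R => (expR (- (a^-1 * \sum_i tnth t i ^+ 2)))%:E : \bar R).
Proof.
apply/measurable_EFinP; apply: measurableT_comp => //; apply: measurableT_comp => //.
apply: measurable_funM => //; apply: measurable_sum => i.
by apply: measurable_funX; exact: measurable_tnth.
Qed.

Lemma integral_gaussian_tuple N (a : R) : 0 < a ->
  (\int[leb R N]_t (expR (- (a^-1 * \sum_i tnth t i ^+ 2)))%:E = (Num.sqrt (pi * a) ^+ N)%:E)%E.
Proof.
move=> a0; elim: N => [|N IH].
  under eq_integral do rewrite big_ord0 mulr0 oppr0 expR0.
  rewrite integral_cst// mul1e; have := leb_tbox 0 (@ler01 R).
  rewrite (_ : tbox 1 = setT); first by rewrite !expr0.
  by apply/seteqP; split=> // t _ [].
rewrite leb_integralS; [|exact: measurable_gauss_tuple|by move=> t; rewrite lee_fin expR_ge0].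
have E x (t : N.-tuple R) :
    (expR (- (a^-1 * \sum_i tnth [tuple of x :: t] i ^+ 2)))%:E
    = ((expR (- (a^-1 * x ^+ 2)))%:E * (expR (- (a^-1 * \sum_i tnth t i ^+ 2)))%:E)%E.
  rewrite -EFinM -expRD -opprD -mulrDr big_ord_recl tnth0; congr (expR (- (_ * (_ + _))))%:E.
  by apply: eq_bigr => i _; rewrite tnthS.
transitivity (\int[lebesgue_measure]_x ((expR (- (a^-1 * x ^+ 2)))%:E * (Num.sqrt (pi * a) ^+ N)%:E))%E.
  apply: eq_integral => x _.
  under eq_integral do rewrite E.
  rewrite ge0_integralZl ?IH//; first exact: measurable_gauss_tuple.
rewrite ge0_integralZr ?lee_fin ?exprn_ge0 ?sqrtr_ge0//.
- by rewrite integral_gaussian// -EFinM exprS.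
- apply/measurable_EFinP; apply: measurableT_comp => //; apply: measurableT_comp => //.
  by apply: measurable_funM.
Qed.

End gaussian_tuple.

(** * The Wishart integral *)

Section wishart_integral.
Variable R : realType.

(** Extended by zero to all symmetric matrices, and defined for arbitrary y and b, so that divergent
    parameters are covered too. *)
Definition wker n (y : 'M[R]_n) (b : R) (S : Sym R n) : R :=
  \1_(@posdef R n) S * (expR (- \tr (y *m S)) * (\det S) `^ b).

Lemma wker_ge0 n y b S : 0 <= @wker n y b S.
Proof. by rewrite /wker mulr_ge0 ?mulr_ge0 ?expR_ge0 ?powR_ge0// indicE. Qed.

Lemma measurable_det_Sym n : measurable_fun setT (fun S : borel (Sym R n) => \det (S : Sym R n)).
Proof.
apply: (@continuous_borel_real _ (Sym R n)); apply: continuous_det => i j S.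
exact: (continuous_comp (@Symmx_continuous R n S) (@coord_continuous _ _ _ i j (Symmx S))).
Qed.

Lemma measurable_tr_Sym n (y : 'M[R]_n) :
  measurable_fun setT (fun S : borel (Sym R n) => \tr (y *m (S : Sym R n))).
Proof.
apply: measurable_sum => i; apply: measurable_mulmx; first exact: measurable_cst_mx.
exact: measurable_Sym_coord.
Qed.

Lemma measurable_wker n y b :
  measurable_fun setT (fun S : borel (Sym R n) => (wker y b S)%:E : \bar R).
Proof.
apply/measurable_EFinP; apply: measurable_funM.
  by apply: measurable_indic; exact: measurable_posdef.
apply: measurable_funM.
  apply: measurableT_comp => //; apply: measurableT_comp => //; exact: measurable_tr_Sym.
by apply: (measurableT_comp (measurable_powR b)); exact: measurable_det_Sym.
Qed.

Definition wint n (b : R) := (\int[lebS R n]_S (wker 1%:M b S)%:E)%E.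

Lemma wint0 b : wint 0 b = 1%E.
Proof.
have E (S : Sym R 0) : wker 1%:M b S = 1.
  rewrite /wker indicE mem_set ?mul1r; last by move=> v; rewrite thinmx0 eqxx.
  by rewrite det_mx00 powR1 mulr1 mul1mx /mxtrace big_ord0 oppr0 expR0.
rewrite /wint; under eq_integral do rewrite E.
rewrite integral_cst// mul1e.
have := lebS_box 0 (@ler01 R); rewrite expr1n (_ : Sbox 1 = setT)//.
by apply/seteqP; split=> // S _ [].
Qed.

Lemma outer_sym n (a : R) (b : 'rV[R]_n) : a^-1 *: (b^T *m b) \in @symmetric_mx R n.
Proof. by apply/eqP; rewrite linearZ/= trmx_mul trmxK. Qed.

(** In terms of the corner a, the row t and the Schur complement C, the determinant is a det C and
    the trace is a + |t|^2 / a + tr C, so the kernel separates once a is fixed. *)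
Lemma wker_Sym_block n (b a : R) (t : n.-tuple R) (C : Sym R n) : 0 < a ->
  wker 1%:M b (Sym_block a (trow t) (MkSym (outer_sym a (trow t)) + C))
  = (expR (- a) * a `^ b) * (expR (- (a^-1 * \sum_i tnth t i ^+ 2)) * wker 1%:M b C).
Proof.
move=> a0; set T := trow t.
have SE : Symmx (Sym_block a T (MkSym (outer_sym a T) + C))
    = block_mx a%:M T T^T (Symmx C + a^-1 *: (T^T *m T)) by rewrite /= addrC.
have pE : posdef (Sym_block a T (MkSym (outer_sym a T) + C)) <-> posdef C.
  have := @pdmx_block_ul R n a T C (lt0r_neq0 a0); rewrite -SE => h.
  by rewrite -[posdef _]/(pdmx _) h; split=> [[]|].
rewrite /wker !indicE; have -> : (Sym_block a T (MkSym (outer_sym a T) + C) \in @posdef R (1 + n))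
    = (C \in @posdef R n) by apply/idP/idP => /set_mem/pE/mem_set.
case: (boolP (C \in _)) => [/set_mem Cp|_]; last by rewrite !mul0r !mulr0.
rewrite !mul1r !mul1mx SE det_block_ul ?lt0r_neq0// mxtrace_block mxtrace_scalar mulr1n.
have C0 : 0 < \det C by apply: pdmx_det_gt0 => //; exact: Symmx_tr.
rewrite powRM ?ltW// mxtraceD mxtraceZ.
have -> : \tr (T^T *m T) = \sum_i tnth t i ^+ 2.
  by rewrite mxtrace_mulC /mxtrace big_ord1 mxE; apply: eq_bigr => i _; rewrite !mxE -expr2.
by rewrite !opprD !expRD; ring.
Qed.

Lemma wker_Sym_block_npos n (b a : R) (t : n.-tuple R) (C : Sym R n) : ~ 0 < a ->
  wker 1%:M b (Sym_block a (trow t) C) = 0.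
Proof.
move=> a0; rewrite /wker indicE memNset ?mul0r// => /(@pdmx_block_gt0 _ n a).
exact: a0.
Qed.

Lemma wint_ge0 n b : (0 <= wint n b)%E.
Proof. by apply: integral_ge0 => S _; rewrite lee_fin wker_ge0. Qed.

(** The Gaussian integral over the row gives (pi a)^(n/2); its power of a joins a^b exp(-a) to form
    the Gamma integral at b + n/2 + 1, and C contributes the same integral in dimension n, with b
    unchanged. *)
Lemma wintS n (b : R) :
  wint (1 + n) b = ((Num.sqrt pi ^+ n)%:E * GammaE (b + n%:R / 2 + 1) * wint n b)%E.
Proof.
rewrite /wint lebS_block_integral; [|exact: measurable_wker|by move=> S; rewrite lee_fin wker_ge0].
pose k := ((Num.sqrt pi ^+ n)%:E * wint n b)%E.
have k0 : (0 <= k)%E by rewrite mule_ge0 ?wint_ge0// lee_fin exprn_ge0 ?sqrtr_ge0.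
transitivity (\int[lebesgue_measure]_(a in [set` `]0%R, +oo[])
    ((gamma_fun (b + n%:R / 2 + 1) a)%:E * k))%E; last first.
  rewrite ge0_integralZr//; first by rewrite /k /GammaE muleCA muleA.
  - exact: measurable_gamma_fun.
  - by move=> a _; rewrite lee_fin gamma_fun_ge0.
rewrite [RHS]integral_mkcond; apply: eq_integral => a _.
rewrite patchE mem_setE in_itv/= andbT; case: ifPn => [a0|/negP a0]; last first.
  rewrite -[RHS]/(0%E : \bar R) -[RHS](integral0 (leb R n) setT).
  apply: eq_integral => t _; rewrite /cst -[RHS](integral0 (lebS R n) setT).
  by apply: eq_integral => C _; rewrite wker_Sym_block_npos.
have mwC (t : n.-tuple R) : measurable_fun setT (fun C : borel (Sym R n) =>
    (wker 1%:M b (Sym_block a (trow t) C))%:E : \bar R).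
  have := measurable_Sym_block (@measurable_wker (1 + n) 1%:M b).
  by move=> h; exact: (measurable_fun_pair2 _ (measurable_fun_pair2 _ h)).
have E (t : n.-tuple R) : (\int[lebS R n]_C (wker 1%:M b (Sym_block a (trow t) C))%:E
    = (expR (- (a^-1 * \sum_i tnth t i ^+ 2)))%:E * ((expR (- a) * a `^ b)%:E * wint n b))%E.
  (* Passing from the lower right block to the Schur complement is a translation for fixed a and
     t. *)
  rewrite -(lebS_shift (MkSym (outer_sym a (trow t))) (mwC t)); last first.
    by move=> S; rewrite lee_fin wker_ge0.
  under eq_integral do rewrite wker_Sym_block// mulrA (mulrC _ (expR _)) EFinM.
  rewrite ge0_integralZl ?lee_fin ?mulr_ge0 ?expR_ge0 ?powR_ge0//.
  - by rewrite EFinM muleA.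
  - exact: measurable_wker.
  - by move=> S _; rewrite lee_fin wker_ge0.
under eq_integral do rewrite E.
rewrite ge0_integralZr; first last.
- by rewrite mule_ge0 ?wint_ge0// lee_fin mulr_ge0 ?expR_ge0 ?powR_ge0.
- by move=> t _; rewrite lee_fin expR_ge0.
- exact: measurable_gauss_tuple.
- exact: measurableT.
rewrite integral_gaussian_tuple// /k !muleA; congr (_ * _)%E; rewrite -!EFinM; congr EFin.
rewrite sqrtrM ?ltW ?pi_gt0// exprMn /gamma_fun addrK powRD; last by rewrite (gt_eqF a0) implybT.
have -> : a `^ (n%:R / 2) = Num.sqrt a ^+ n.
  by rewrite mulrC powRrM powR12_sqrt ?ltW// powR_mulrn// sqrtr_ge0.
by ring.
Qed.

Lemma wint_gt0 n b : (0 < wint n b)%E.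
Proof.
elim: n b => [|n IH] b; first by rewrite wint0.
rewrite (wintS n) mule_gt0// mule_gt0 ?GammaE_gt0// lte_fin exprn_gt0// sqrtr_gt0.
exact: pi_gt0.
Qed.

(** The factor of dimension one is the Gamma integral at b + 1, which diverges; all further factors
    are positive and cannot cancel this. *)
Lemma wint_pinfty n (b : R) : (0 < n)%N -> b <= -1 -> wint n b = +oo%E.
Proof.
case: n => // n _ b1; elim: n => [|n IH].
  rewrite (wintS 0) wint0 expr0 mul1e mule1 mul0r addr0 GammaE_pinfty//; lra.
rewrite (wintS n.+1) IH gt0_muley// mule_gt0 ?GammaE_gt0// lte_fin exprn_gt0// sqrtr_gt0.
exact: pi_gt0.
Qed.

Lemma wint_fin n (b : R) : -1 < b ->
  wint n b = (pi `^ (n%:R * (n%:R - 1) / 4)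
    * \prod_(1 <= k < n.+1) Gamma (b + (n%:R + 1) / 2 - (k%:R - 1) / 2))%:E.
Proof.
move=> b1; elim: n => [|n IH].
  by rewrite wint0 big_nil mul0r mul0r powRr0 mulr1.
rewrite (wintS n) [in RHS]big_nat_recl// IH.
rewrite GammaE_fin; last first.
  by have : 0 <= n%:R :> R by []; lra.
rewrite -!EFinM; congr EFin.
have -> : pi `^ (n.+1%:R * (n.+1%:R - 1) / 4) = Num.sqrt pi ^+ n * pi `^ (n%:R * (n%:R - 1) / 4) :> R.
  rewrite -(@powR_mulrn _ (Num.sqrt pi) n) ?sqrtr_ge0// -powR12_sqrt ?ltW ?pi_gt0//.
  rewrite -powRrM -powRD; last by rewrite (gt_eqF (pi_gt0 R)) implybT.
  by congr (_ `^ _); rewrite -natr1; field.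
(* The new Gamma factor is the one with k = 1 in dimension n + 1; the old factor k becomes the new
   factor k + 1, since (n+1)/2 also moves by 1/2. *)
have -> : b + n%:R / 2 + 1 = b + (n.+1%:R + 1) / 2 - (1%:R - 1) / 2.
  by rewrite -natr1; field.
rewrite -!mulrA; congr (_ * _); rewrite mulrCA; congr (_ * (_ * _)).
by apply: eq_big_nat => k _; congr Gamma; rewrite -!natr1; field.
Qed.

End wishart_integral.

(** Doubled to avoid a division: adding the count of i <= j to its transpose counts every pair once
    and the diagonal twice. *)
Lemma card_upper n : (#|upper n| * 2 = n * n.+1)%N.
Proof.
have -> : #|upper n| = (\sum_(i < n) \sum_(j < n) (i <= j))%N.
  rewrite pair_big/= card_sig -sum1_card big_mkcond/=.
  by apply: eq_bigr => -[i j] _ /=; rewrite inE/=; case: leqP.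
rewrite muln2 -addnn [X in (_ + X)%N]exchange_big -big_split/=.
rewrite (eq_bigr (fun=> n.+1)) ?sum_nat_const ?card_ord// => i _.
rewrite -big_split/= (eq_bigr (fun j : 'I_n => 1 + (j == i))%N); last first.
  move=> j _; rewrite -val_eqE/=; by case: ltngtP.
rewrite big_split/= sum1_card card_ord (bigD1 i)//= eqxx big1 ?addn0 ?addn1// => j /negPf ->.
by [].
Qed.

(** * The Jacobian of a congruence *)

Section lebesgue_congruence.
Variables (R : realType) (n : nat).

(** If the cone were a null set, the positive integral [wint n 0] would vanish. *)
Lemma lebS_posdef_neq0 : lebS R n (@posdef R n) != 0%E.
Proof.
apply/eqP => p0; have := @wint_gt0 R n 0; rewrite /wint.
rewrite (_ : (\int[_]_S _)%E = 0%E) ?ltxx//.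
transitivity (\int[lebS R n]_(S in @posdef R n) (wker 1%:M 0 S)%:E)%E.
  rewrite [RHS]integral_mkcond; apply: eq_integral => S _.
  rewrite patchE; case: ifPn => // Sp; rewrite /wker indicE (negPf Sp) mul0r//.
apply: null_set_integral => //; first exact: measurable_posdef.
by apply: measurable_funTS; exact: measurable_wker.
Qed.

Lemma lebS_congr (g : GL R n) (F : Sym R n -> \bar R) : (0 < n)%N ->
  measurable_fun setT (F : borel (Sym R n) -> \bar R) -> (forall S, (0 <= F S)%E) ->
  (\int[lebS R n]_S F (congr_act g S)
   = (`|\det g| `^ (n%:R + 1))^-1%:E * \int[lebS R n]_S F S)%E.
Proof.
move=> n0 mF F0; have [c c0 cF] := lebS_congr_char R n.
have cA h (A : set (borel (Sym R n))) : measurable A ->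
    lebS R n (congr_act h @^-1` A) = ((c h)^-1%:E * lebS R n A)%E.
  move=> mA; have mh := measurable_congr_act h.
  rewrite -[A in RHS]setIT -integral_indic// -cF; last 2 first.
  - by apply/measurable_EFinP; exact: measurable_indic.
  - by move=> S; rewrite lee_fin indicE.
  rewrite -[LHS](congr1 _ (setIT _)) -integral_indic//.
  by rewrite -[_ @^-1` _]setTI; exact: mh.
have [s sE] := measure_character c0 cA (@lebS_Kset R n) lebS_posdef_neq0.
rewrite cF// sE; suff -> : s = n%:R + 1 by [].
(* Congruence by 2I multiplies entries by 4, so comparing boxes gives 4^(n(n+1)/2) = (2^n)^s. Taking
   logarithms and cancelling n, which is positive, gives s = n + 1. *)
have u2 : (2%:M : 'M[R]_n) \in unitmx by rewrite unitmxE det_scalar unitfE expf_neq0.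
have := cA (MkGL u2) (Sbox 4%:R) (measurable_Sbox _).
rewrite (_ : _ @^-1` _ = Sbox 1); last first.
  apply/seteqP; split=> S /= SP i j; have := SP i j;
    by rewrite /= tr_scalar_mx mul_mx_scalar mul_scalar_mx !mxE => /andP[? ?]; apply/andP; split; lra.
rewrite !lebS_box// expr1n sE /= det_scalar ger0_norm ?exprn_ge0// -EFinM => -[] /esym.
have p0 : 0 < (2 ^+ n : R) `^ s by rewrite powR_gt0// exprn_gt0.
move=> /(congr1 (fun z => z * (2 ^+ n) `^ s)); rewrite mul1r mulrAC mulVf ?gt_eqF// mul1r.
rewrite (_ : 4%:R = 2 ^+ 2 :> R); last by rewrite expr2 -natrM.
rewrite -exprM mulnC card_upper -!powR_mulrn// -powRrM => /(congr1 (@ln R)).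
have l2 : ln (2 : R) != 0 by rewrite gt_eqF// ln_gt0// ltr1n.
rewrite !ln_powR => /(mulIf l2).
rewrite natrM => /mulfI <-; first by rewrite -natr1.
by rewrite pnatr_eq0 -lt0n.
Qed.

End lebesgue_congruence.

Section block_swap.
Variables (R : realType) (n : nat).
Local Open Scope ereal_scope.

(** The same decomposition with the corner innermost, since divergence is seen in the corner
    alone. *)
Lemma lebS_block_integral_corner (F : Sym R (1 + n) -> \bar R) :
  measurable_fun setT (F : borel (Sym R (1 + n)) -> \bar R) -> (forall S, 0 <= F S) ->
  \int[lebS R (1 + n)]_S F S
  = \int[(leb R n \x lebS R n)]_q \int[lebesgue_measure]_a F (Sym_block a (trow q.1) q.2).
Proof.
move=> mF F0; rewrite lebS_block_integral//.
have mFt := measurable_Sym_block mF.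
pose m23 := mk_sigma_finite (sigma_finite_prod (leb R n) (lebS R n)).
rewrite -[RHS](@fubini_tonelli2 _ _ _ _ _ (@lebesgue_measure R) m23 _ mFt)//.
rewrite (@fubini_tonelli1 _ _ _ _ _ (@lebesgue_measure R) m23 _ mFt)//.
apply: eq_integral => a _; rewrite /fubini_F.
have mFa := measurable_fun_pair2 a mFt.
by rewrite [RHS](@fubini_tonelli1 _ _ _ _ _ (leb R n) (lebS R n) _ mFa (fun q => F0 _)).
Qed.

End block_swap.

(** * The integral for general y: reduction to y = 1 and divergence *)

Section wishart_divergence.
Variables (R : realType).

Lemma sqr_powR (x : R) : x ^+ 2 = `|x| `^ 2.
Proof. by rewrite powR_mulrn// real_normK// num_real. Qed.

Lemma wker_congr n (g : GL R n) (y : 'M[R]_n) b (S : Sym R n) :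
  wker y b (congr_act g S) = `|\det g| `^ (2 * b) * wker (g^T *m y *m g) b S.
Proof.
have pE : posdef (congr_act g S) <-> posdef S.
  exact: (pdmx_congr (Symmx S) (GLmx_unit g)).
rewrite /wker !indicE; have -> : (congr_act g S \in @posdef R n) = (S \in @posdef R n).
  by apply/idP/idP => /set_mem/pE/mem_set.
case: (boolP (S \in _)) => [/set_mem Sp|_]; last by rewrite !mul0r mulr0.
have S0 : 0 < \det S by apply: pdmx_det_gt0 => //; exact: Symmx_tr.
rewrite !mul1r /= !det_mulmx det_tr mulrAC -expr2 sqr_powR.
rewrite powRM ?powR_ge0 ?ltW// -powRrM mulrCA; congr (_ * (expR (- _) * _)).
by rewrite mulmxA mxtrace_mulC !mulmxA.
Qed.

Lemma mule_cancel (u v : R) (I J : \bar R) : 0 < u ->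
  (u%:E * I = (v^-1)%:E * J -> I = ((u * v)^-1)%:E * J)%E.
Proof.
move=> u0 /(congr1 (fun z => (u^-1)%:E * z)%E).
by rewrite !muleA -!EFinM mulVf ?gt_eqF// mul1e invfM.
Qed.

Lemma integral_wker_congr n (g : GL R n) (y : 'M[R]_n) b : (0 < n)%N ->
  (\int[lebS R n]_S (wker (g^T *m y *m g) b S)%:E
   = ((`|\det g| `^ (2 * b + (n%:R + 1)))^-1)%:E * \int[lebS R n]_S (wker y b S)%:E)%E.
Proof.
move=> n0; have d0 : 0 < `|\det g| by rewrite normr_gt0 -unitfE -unitmxE GLmx_unit.
have w0 z S : (0 <= (@wker R n z b S)%:E)%E by rewrite lee_fin wker_ge0.
have := lebS_congr g n0 (measurable_wker y b) (w0 _).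
under eq_integral do rewrite wker_congr EFinM.
rewrite ge0_integralZl ?lee_fin ?powR_ge0//; last exact: measurable_wker.
rewrite (@powRD _ _ (2 * b)); last by rewrite (gt_eqF d0) implybT.
apply: mule_cancel; exact: powR_gt0.
Qed.

(** Congruence by the transpose of the Cholesky factor of z carries the parameter 1 to z. *)
Lemma integral_wker_pd n (z : SymPos R n) b : (0 < n)%N ->
  (\int[lebS R n]_S (wker (posmx z) b S)%:E
   = (\det (posmx z) `^ (- (b + (n%:R + 1) / 2)))%:E * wint n b)%E.
Proof.
move=> n0; have gU : (chol (posmx z))^T \in unitmx.
  by rewrite unitmx_tr; exact: cholesky_factor_unit (choleskyP z).
have := integral_wker_congr (MkGL gU) 1%:M b n0.
rewrite /= trmxK mulmx1 cholesky_gram => ->; rewrite /wint; congr (_%:E * _)%E.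
rewrite -[in RHS](cholesky_gram z) det_mulmx det_tr -expr2 sqr_powR.
by rewrite -powRN -powRrM; congr (_ `^ _); field.
Qed.

(** Only the slope in the corner matters; K collects everything that does not depend on it. *)
Lemma tr_Sym_block n (y : 'M[R]_(1 + n)) (T : 'rV[R]_n) (C : Sym R n) : exists K,
  forall a, \tr (y *m Sym_block a T C) = y ord0 ord0 * a + K.
Proof.
exists (\tr (ursubmx y *m T^T) + \tr (dlsubmx y *m T + drsubmx y *m C)) => a.
rewrite -[in LHS](submxK y) mulmx_block mxtrace_block addrA; congr (_ + _).
rewrite mxtraceD; congr (_ + _); rewrite mul_mx_scalar mxtraceZ mulrC; congr (_ * _).
by rewrite /mxtrace big_ord1 !mxE; congr (y _ _); apply: val_inj.
Qed.

(* In the coordinate [a - T C^-1 T^T] of the corner the integrand is at least a constant times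
   a power of that coordinate, which is not integrable on the half-line. *)
Lemma integral_wker_corner_line n (y : 'M[R]_(1 + n)) b (t : n.-tuple R) (C : Sym R n) :
  y ord0 ord0 <= 0 -> posdef C ->
  (\int[lebesgue_measure]_a (wker y b (Sym_block a (trow t) C))%:E = +oo)%E.
Proof.
move=> y0 Cp; have [K KE] := tr_Sym_block y (trow t) C.
have CT : C^T = C :> 'M[R]_n by exact: Symmx_tr.
have CU : (C : 'M[R]_n) \in unitmx by exact: pdmx_unit.
have C0 : 0 < \det C by exact: pdmx_det_gt0.
set q := (trow t *m invmx C *m (trow t)^T) 0 0.
have mf : measurable_fun setT (fun a : R => (wker y b (Sym_block a (trow t) C))%:E : \bar R).
  have := measurable_fun_pair1 (t, C : borel (Sym R n)) (measurable_Sym_block (measurable_wker y b)).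
  by move=> /measurableT_comp/(_ (@Rid_mType R)).
rewrite -(lebesgue_integral_shift q mf); last by move=> a; rewrite lee_fin wker_ge0.
pose c := expR (- (y ord0 ord0 * q + K)) * (\det C) `^ b.
have c0 : 0 < c by rewrite mulr_gt0 ?expR_gt0 ?powR_gt0.
apply/eqP; rewrite -leye_eq.
apply: (@le_trans _ _ (\int[lebesgue_measure]_(a in `]0%R, +oo[) (c%:E * (a `^ b)%:E))%E).
  rewrite ge0_integralZl ?lee_fin ?(ltW c0)//; first last.
  - by move=> a _; rewrite lee_fin powR_ge0.
  - exact: measurable_EFin_powR.
  by rewrite integral_powR_pinfty gt0_muley ?lte_fin.
apply: (@le_trans _ _ (\int[lebesgue_measure]_(a in `]0%R, +oo[)
    (wker y b (Sym_block (q + a) (trow t) C))%:E)%E).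
  apply: ge0_le_integral.
  - exact: measurable_itv.
  - by move=> a _; rewrite -EFinM lee_fin mulr_ge0 ?powR_ge0 ?ltW.
  - by apply: measurable_funeM; exact: measurable_EFin_powR.
  - apply: measurable_funTS; apply: (measurableT_comp mf).
    exact: measurable_funD.
  move=> a; rewrite /= in_itv/= andbT -EFinM lee_fin => a0.
  rewrite /wker KE indicE mem_set; last first.
    by rewrite /= addrC; apply/pdmx_block_dr.
  rewrite /= [q + a]addrC det_block_dr// mul1r powRM ?(ltW a0) ?(ltW C0)//.
  rewrite /c -mulrA; apply: ler_pM; rewrite ?expR_ge0 ?mulr_ge0 ?powR_ge0//.
    by rewrite ler_expR lerN2 lerD2r ler_wnM2l// lerDr ltW.
  by rewrite mulrC.
apply: ge0_subset_integral.
- exact: measurable_itv.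
- exact: measurableT.
- by apply: (measurableT_comp mf); exact: measurable_funD.
- by move=> a _; rewrite lee_fin wker_ge0.
- exact: subsetT.
Qed.

(** The corner integral is infinite for every row t and every positive definite C, a set of pairs of
    positive measure. *)
Lemma integral_wker_corner n (y : 'M[R]_(1 + n)) b : y ord0 ord0 <= 0 ->
  (\int[lebS R (1 + n)]_S (wker y b S)%:E = +oo)%E.
Proof.
move=> y0; have w0 S : (0 <= (wker y b S)%:E)%E by rewrite lee_fin wker_ge0.
rewrite lebS_block_integral_corner//; last exact: measurable_wker.
apply/eqP; rewrite -leye_eq.
have mP : measurable (setT `*` @posdef R n : set (n.-tuple R * borel (Sym R n))).
  by apply: measurableX => //; exact: measurable_posdef.
pose m23 := mk_sigma_finite (sigma_finite_prod (leb R n) (lebS R n)).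
apply: (@le_trans _ _ (\int[m23]_(q in setT `*` @posdef R n) +oo)%E).
  rewrite (integral_cst m23 mP) gt0_mulye//.
  rewrite [ltRHS](product_measure1E (leb R n) (lebS R n))//; last exact: measurable_posdef.
  rewrite mule_gt0//; last by rewrite lt0e lebS_posdef_neq0 measure_ge0.
  apply: (@lt_le_trans _ _ (leb R n (tbox 1))); first by rewrite leb_tbox// expr1n lte01.
  by apply: le_measure; rewrite ?inE//; exact: measurable_tbox.
rewrite integral_mkcond; apply: ge0_le_integral => //.
- by move=> q _; rewrite patchE; case: ifP.
- by apply/(measurable_restrictT (cst +oo%E)).
- exact: (@measurable_fun_fubini_tonelli_G _ _ _ _ _ (@lebesgue_measure R) _ (measurable_Sym_block (measurable_wker y b)) (fun q => w0 _)).
move=> [t C] _; rewrite patchE; case: ifPn => [/set_mem[/= _ Cp]|_].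
  by rewrite integral_wker_corner_line.
by apply: integral_ge0.
Qed.

Lemma mule_eqy (k : R) (I : \bar R) : 0 < k -> (k%:E * I = +oo -> I = +oo)%E.
Proof.
by move=> k0; case: I => [r| |]//; rewrite gt0_muleNy.
Qed.

Lemma integral_wker_npd n (y : 'M[R]_n) b : (0 < n)%N -> ~ pdmx y ->
  (\int[lebS R n]_S (wker y b S)%:E = +oo)%E.
Proof.
case: n y => // n y _ ypd.
have [v v0 yv] : exists2 v : 'rV[R]_n.+1, v != 0 & qf y v <= 0.
  apply: contrapT => nv; apply: ypd => v v0; rewrite ltNge; apply/negP => yv.
  by apply: nv; exists v.
(* As v has rank one, the first row of this invertible matrix is proportional to v. Congruence by it
   therefore moves the nonpositive value of the form into the corner. *)
pose h := row_ebase v; have hU : h \in unitmx by exact: row_ebase_unit.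
have gU : h^T \in unitmx by rewrite unitmx_tr.
have d0 : 0 < `|\det (h^T)| by rewrite normr_gt0 -unitfE -unitmxE.
have := integral_wker_congr (MkGL gU) y b (ltn0Sn n); rewrite /= trmxK.
rewrite (@integral_wker_corner n (h *m y *m h^T)) => [/esym|].
  by apply: mule_eqy; rewrite invr_gt0 powR_gt0.
pose c := col_ebase v ord0 ord0; pose w := row ord0 h.
have vE : v = c *: w.
  rewrite -[LHS]mulmx_ebase rank_rV v0 /w rowE -/h [col_ebase v]mx11_scalar mul_scalar_mx -scalemxAl.
  congr (_ *: (_ *m _)); apply/matrixP => i j.
  by rewrite !mxE !ord1 eqxx andbT eq_sym.
have c0 : c != 0 by apply: contraNneq v0; rewrite vE => ->; rewrite scale0r.
have -> : (h *m y *m h^T) ord0 ord0 = qf y w.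
  rewrite /qf /w -row_mul [LHS]mxE [RHS]mxE; apply: eq_bigr => j _.
  by rewrite [row _ _ _ _]mxE tr_row [col _ _ _ _]mxE.
have : qf y v = c ^+ 2 * qf y w.
  by rewrite vE /qf linearZ/= -!scalemxAl -scalemxAr !mxE expr2 mulrA.
by move: yv => /[swap] ->; rewrite pmulr_rle0// exprn_even_gt0.
Qed.

End wishart_divergence.

(** * Invariant measures on Sym+ *)

Section restricted_measure.
Context d (T : measurableType d) (R : realType) (mu : {measure set T -> \bar R}).
Local Open Scope ereal_scope.

Lemma integral_mrestr (D : set T) (mD : measurable D) (f : T -> \bar R) :
  measurable_fun setT f -> (forall x, 0 <= f x) ->
  \int[mrestr mu mD]_x f x = \int[mu]_(x in D) f x.
Proof.
move=> mf f0; rewrite -(setUv D) ge0_integral_setU//; first last.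
- exact/disj_setPCl.
- by rewrite setUv.
- exact: measurableC.
rewrite [X in _ + X]null_set_integral ?adde0; first last.
- by rewrite /mrestr -(measure0 mu); congr (mu _); exact: setICl.
- exact: measurable_funTS.
- exact: measurableC.
apply: eq_measure_integral => A mA AD.
by rewrite /mrestr; congr (mu _); exact: setIidl.
Qed.

End restricted_measure.

Section SymPos_measures.
Variables (R : realType) (n : nat).
Local Notation SP := (borel (SymPos R n)).

(* The junk value outside [posdef] is the identity matrix. *)
Definition posret (S : borel (Sym R n)) : SP := insubd (gram (1%g : GL R n) : set_type (@posdef R n)) S.

Lemma posretK (z : SymPos R n) : posret (val z) = z.
Proof. exact: valKd. Qed.

Lemma val_posret (S : Sym R n) : posdef S -> val (posret S : SymPos R n) = S.
Proof. by move=> Sp; rewrite insubdK//; exact: mem_set. Qed.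

Lemma posmx_posret (S : Sym R n) : posdef S -> posmx (posret S) = S.
Proof. by move=> Sp; rewrite /posmx val_posret. Qed.

Lemma measurable_posret : measurable_fun setT posret.
Proof.
apply: measurable_SymPos => i j.
rewrite (_ : (fun S => _) = (fun S : borel (Sym R n) =>
    if S \in @posdef R n then Symmx S i j else posmx (gram (1%g : GL R n)) i j)).
  apply: measurable_fun_ifT; last exact: measurable_cst.
    apply: (@measurable_fun_bool _ _ _ _ true).
    rewrite setTI (_ : _ @^-1` _ = @posdef R n); first exact: measurable_posdef.
    by apply/seteqP; split=> S /=; [move/set_mem|move/mem_set].
  exact: measurable_Sym_coord.
apply/funext => S; rewrite /posret /posmx val_insubd.
by case: ifP.
Qed.

Lemma measurable_SymPos_val :
  measurable_fun setT (val : SP -> borel (Sym R n)).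
Proof. by apply: (@continuous_borel (SymPos R n) (Sym R n)); exact: SymPos_val_continuous. Qed.

Lemma measurable_pos_act (g : GL R n) : measurable_fun setT (pos_act g : SP -> SP).
Proof.
apply: measurable_SymPos => i j; under eq_fun do rewrite posmx_act.
apply: measurable_mulmx; last exact: measurable_cst_mx.
by apply: measurable_mulmx; [exact: measurable_cst_mx|exact: measurable_SymPos_coord].
Qed.

Lemma measurable_cholesky_coord i j :
  measurable_fun setT (fun z : SP => (cholesky z : 'M[R]_n) i j).
Proof.
apply: (@continuous_borel_real _ (SymPos R n)) => z.
have c : {for z, continuous (fun z => GLmx (cholesky z))}.
  exact: (continuous_comp (@cholesky_continuous R n z) (@GLmx_continuous R n _)).
exact: (continuous_comp c (@coord_continuous _ _ _ i j _)).
Qed.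

Lemma measurable_pos_mul : measurable_fun setT (fun p : SP * SP => pos_mul p.1 p.2 : SP).
Proof.
apply: measurable_SymPos => i j; under eq_fun do rewrite posmx_act.
have m1 k l : measurable_fun setT (fun p : SP * SP => (cholesky p.1 : 'M[R]_n) k l).
  exact: (measurableT_comp (measurable_cholesky_coord k l)).
apply: measurable_mulmx; last exact: measurable_trmx.
apply: measurable_mulmx => // k l.
exact: (measurableT_comp (measurable_SymPos_coord k l)).
Qed.

Lemma pos_inv_continuous : continuous (@pos_inv R n).
Proof.
move=> z; apply: (continuous_comp (f := fun z => (cholesky z)^-1%g)); last exact: gram_continuous.
apply: continuous_comp; [exact: cholesky_continuous|exact: invg_continuous].
Qed.

Lemma measurable_pos_inv : measurable_fun setT (@pos_inv R n : SP -> SP).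
Proof. by apply: (@continuous_borel (SymPos R n)); exact: pos_inv_continuous. Qed.

Lemma measurable_det_posmx : measurable_fun setT (fun z : SP => \det (posmx z)).
Proof. exact: (measurableT_comp (@measurable_det_Sym R n) measurable_SymPos_val). Qed.

Lemma det_cholesky (z : SymPos R n) (s : R) : `|\det (cholesky z)| `^ s = \det (posmx z) `^ (s / 2).
Proof.
rewrite -[in RHS](cholesky_gram z) det_mulmx det_tr -expr2 sqr_powR -powRrM.
by rewrite mulrCA divff ?mulr1// pnatr_eq0.
Qed.

Lemma character_det (s : R) :
  character (@pos_mul R n : SP -> SP -> SP) (fun z => \det (posmx z) `^ s).
Proof.
split.
- exact: (measurableT_comp (measurable_powR s) measurable_det_posmx).
- by move=> z; rewrite powR_gt0// det_posmx_gt0.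
- move=> x y.
  have E : \det (posmx x) = \det (cholesky x) * \det (cholesky x).
    by rewrite -[in LHS](cholesky_gram x) det_mulmx det_tr.
  by rewrite posmx_act !det_mulmx det_tr mulrAC -E powRM// ltW// det_posmx_gt0.
Qed.

Lemma SymPos_sigma_finite (N : {measure set SP -> \bar R}) :
  (forall m : R, 0 < m -> (N (val @^-1` (@Kset R n m)) < +oo)%E) -> sigma_finite setT N.
Proof.
move=> NK; exists (fun k => val @^-1` (@Kset R n k.+1%:R)); last first.
  move=> k; split; last exact: NK.
  by rewrite -[X in measurable X]setTI; apply: measurable_SymPos_val => //; exact: measurable_Kset.
apply/seteqP; split=> // z _.
have [k _ Kz] : (\bigcup_(m : nat) @Kset R n m.+1%:R) (val (z : SymPos R n)).
  by rewrite -posdefE; exact: set_mem (valP z).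
by exists k.
Qed.

End SymPos_measures.

Section SymPos_lebesgue.
Variables (R : realType) (n : nat).
Local Notation SP := (borel (SymPos R n)).
Local Open Scope ereal_scope.

(** Restriction to the cone precedes the image under [posret], so its junk value carries no mass. *)
Let lebP0 : {measure set SP -> \bar R} :=
  image_measure (@measurable_posret R n) (mrestr (lebS R n) (@measurable_posdef R n)).

Let lebP0_sigma_finite : sigma_finite setT lebP0.
Proof.
apply: SymPos_sigma_finite => m m0.
apply: (@le_lt_trans _ _ (lebS R n (@Kset R n m))); last exact: lebS_Kset.
apply: (@le_measure _ _ _ (lebS R n)); rewrite ?inE.
- apply: measurableI; last exact: measurable_posdef.
  rewrite -[X in measurable X]setTI; apply: measurable_posret => //.
  rewrite -[X in measurable X]setTI; apply: measurable_SymPos_val => //.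
  exact: measurable_Kset.
- exact: measurable_Kset.
- by move=> S [/= + Sp]; rewrite val_posret.
Qed.

Definition lebP := mk_sigma_finite lebP0_sigma_finite.

Lemma lebP_integral (h : SymPos R n -> \bar R) :
  measurable_fun setT (h : SP -> \bar R) -> (forall z, 0 <= h z) ->
  \int[lebP]_z h z = \int[lebS R n]_(S in @posdef R n) h (posret S).
Proof.
move=> mh h0; rewrite -(integral_mrestr (lebS R n) (@measurable_posdef R n)); last 2 first.
- exact: (measurableT_comp mh (@measurable_posret R n)).
- by move=> S; exact: h0.
exact: (integral_image (@measurable_posret R n) (mrestr (lebS R n) (@measurable_posdef R n)) mh).
Qed.

Lemma posret_act (g : GL R n) (S : Sym R n) : posdef S ->
  posret (congr_act g S) = pos_act g (posret S).
Proof.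
move=> Sp; apply: posmx_inj; rewrite posmx_act !posmx_posret//.
exact/(pdmx_congr _ (GLmx_unit g)).
Qed.

Lemma posdef_congr (g : GL R n) (S : Sym R n) :
  (congr_act g S \in @posdef R n) = (S \in @posdef R n).
Proof.
have pE := pdmx_congr (Symmx S) (GLmx_unit g).
by apply/idP/idP => /set_mem/pE/mem_set.
Qed.

Lemma lebP_act (g : GL R n) (h : SymPos R n -> \bar R) : (0 < n)%N ->
  measurable_fun setT (h : SP -> \bar R) -> (forall z, 0 <= h z) ->
  \int[lebP]_z h (pos_act g z)
  = (`|\det g| `^ (n%:R + 1))^-1%:E * \int[lebP]_z h z.
Proof.
move=> n0 mh h0; rewrite !lebP_integral//; last first.
  exact: (measurableT_comp mh (measurable_pos_act g)).
rewrite [in LHS]integral_mkcond [in RHS]integral_mkcond -lebS_congr//; last 2 first.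
- apply/(measurable_restrictT _ (@measurable_posdef R n)); apply: measurable_funTS.
  exact: (measurableT_comp mh (@measurable_posret R n)).
- by move=> S; rewrite patchE; case: ifP.
apply: eq_integral => S _; rewrite !patchE posdef_congr.
by case: ifPn => // /set_mem Sp; rewrite posret_act.
Qed.

Lemma pos_mul1 (z : SymPos R n) : pos_mul z (gram 1%g) = z.
Proof. by rewrite /pos_mul pos_act_gram mulg1 gram_cholesky. Qed.

Lemma pos_mulKV (x y : SymPos R n) : pos_mul (pos_mul y (pos_inv x)) x = y.
Proof.
rewrite pos_mulA; rewrite [pos_mul (pos_inv x) x](_ : _ = gram 1%g) ?pos_mul1//.
by rewrite -[RHS](pos_mulVK x) pos_mul1.
Qed.

End SymPos_lebesgue.

(** * The reference function exp(-tr) *)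

Section trace_exponential.
Variables (R : realType) (n : nat).
Hypothesis n0 : (0 < n)%N.
Local Notation SP := (borel (SymPos R n)).

Definition exp_tr (z : SymPos R n) : \bar R := (expR (- \tr (posmx z)))%:E.

Lemma measurable_exp_tr : measurable_fun setT (exp_tr : SP -> \bar R).
Proof.
apply/measurable_EFinP; apply: measurableT_comp => //; apply: measurableT_comp => //.
by apply: measurable_sum => i; exact: measurable_SymPos_coord.
Qed.

Lemma integral_exp_scalar (c : R) : 0 < c ->
  (0 < \int[lebS R n]_S (wker c%:M 0 S)%:E < +oo)%E.
Proof.
move=> c0; have s0 : 0 < Num.sqrt c by rewrite sqrtr_gt0.
have sU : ((Num.sqrt c)%:M : 'M[R]_n) \in unitmx.
  by rewrite unitmxE det_scalar unitfE expf_neq0// gt_eqF.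
have := integral_wker_pd (gram (MkGL sU)) 0 n0.
rewrite posmx_gram /= tr_scalar_mx -scalar_mxM -expr2 sqr_sqrtr ?(ltW c0)// => ->.
have d0 : 0 < \det (c%:M : 'M[R]_n) by rewrite det_scalar exprn_gt0.
rewrite wint_fin ?oppr_lt0// -EFinM ltry andbT EFinM -wint_fin ?oppr_lt0//.
by rewrite mule_gt0 ?wint_gt0// lte_fin powR_gt0.
Qed.

(** The trace of L y L^T is the sum of the quadratic form y over the rows of L. *)
Lemma tr_gram_pinched (m : R) (L y : 'M[R]_n) : 0 < m -> pinched m y ->
  m^-1 * \tr (L *m L^T) <= \tr (L *m y *m L^T) <= m * \tr (L *m L^T).
Proof.
move=> m0 my.
have E A : \tr (L *m A *m L^T) = \sum_i qf A (row i L).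
  apply: eq_bigr => i _; rewrite /qf -row_mul [LHS]mxE [RHS]mxE; apply: eq_bigr => j _.
  by rewrite [row _ _ _ _]mxE tr_row [col _ _ _ _]mxE.
have := E 1%:M; rewrite mulmx1 => ->; rewrite E !mulr_sumr.
by apply/andP; split; apply: ler_sum => i _; have /andP[] := my (row i L).
Qed.

(** With L the Cholesky factor of x, the exponent is tr(L y L^T), which lies between m^-1 tr x and m
    tr x when y is pinched by m. The integral is thus squeezed between Wishart integrals with scalar
    parameter. *)
Lemma integral_exp_tr_mul (y : SymPos R n) :
  (0 < \int[lebP R n]_x exp_tr (pos_mul x y) < +oo)%E.
Proof.
have [m my] := pdmx_pinched (posmx_sym y) (posmx_pd y).
have m0 : 0 < m.+1%:R :> R by [].
have mf : measurable_fun setT (fun x : SP => exp_tr (pos_mul x y)).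
  exact: (measurableT_comp measurable_exp_tr (measurable_fun_pair1 (y : SP) (@measurable_pos_mul R n))).
rewrite lebP_integral//; last by move=> z; rewrite lee_fin expR_ge0.
rewrite integral_mkcond.
have mr : measurable_fun setT
    ((fun S => exp_tr (pos_mul (posret S) y)) \_ (@posdef R n) : borel (Sym R n) -> \bar R).
  apply/(measurable_restrictT _ (@measurable_posdef R n)); apply: measurable_funTS.
  exact: (measurableT_comp mf (@measurable_posret R n)).
have r0 S : (0 <= ((fun S => exp_tr (pos_mul (posret S) y)) \_ (@posdef R n)) S)%E.
  by rewrite patchE; case: ifP => // _; rewrite lee_fin expR_ge0.
have /andP[p1 _] := integral_exp_scalar m0.
have /andP[_ p2] : (0 < \int[lebS R n]_S (wker (m.+1%:R^-1)%:M 0 S)%:E < +oo)%E.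
  by apply: integral_exp_scalar; rewrite invr_gt0.
have trE (S : Sym R n) : posdef S ->
    m.+1%:R^-1 * \tr S <= \tr (posmx (pos_mul (posret S) y)) <= m.+1%:R * \tr S.
  move=> Sp; rewrite posmx_act.
  by have := tr_gram_pinched (cholesky (posret S)) m0 my; rewrite cholesky_gram posmx_posret.
have wE c S : wker (c%:M) 0 S = \1_(@posdef R n) S * expR (- (c * \tr S)) :> R.
  by rewrite /wker powRr0 mulr1 mul_scalar_mx mxtraceZ.
apply/andP; split.
  apply: (lt_le_trans p1); apply: ge0_le_integral => //.
  - by move=> S _; rewrite lee_fin wker_ge0.
  - exact: measurable_wker.
  move=> S _; rewrite patchE wE indicE; case: (boolP (S \in _)) => [/set_mem Sp|_].
    by rewrite mul1r lee_fin ler_expR lerN2; have /andP[] := trE S Sp.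
  by rewrite mul0r.
apply: le_lt_trans p2; apply: ge0_le_integral => //; first exact: measurable_wker.
move=> S _; rewrite patchE wE indicE; case: (boolP (S \in _)) => [/set_mem Sp|_].
  by rewrite mul1r lee_fin ler_expR lerN2; have /andP[] := trE S Sp.
by rewrite mul0r.
Qed.

End trace_exponential.

(** * Density of a relatively invariant measure on Sym+ *)

Section invariant_density.
Variables (R : realType) (n : nat).
Hypothesis n0 : (0 < n)%N.
Local Notation SP := (borel (SymPos R n)).
Local Open Scope ereal_scope.

Variables (N : {measure set SP -> \bar R}) (chi : GL R n -> R).
Hypotheses (chi0 : forall g, (0 < chi g)%R)
  (Nchi : forall g (A : set SP), measurable A ->
    N (pos_act g @^-1` A) = (chi g)^-1%:E * N A)
  (NK : forall m : R, (0 < m)%R -> N (val @^-1` (@Kset R n m)) < +oo)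
  (NT : N setT != 0).

Let NV : {measure set (borel (Sym R n)) -> \bar R} :=
  image_measure (@measurable_SymPos_val R n) N.

Lemma SymPos_character : exists s : R, forall g : GL R n, chi g = (`|\det g| `^ s)%R.
Proof.
apply: (@measure_character _ _ NV) => //.
- move=> g A mA; have mA' : measurable (val @^-1` A : set SP).
    by rewrite -[X in measurable X]setTI; exact: measurable_SymPos_val.
  have AE : val @^-1` (congr_act g @^-1` A) = pos_act g @^-1` (val @^-1` A) :> set SP by [].
  by rewrite /NV [LHS]image_measureE [in RHS]image_measureE AE Nchi.
- rewrite /NV image_measureE (_ : _ @^-1` _ = setT)//.
  by apply/seteqP; split=> // z _; exact: set_mem (valP (z : SymPos R n)).
Qed.

Let Nact (g : GL R n) (h : SymPos R n -> \bar R) :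
  measurable_fun setT (h : SP -> \bar R) -> (forall z, 0 <= h z) ->
  \int[N]_z h (pos_act g z) = (chi g)^-1%:E * \int[N]_z h z.
Proof.
move=> mh h0; rewrite -(integral_image (measurable_pos_act g) N mh h0).
have c0 : (0 <= (chi g)^-1)%R by rewrite invr_ge0 ltW.
rewrite -(ge0_integral_mscale N measurableT (NngNum c0))//; last first.
by apply: eq_measure_integral => A mA _; rewrite image_measureE Nchi.
Qed.

(** [invariant_unique] compares N with Lebesgue measure; |det g| = det(x)^(1/2) for the Cholesky
    factor g of x turns the multipliers into the characters [cm] and [cn]. What remains is to see
    that the constant is positive and finite. *)
Lemma SymPos_invariant_density : exists C r : R, (0 < C)%R /\
  forall h : SymPos R n -> \bar R,
    measurable_fun setT (h : SP -> \bar R) -> (forall z, 0 <= h z) ->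
  \int[N]_z h z = C%:E * \int[lebP R n]_z ((\det (posmx z) `^ r)%:E * h z).
Proof.
have [s sE] := SymPos_character.
pose Ns := mk_sigma_finite (SymPos_sigma_finite NK).
pose cm (z : SymPos R n) := (\det (posmx z) `^ ((n%:R + 1) / 2))%R.
pose cn (z : SymPos R n) := (\det (posmx z) `^ (s / 2))%R.
have Im : rel_invariant (@pos_mul R n : SP -> SP -> SP) (lebP R n) cm.
  by move=> x f mf f0; rewrite lebP_act// det_cholesky.
have In : rel_invariant (@pos_mul R n : SP -> SP -> SP) Ns cn.
  by move=> x f mf f0; rewrite [LHS]Nact// sE det_cholesky.
have e0 z : 0 <= exp_tr (z : SymPos R n) by rewrite lee_fin expR_ge0.
have key h : measurable_fun setT (h : SP -> \bar R) -> (forall z : SymPos R n, 0 <= h z) ->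
    (\int[lebP R n]_z exp_tr z) * (\int[N]_z h z)
    = (\int[N]_z ((cm z / cn z)%:E * exp_tr z))
      * (\int[lebP R n]_z ((\det (posmx z) `^ (s / 2 - (n%:R + 1) / 2))%:E * h z)).
  move=> mh h0.
  have cE z : (\det (posmx z) `^ (s / 2 - (n%:R + 1) / 2) = cn z / cm z)%R.
    rewrite powRD ?powRN//; apply/implyP => _; exact: lt0r_neq0 (det_posmx_gt0 z).
  under [X in _ = _ * X]eq_integral do rewrite cE.
  apply: (@invariant_unique _ SP R (@pos_mul R n) (@pos_inv R n) _ _ _ _ _ _ (lebP R n) Ns cm cn) => //.
  - exact: pos_mulVK.
  - exact: pos_mulKV.
  - exact: pos_invK.
  - exact: pos_invM.
  - exact: measurable_pos_mul.
  - exact: measurable_pos_inv.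
  - exact: character_det.
  - exact: character_det.
  - exact: measurable_exp_tr.
  - by move=> y; exact: integral_exp_tr_mul.
have [a a0 aE] : exists2 a : R, (0 < a)%R & \int[lebP R n]_z exp_tr z = a%:E.
  have := integral_exp_tr_mul n0 (gram (1%g : GL R n)).
  have -> : \int[lebP R n]_x exp_tr (pos_mul x (gram 1%g)) = \int[lebP R n]_x exp_tr x.
    by apply: eq_integral => z _; rewrite pos_mul1.
  case: (\int[_]_z _) => [a| |] /andP[a0 ay]//.
  by exists a.
have [m m0 NKm] : exists2 m : R, (0 < m)%R & N (val @^-1` (@Kset R n m)) != 0.
  apply: contrapT => h.
  have Km0 k : N (val @^-1` (@Kset R n k.+1%:R)) = 0.
    by apply: contrapT => /eqP hk; apply: h; exists k.+1%:R.
  move/eqP: NT; apply; apply/eqP; rewrite eq_le measure_ge0 andbT.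
  have mK k : measurable (val @^-1` (@Kset R n k.+1%:R) : set SP).
    rewrite -[X in measurable X]setTI; apply: measurable_SymPos_val => //.
    exact: measurable_Kset.
  apply: (le_trans (@measure_sigma_subadditive _ _ _ N _ (fun k => val @^-1` (@Kset R n k.+1%:R)) mK _ _)) => //.
    move=> z _; have [k _ Kz] : (\bigcup_(k : nat) @Kset R n k.+1%:R) (val (z : SymPos R n)).
      by rewrite -posdefE; exact: set_mem (valP z).
    by exists k.
  by rewrite eseries0.
have mK : measurable (val @^-1` (@Kset R n m) : set SP).
  rewrite -[X in measurable X]setTI; apply: measurable_SymPos_val => //.
  exact: measurable_Kset.
set B := \int[N]_z ((cm z / cn z)%:E * exp_tr z) in key.
have B0 : 0 <= B.
  apply: integral_ge0 => z _; rewrite mule_ge0// lee_fin divr_ge0// powR_ge0//.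
(* Test the identity on a set of finite nonzero N-mass: its left side is positive and finite, which
   excludes B = 0 and B infinite. *)
have [b b0 bE] : exists2 b : R, (0 < b)%R & B = b%:E.
  have := key (EFin \o \1_(val @^-1` (@Kset R n m))).
  rewrite aE integral_indic// setIT.
  set J := \int[lebP R n]_z _ => /(_ _ _)E.
  have {E} : a%:E * N (val @^-1` @Kset R n m) = B * J.
    apply: E; first by apply/measurable_EFinP; exact: measurable_indic.
    by move=> z; rewrite lee_fin.
  have J0 : 0 <= J by apply: integral_ge0 => z _; rewrite -EFinM lee_fin mulr_ge0// powR_ge0.
  have : 0 < N (val @^-1` @Kset R n m) by rewrite lt0e NKm measure_ge0.
  move: (NK m0); case: (N _) => [k| |]// _; rewrite lte_fin => k0.
  have ak : (0 < a * k)%R by rewrite mulr_gt0.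
  move: (B) (J) B0 J0 => {B J key} [b| |]// [j| |]//; rewrite ?lee_fin => b0 j0.
  - rewrite -!EFinM => -[abj]; exists b => //; rewrite lt0r b0 andbT.
    by apply: contraTneq ak => b00; rewrite abj b00 mul0r ltxx.
  - move: b0; rewrite le_eqVlt => /orP[/eqP <-|b0 _]; last by exists b.
    by rewrite mul0e -EFinM => -[ak0]; move: ak; rewrite ak0 ltxx.
  - move: j0; rewrite le_eqVlt => /orP[/eqP <-|j0].
      by rewrite mule0 -EFinM => -[ak0]; move: ak; rewrite ak0 ltxx.
    by rewrite gt0_mulye.
(* This is b / a, in the shape that [mule_cancel] returns. *)
exists (a * b^-1)^-1%R, (s / 2 - (n%:R + 1) / 2)%R; split.
  by rewrite invr_gt0 mulr_gt0// invr_gt0.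
by move=> h mh h0; apply: mule_cancel => //; rewrite invrK -aE -bE key.
Qed.

End invariant_density.

(** * Radon measures *)

Section regularity.
Variables (R : realType) (T : ptopologicalType).
Local Open Scope ereal_scope.
Local Notation BT := (borel T).

Lemma measure_nondecreasing_diff (m : {measure set BT -> \bar R}) (C : nat -> set BT) (e : R) :
  (forall i, measurable (C i)) -> {homo C : i j / (i <= j)%N >-> (i <= j)%O} ->
  m setT < +oo -> (0 < e)%R -> exists N, m (\bigcup_i C i `\` C N) < e%:E.
Proof.
move=> mC incC mT e0.
have mU : measurable (\bigcup_i C i) by exact: bigcupT_measurable.
have mUy A : measurable A -> m A < +oo.
  by move=> mA; apply: le_lt_trans mT; apply: le_measure; rewrite ?inE.
apply: contrapT => h; have {}h N : e%:E <= m (\bigcup_i C i `\` C N).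
  by rewrite leNgt; apply/negP => hN; apply: h; exists N.
have mCN N : m (C N) + e%:E <= m (\bigcup_i C i).
  have CU : C N `<=` \bigcup_i C i by move=> x Cx; exists N.
  rewrite -[in leRHS](setDUK CU) measureU//; first by apply: leeD2l; exact: h.
  - exact: measurableD.
  - exact: setDIK.
have mf : m (\bigcup_i C i) \is a fin_num by rewrite ge0_fin_numE ?mUy.
have cv : (m \o C) x @[x --> \oo] --> m (\bigcup_i C i) by exact: nondecreasing_cvg_mu.
have : limn (m \o C) <= m (\bigcup_i C i) - e%:E.
  apply: lime_le; first by apply/cvg_ex; eexists; exact: cv.
  by apply: nearW => N; rewrite leeBrDr//; exact: mCN.
rewrite (cvg_lim _ cv)//.
move: mf; case: (m _) => [r| |]// _; rewrite -EFinB lee_fin.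
by move=> h1; move: e0; lra.
Qed.

(** The sets that can be squeezed in this way form a sigma-algebra, and it contains the open sets
    because these are increasing unions of closed ones. *)
Lemma outer_inner_regular (m : {measure set BT -> \bar R}) :
  m setT < +oo ->
  (forall U : set T, open U -> exists2 C : nat -> set T,
    (forall i, closed (C i)) /\ {homo C : i j / (i <= j)%N >-> i `<=` j} &
    U = \bigcup_i C i) ->
  forall A : set BT, measurable A -> forall e : R, (0 < e)%R ->
    exists F U : set T, [/\ closed F, open U, F `<=` A, A `<=` U & m (U `\` F) < e%:E].
Proof.
move=> mT HU A mA.
pose P := [set A : set BT | forall e : R, (0 < e)%R ->
  exists F U : set T, [/\ closed F, open U, F `<=` A, A `<=` U & m (U `\` F) < e%:E]].
have mo (U : set T) : open U -> measurable (U : set BT) by exact: open_borel_measurable.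
have mc (U : set T) : closed U -> measurable (U : set BT) by exact: closed_borel_measurable.
suff sP : <<s open >> `<=` P by exact: sP.
apply: smallest_sub; last first.
  move=> U oU e e0; have [C [cC incC] UE] := HU U oU.
  have [||N hN] := @measure_nondecreasing_diff m C e _ _ mT e0.
  - by move=> i; exact: mc.
  - by move=> i j ij; apply/subsetPset; exact: incC.
  exists (C N), U; split=> //; last by rewrite UE.
  by rewrite UE => x Cx; exists N.
split.
- by move=> e e0; exists set0, set0; split=> //; first [exact: closed0|exact: open0|rewrite setD0 measure0].
- move=> B PB e e0; have [F [U [cF oU FB BU mUF]]] := PB e e0.
  exists (~` U), (~` F); split.
  + exact: open_closedC.
  + exact: closed_openC.
  + by rewrite setTD; apply: subsetC.
  + by rewrite setTD; apply: subsetC.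
  + rewrite (_ : _ `\` _ = U `\` F)//.
    by apply/seteqP; split=> x [h1 h2]; split=> //; exact: contrapT.
(* A countable union of closed sets need not be closed: half of e pays for the approximations of the
   B i, the other half for truncating the union of the F i. *)
- move=> B PB e e0; have e20 : (0 < e / 2)%R by rewrite divr_gt0.
  have [i|FU FUP] := @choice _ _ (fun i (FU : set T * set T) =>
    [/\ closed FU.1, open FU.2, FU.1 `<=` B i, B i `<=` FU.2
      & m (FU.2 `\` FU.1) < (e / 2 / (2 ^ i.+1)%:R)%:E]).
    have d0 : (0 < e / 2 / (2 ^ i.+1)%:R)%R by rewrite divr_gt0// ltr0n expn_gt0.
    by have [F [U FUP]] := PB i _ d0; exists (F, U).
  pose F i : set BT := (FU i).1; pose U i : set BT := (FU i).2.
  have cF i : closed (F i) by have [] := FUP i.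
  have oU i : open (U i) by have [] := FUP i.
  pose Phi N : set BT := \big[setU/set0]_(i < N) F i.
  have cPhi N : closed (Phi N) by apply: closed_bigsetU.
  have PhiE : \bigcup_i F i = \bigcup_N Phi N.
    apply/seteqP; split=> x [i _ Fx].
      by exists i.+1 => //; rewrite /Phi -bigcup_mkord; exists i => /=.
    by move: Fx; rewrite /Phi -bigcup_mkord => -[k _ Fx]; exists k.
  have mF i : measurable (F i) by exact: mc.
  have mU i : measurable (U i) by exact: mo.
  have mPhi N : measurable (Phi N) by exact: mc.
  have [||N hN] := @measure_nondecreasing_diff m Phi (e / 2) _ _ mT e20.
  - by [].
  - move=> i j ij; apply/subsetPset; rewrite /Phi -!bigcup_mkord => x [k ki Fx].
    by exists k => //; exact: leq_trans ij.
  exists (Phi N), (\bigcup_i U i); split => //.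
  - exact: bigcup_open.
  - rewrite /Phi -bigcup_mkord => x [k _ Fx]; exists k => //.
    by have [_ _ FB _ _] := FUP k; exact: FB.
  - move=> x [k _ Bx]; exists k => //.
    by have [_ _ _ BU _] := FUP k; exact: BU.
  have mUU : measurable (\bigcup_i U i : set BT) by exact: bigcupT_measurable.
  have mFF : measurable (\bigcup_i F i : set BT) by exact: bigcupT_measurable.
  apply: (@le_lt_trans _ _ (m (\bigcup_i U i `\` \bigcup_i F i) + m (\bigcup_i F i `\` Phi N))).
    apply: le_trans (measureU2 _ _ _) => //; last 2 first.
    - exact: measurableD.
    - exact: measurableD.
    apply: le_measure; rewrite ?inE; [exact: measurableD|by apply: measurableU; exact: measurableD|].
    by move=> x [Ux Px]; case: (pselect ((\bigcup_i F i) x)) => Fx; [right|left].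
  rewrite [e]splitr EFinD; apply: lee_ltD => //; last by rewrite PhiE.
    rewrite ge0_fin_numE// (le_lt_trans _ mT)//; apply: le_measure; rewrite ?inE//.
    exact: measurableD.
  apply: (@le_trans _ _ (\sum_(0 <= i <oo) m (U i `\` F i))).
    apply: measure_sigma_subadditive.
    - by move=> i; exact: measurableD.
    - exact: measurableD.
    - by move=> x [[k _ Ux] Fx]; exists k => //; split=> // Fkx; apply: Fx; exists k.
  apply: le_trans (epsilon_trick0 xpredT (ltW e20)); apply: lee_nneseries => // i _.
  by have [_ _ _ _ /ltW] := FUP i.
Qed.

(** Compactness serves inner regularity on open sets, closedness the approximation of Borel sets. *)
Definition exhaustible := forall U : set T, open U -> exists C : nat -> set T,
  [/\ forall i, compact (C i), forall i, closed (C i),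
      {homo C : i j / (i <= j)%N >-> i `<=` j} & U = \bigcup_i C i].

(** Inner regularity is continuity from below along an exhaustion. For outer regularity, m is
    restricted to each W k, where it is finite, and the open sets found there are glued. *)
Lemma radon_exhaustible (m : {measure set BT -> \bar R}) (W : nat -> set T) :
  hausdorff_space T -> exhaustible -> (forall k, open (W k)) -> {homo W : i j / (i <= j)%N >-> i `<=` j} ->
  \bigcup_k W k = setT -> (forall k, m (W k) < +oo) -> radon m.
Proof.
move=> hT HU oW incW WT mW.
have mo (U : set T) : open U -> measurable (U : set BT) by exact: open_borel_measurable.
have mc (U : set T) : closed U -> measurable (U : set BT) by exact: closed_borel_measurable.
have mWk k : measurable (W k : set BT) by exact: mo.
split.
- move=> K cK.
  have [k KW] : exists k, K `<=` W k.
    move: cK; rewrite compact_cover => cK.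
    have KW : K `<=` \bigcup_(i in [set: nat]) W i by rewrite WT.
    have [D _ KD] := cK nat setT W (fun i _ => oW i) KW.
    exists (\max_(i <- finmap.enum_fset D) i)%N => x Kx; have [i /= iD Wx] := KD x Kx.
    by apply: (incW i) Wx; exact: (@leq_bigmax_seq _ (finmap.enum_fset D) xpredT id).
  apply: le_lt_trans (mW k); apply: le_measure; rewrite ?inE//.
  by apply: mc; exact: compact_closed.
- move=> A mA; apply/eqP; rewrite eq_le; apply/andP; split.
    apply: le_ereal_inf_tmp => _ [U [oU AU] <-]; apply: le_measure; rewrite ?inE//.
    exact: mo.
  apply/lee_addgt0Pr => e e0.
  pose mk k := mrestr m (mWk k).
  have mkT k : mk k setT < +oo by rewrite /mk /mrestr setTI.
  have HC (U : set T) : open U -> exists2 C : nat -> set T,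
      (forall i, closed (C i)) /\ {homo C : i j / (i <= j)%N >-> i `<=` j} & U = \bigcup_i C i.
    by move=> /HU [C [_ cC iC UE]]; exists C.
  have [k|U UP] := @choice _ _ (fun k (U : set T) =>
      [/\ open U, A `<=` U & m ((U `\` A) `&` W k) < (e / (2 ^ k.+1)%:R)%:E]).
    have d0 : (0 < e / (2 ^ k.+1)%:R)%R by rewrite divr_gt0// ltr0n expn_gt0.
    have [F [U [cF oU FA AU]]] := outer_inner_regular (mkT k) HC mA d0.
    rewrite /mk /mrestr => mUF; exists U; split=> //; apply: le_lt_trans mUF.
    apply: le_measure; rewrite ?inE.
    + by apply: measurableI => //; apply: measurableD => //; exact: mo.
    + by apply: measurableI => //; apply: measurableD; [exact: mo|exact: mc].
    + by move=> x [[Ux Ax] Wx]; split=> //; split=> // Fx; apply: Ax; exact: FA.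
  have oU k : open (U k) by have [] := UP k.
  have mU k : measurable (U k : set BT) by exact: mo.
  (* Each U k is good only inside W k, so it is cut down to W k before gluing; the errors e /
     2^(k+1) add up to at most e. *)
  pose V := \bigcup_k (U k `&` W k).
  have oV : open V by apply: bigcup_open => k _; exact: openI.
  have AV : A `<=` V.
    move=> x Ax; have [k _ Wx] : (\bigcup_k W k) x by rewrite WT.
    by exists k => //; split=> //; have [_ AU _] := UP k; exact: AU.
  apply: (@le_trans _ _ (m V)); first by apply: ereal_inf_lbound; exists V.
  have mVA : measurable (V `\` A : set BT) by apply: measurableD => //; exact: mo.
  have mUA k : measurable ((U k `\` A) `&` W k : set BT).
    by apply: measurableI => //; exact: measurableD.
  rewrite -[V](setDUK AV); apply: le_trans (measureU2 _ _ _) _ => //.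
  rewrite leeD2l//; apply: (@le_trans _ _ (\sum_(0 <= k <oo) m ((U k `\` A) `&` W k))).
    apply: measure_sigma_subadditive => //.
    by move=> x [[k _ [Ux Wx]] Ax]; exists k.
  apply: le_trans (epsilon_trick0 xpredT (ltW e0)); apply: lee_nneseries => // k _.
  by have [_ _ /ltW] := UP k.
- move=> U oU; apply/eqP; rewrite eq_le; apply/andP; split; last first.
    apply: ge_ereal_sup => _ [K [cK KU] <-].
    by apply: le_measure; rewrite ?inE//; [apply: mc; exact: compact_closed|exact: mo].
  have [C [kC cC iC UE]] := HU U oU.
  have mC i : measurable (C i : set BT) by exact: mc.
  have cv := @nondecreasing_cvg_mu _ BT R m C mC _ _.
  have {}cv : (m \o C) x @[x --> \oo] --> m (\bigcup_i C i).
    apply: cv; first exact: bigcupT_measurable.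
    by move=> i j ij; apply/subsetPset; exact: iC.
  rewrite {1}UE -(cvg_lim _ cv)//; apply: lime_le; first by apply/cvg_ex; eexists; exact: cv.
  apply: nearW => N /=; apply: ereal_sup_ubound; exists (C N) => //; split=> //.
  by rewrite UE => x Cx; exists N.
Qed.

End regularity.

(** * Compactness and separation for initial topologies *)

Section topology_lemmas.

Lemma compact_initial (S T : topologicalType) (f : S -> T) (A : set S) :
  (forall x V, nbhs x V -> exists2 W, nbhs (f x) W & f @^-1` W `<=` V) ->
  compact (f @` A) -> compact A.
Proof.
move=> fV cA F PF FA.
have [|y [[x Ax <-] xF]] := cA (f @ F) (fmap_proper_filter f PF); first by apply: (@filterS _ F _ A) => // x Ax; exists x.
exists x; split=> // U V FU /fV[W fxW WV].
have [|z [[u Uu <-] Wu]] := xF (f @` U) W _ fxW.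
  by apply: (@filterS _ F _ U) => // u Uu; exists u.
by exists u; split=> //; exact: WV.
Qed.

Lemma initial_nbhs (S : choiceType) (T : topologicalType) (f : S -> T)
    (x : initial_topology f) (V : set (initial_topology f)) :
  nbhs x V -> exists2 W, nbhs (f x) W & f @^-1` W `<=` V.
Proof.
rewrite !nbhsE => -[_ [[W oW <-] Wx] WV]; exists W => //.
by exists W.
Qed.

Lemma injective_hausdorff (R : realType) (T : topologicalType) (I : Type) (f : I -> T -> R) :
  (forall i, continuous (f i)) -> (forall x y, (forall i, f i x = f i y) -> x = y) ->
  hausdorff_space T.
Proof.
move=> cf fI p q pq; apply: fI => i; apply: (@Rhausdorff R) => A B Ap Bq.
have [x [Ax Bx]] := pq _ _ (cf i p A Ap) (cf i q B Bq).
by exists (f i x).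
Qed.

End topology_lemmas.

Section Sym_topology.
Variables (R : realType) (n : nat).

(** An entrywise l1 distance that induces the initial topology of [Sym]; it measures the distance to
    the complement of an open set. *)
Definition sym_dist (S S' : Sym R n) : R := \sum_ij `|S ij.1 ij.2 - S' ij.1 ij.2|.

Lemma sym_dist_ge (S S' : Sym R n) i j : `|S i j - S' i j| <= sym_dist S S'.
Proof.
rewrite /sym_dist (bigD1 (i, j))//= lerDl.
by apply: sumr_ge0.
Qed.

Lemma Sym_coord_continuous i j : continuous (fun S : Sym R n => S i j).
Proof.
by move=> S; exact: (continuous_comp (@Symmx_continuous R n S) (@coord_continuous _ _ _ i j _)).
Qed.

Lemma sym_dist_continuous S' : continuous (fun S => sym_dist S S').
Proof.
apply: continuous_big; first exact: add_continuous.
move=> ij _.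
have c : continuous (fun S : Sym R n => S ij.1 ij.2 - S' ij.1 ij.2).
  by move=> S; exact: (cvgB (@Sym_coord_continuous ij.1 ij.2 S) (cvg_cst _)).
by move=> S; exact: (continuous_comp (c S) (@norm_continuous _ _ _)).
Qed.

Lemma Sym_nbhs (S : Sym R n) U : nbhs S U ->
  exists2 e, 0 < e & forall S', sym_dist S S' < e -> U S'.
Proof.
move=> /(@initial_nbhs _ _ (@Symmx R n))[W /nbhs_ballP[e e0 eW] WU].
exists e => // S' SS'; apply: WU; apply: eW; split=> // i j.
exact: le_lt_trans (sym_dist_ge S S' i j) SS'.
Qed.

(** The points at distance at least 1/(k+1) from the complement of U; cut with [Kset], they yield
    the compact exhaustion. *)
Definition inner_part (U : set (Sym R n)) (k : nat) : set (Sym R n) :=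
  [set S | forall S', ~ U S' -> k.+1%:R^-1 <= sym_dist S S'].

Lemma inner_part_closed U k : closed (inner_part U k).
Proof.
have -> : inner_part U k = \bigcap_(S' in ~` U) ((fun S => sym_dist S S') @^-1` `[k.+1%:R^-1, +oo[).
  apply/seteqP; split=> S SP S' US'; first by rewrite /= in_itv/= andbT; exact: SP.
  by have := SP S' US'; rewrite /= in_itv/= andbT.
apply: closed_bigI => S' _; apply: closed_comp; first by move=> S _; exact: sym_dist_continuous.
exact: interval_closed.
Qed.

Lemma inner_part_homo U : {homo inner_part U : i j / (i <= j)%N >-> i `<=` j}.
Proof.
move=> i j ij S SP S' US'; apply: le_trans (SP S' US').
by rewrite lef_pV2 ?posrE// ler_nat.
Qed.

Lemma inner_part_sub U k : inner_part U k `<=` U.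
Proof.
move=> S SP; apply: contrapT => US; have := SP S US.
rewrite /sym_dist big1 => [|ij _]; first by rewrite leNgt invr_gt0 ltr0Sn.
by rewrite subrr normr0.
Qed.

Lemma inner_part_bigcup U : open U -> U `<=` \bigcup_k inner_part U k.
Proof.
move=> oU S US; have [e e0 eU] := Sym_nbhs (open_nbhs_nbhs (conj oU US)).
exists (Num.truncn e^-1) => // S' US'; rewrite leNgt; apply/negP => SS'; apply: US'; apply: eU.
apply: lt_le_trans SS' _; rewrite -[leRHS]invrK lef_pV2 ?posrE ?invr_gt0//.
by apply: ltW; exact: truncnS_gt.
Qed.

Let symmetrize (f : 'I_n * 'I_n -> R) : 'M[R]_n := \matrix_(i, j) ((f (i, j) + f (j, i)) / 2).

Let symmetrize_sym f : symmetrize f \in @symmetric_mx R n.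
Proof. by apply/eqP/matrixP => i j; rewrite !mxE addrC. Qed.

(** The ball is the continuous image of a product of segments under symmetrization, so Tychonoff's
    theorem applies. *)
Lemma Sball_compact r : compact (@Sball R n r).
Proof.
pose P := prod_topology (fun _ : 'I_n * 'I_n => R).
pose F (f : P) : Sym R n := MkSym (symmetrize_sym f).
have pc ij : continuous (fun f : P => f ij : R).
  exact: (@proj_continuous _ (fun _ : 'I_n * 'I_n => R) ij).
have cF : continuous F.
  apply: (@continuous_comp_initial (Sym R n) _ _ (@Symmx R n)).
  apply: continuous_mx => i j.
  rewrite (_ : (fun f => _) = (fun f : P => (f (i, j) + f (j, i)) / 2)); last first.
    by apply/funext => f /=; rewrite mxE.
  by move=> f; exact: (cvgM (cvgD (pc (i, j) f) (pc (j, i) f)) (cvg_cst _)).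
have := @tychonoff _ (fun _ : 'I_n * 'I_n => R) (fun _ => [set` `[- r, r]]) (fun _ => @segment_compact R _ _).
move=> /(continuous_compact (continuous_subspaceT cF)); congr compact.
apply/seteqP; split=> [S [f fP <-] i j|S SP].
  rewrite /= mxE; have /= := fP (i, j); have /= := fP (j, i); rewrite !in_itv/= => /andP[? ?] /andP[? ?].
  by rewrite ler_norml; apply/andP; split; lra.
exists (fun ij => S ij.1 ij.2) => [ij|]; first by rewrite /= in_itv/= -ler_norml.
apply: val_inj; apply/matrixP => i j; rewrite /= mxE /= -[in X in _ + X](Symmx_tr S) mxE.
by field.
Qed.

Lemma Kset_compact m : 0 < m -> compact (@Kset R n m).
Proof.
move=> m0; apply: subclosed_compact (@Sball_compact (m *+ 2)) _; last exact: Kset_Sball.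
exact: Kset_closed.
Qed.

Lemma Kset_homo : {homo (fun k : nat => @Kset R n k.+1%:R) : i j / (i <= j)%N >-> i `<=` j}.
Proof. by move=> i j ij S; apply: pinched_le => //; rewrite ler_nat. Qed.

End Sym_topology.

(** * Topology of the coset space *)

Section coset_topology.
Variables (R : realType) (n : nat).
Local Notation X := (coset_space (@orthogonal_group R n)).

Definition coset_sym (x : X) : Sym R n := val (coset_gram x).

Definition coset_chol (z : SymPos R n) : X := \pi_X (cholesky z).

Lemma coset_sym_continuous : continuous coset_sym.
Proof.
move=> x; apply: (continuous_comp (@coset_gram_continuous R n x)).
exact: SymPos_val_continuous.
Qed.

Lemma coset_chol_continuous : continuous coset_chol.
Proof.
move=> z; apply: (continuous_comp (@cholesky_continuous R n z)).
exact: pi_continuous.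
Qed.

Lemma coset_sym_chol z : coset_sym (coset_chol z) = val z.
Proof. by rewrite /coset_sym coset_gram_cholesky. Qed.

Lemma coset_chol_act (g : GL R n) z : coset_act g (coset_chol z) = coset_chol (pos_act g z).
Proof.
apply: (can_inj (@coset_gramK R n)).
by rewrite coset_gram_act !coset_gram_cholesky.
Qed.

(** [Kset m] lies inside the open cone, away from its boundary, so it stays compact in the
    subspace. *)
Lemma SymPos_Kset_compact m : 0 < m -> compact (val @^-1` (@Kset R n m) : set (SymPos R n)).
Proof.
move=> m0; apply: (@compact_initial (SymPos R n) (Sym R n) val).
  exact: (@initial_nbhs (set_type (@posdef R n)) (Sym R n) set_val).
rewrite (_ : _ @` _ = Kset m); first exact: Kset_compact.
apply/seteqP; split=> [_ [z Kz <-]//|S KS].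
have Sp : posdef S by exact: pinched_pdmx KS.
by exists (posret S : SymPos R n); rewrite /= val_posret.
Qed.

Lemma coset_Kset_compact m : 0 < m -> compact (coset_sym @^-1` (@Kset R n m)).
Proof.
move=> m0; rewrite (_ : _ @^-1` _ = coset_chol @` (val @^-1` (@Kset R n m))).
  exact: (continuous_compact (continuous_subspaceT coset_chol_continuous) (SymPos_Kset_compact m0)).
apply/seteqP; split=> [x Kx|_ [z Kz <-]]; last by rewrite /= coset_sym_chol.
by exists (coset_gram x) => //; exact: coset_gramK.
Qed.

Lemma coset_exhaustible : exhaustible X.
Proof.
move=> U oU.
have : open (coset_chol @^-1` U).
  by apply: open_comp => // z _; exact: coset_chol_continuous.
(* V is open in [Sym] and cuts out U on the cone. Inner parts of V alone may approach the boundary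
   of the cone, hence the intersection with [Kset]. *)
move=> -[V oV VE].
have UE x : U x <-> V (coset_sym x).
  have := congr1 (fun A => A (coset_gram x)) VE.
  rewrite /= /coset_chol coset_gramK => <-; split; exact.
pose C k := coset_sym @^-1` (@Kset R n k.+1%:R `&` inner_part V k).
have cC k : closed (C k).
  apply: closed_comp; first by move=> x _; exact: coset_sym_continuous.
  by apply: closedI; [exact: Kset_closed|exact: inner_part_closed].
have incC : {homo C : i j / (i <= j)%N >-> i `<=` j}.
  by move=> i j ij x [Kx Ix]; split; [exact: Kset_homo Kx|exact: inner_part_homo Ix].
exists C; split=> //.
  move=> k; apply: subclosed_compact (@coset_Kset_compact k.+1%:R _) _ => //.
  by move=> x [].
apply/seteqP; split=> [x /UE Vx|x [k _ [_ /inner_part_sub/UE]]//].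
have [k _ kx] := inner_part_bigcup oV Vx.
have [l _ lx] : (\bigcup_(m : nat) @Kset R n m.+1%:R) (coset_sym x).
  by rewrite -posdefE; exact: set_mem (valP (coset_gram x)).
exists (maxn k l) => //; split.
  by apply: Kset_homo lx; exact: leq_maxr.
by apply: inner_part_homo kx; exact: leq_maxl.
Qed.

Lemma coset_hausdorff : hausdorff_space X.
Proof.
apply: (@injective_hausdorff R _ _ (fun ij x => coset_sym x ij.1 ij.2)) => [ij x|x y xy].
  exact: (continuous_comp (@coset_sym_continuous x) (@Sym_coord_continuous R n ij.1 ij.2 _)).
apply: (can_inj (@coset_gramK R n)); apply: posmx_inj; apply/matrixP => i j.
exact: (xy (i, j)).
Qed.

End coset_topology.

(** * Existence of an admissible measure *)

Section coset_measure.
Variables (R : realType) (n : nat).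
Hypothesis n0 : (0 < n)%N.
Local Notation X := (coset_space (@orthogonal_group R n)).
Local Open Scope ereal_scope.

Lemma measurable_coset_chol :
  measurable_fun setT (@coset_chol R n : borel (SymPos R n) -> borel X).
Proof. by apply: continuous_borel; exact: coset_chol_continuous. Qed.

Definition coset_lebesgue : {measure set (borel X) -> \bar R} :=
  image_measure measurable_coset_chol (lebP R n).

Lemma lebP_act_set (g : GL R n) (A : set (borel (SymPos R n))) : measurable A ->
  lebP R n (pos_act g @^-1` A) = (`|\det g| `^ (n%:R + 1))^-1%:E * lebP R n A.
Proof.
move=> mA; rewrite -[A in RHS]setIT -integral_indic//.
rewrite -(lebP_act g n0)//.
- rewrite -[LHS](congr1 _ (setIT _)) -integral_indic//.
  by rewrite -[X in measurable X]setTI; exact: measurable_pos_act.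
- by apply/measurable_EFinP; exact: measurable_indic.
Qed.

(** Bounded sets of symmetric matrices have finite Lebesgue measure, even up to the boundary of the
    cone, so balls around 0 provide the open sets of finite mass. *)
Lemma coset_lebesgue_radon : radon coset_lebesgue.
Proof.
pose D k := (fun S : Sym R n => sym_dist S 0%R) @^-1` [set r | (r < k.+1%:R)%R].
pose W k := @coset_sym R n @^-1` D k.
have oW k : open (W k).
  apply: open_comp; first by move=> x _; exact: coset_sym_continuous.
  apply: open_comp; first by move=> S _; exact: sym_dist_continuous.
  exact: open_lt.
apply: (@radon_exhaustible _ _ _ W) => //.
- exact: coset_hausdorff.
- exact: coset_exhaustible.
- by move=> i j ij x /= h; apply: lt_le_trans h _; rewrite ler_nat.
- apply/seteqP; split=> // x _; exists (Num.truncn (sym_dist (coset_sym x) 0%R)) => //.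
  exact: truncnS_gt.
- move=> k.
  apply: (@le_lt_trans _ _ (lebS R n (@Sball R n k.+1%:R))); last exact: lebS_ball.
  have mW : measurable (@coset_chol R n @^-1` W k : set (borel (SymPos R n))).
    rewrite -[X in measurable X]setTI; apply: measurable_coset_chol => //.
    exact: open_borel_measurable.
  apply: (@le_measure _ _ _ (lebS R n)); rewrite ?inE.
  + apply: measurableI; last exact: measurable_posdef.
    by rewrite -[X in measurable X]setTI; exact: measurable_posret.
  + exact: measurable_Sball.
  + move=> S [Wk Sp]; have : D k (coset_sym (coset_chol (posret S))) := Wk.
    rewrite coset_sym_chol val_posret// => Sk i j.
    have := sym_dist_ge S 0%R i j; rewrite /= mxE subr0 => /le_lt_trans/(_ Sk).
    exact: ltW.
Qed.

Lemma coset_lebesgue_admissible : admissible_measure coset_lebesgue.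
Proof.
split.
- rewrite /coset_lebesgue image_measureE preimage_setT.
  have -> : lebP R n setT = lebS R n (@posdef R n).
    rewrite -[LHS]/(lebS R n _); congr (lebS R n _).
    by rewrite preimage_setT setTI.
  exact/eqP/lebS_posdef_neq0.
- exact: coset_lebesgue_radon.
- exists (fun g : GL R n => `|\det g| `^ (n%:R + 1))%R; split.
    by move=> g; rewrite powR_gt0// normr_gt0 -unitfE -unitmxE GLmx_unit.
  move=> g A mA; rewrite /pushforward /coset_lebesgue !image_measureE -lebP_act_set.
    congr (lebP R n _); apply/seteqP; split=> z /=; rewrite coset_chol_act//.
  by rewrite -[X in measurable X]setTI; exact: measurable_coset_chol.
Qed.

End coset_measure.

(** * The exponential family *)

Section characters_and_functionals.
Variables (R : realType) (n : nat).

Lemma orthogonal_fixes_Sym1 : fixed_by (@orthogonal_group R n) (congr_rep R n) (Sym1 R n).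
Proof. by move=> h /eqP hO; apply: val_inj; rewrite /= mulmx1. Qed.

Definition trform (y : 'M[R]_n) (S : Sym R n) : R^o := \tr (y *m S).

Lemma trform_linear y : linear (trform y).
Proof. by move=> a S T; rewrite /trform /= mulmxDr -scalemxAr mxtraceD mxtraceZ. Qed.

HB.instance Definition _ y :=
  GRing.isLinear.Build R (Sym R n) R^o *:%R (trform y) (trform_linear y).

Lemma sym_basis_sym (i j : 'I_n) :
  2^-1 *: (delta_mx i j + delta_mx j i : 'M[R]_n) \in @symmetric_mx R n.
Proof. by apply/eqP; rewrite linearZ/= linearD/= !trmx_delta addrC. Qed.

(** A spanning family indexed by all pairs: (i, j) and (j, i) give the same matrix, and the factor
    1/2 makes the coordinates equal to the entries. *)
Definition sym_basis i j : Sym R n := MkSym (sym_basis_sym i j).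

Lemma sym_basis_sum (S : Sym R n) : S = \sum_i \sum_j S i j *: sym_basis i j.
Proof.
have valD : {morph @Symmx R n : A B / A + B} by [].
apply: val_inj; rewrite /= (big_morph _ valD (erefl _)).
under eq_bigr do rewrite (big_morph _ valD (erefl _)) /=.
under eq_bigr do under eq_bigr do rewrite scalerA scalerDr.
under eq_bigr do rewrite big_split/=.
rewrite big_split/= [X in _ + X]exchange_big/= -big_split/=.
rewrite [LHS]matrix_sum_delta; apply: eq_bigr => i _.
rewrite -big_split/=; apply: eq_bigr => j _.
rewrite -scalerDl -mulrDl; congr (_ *: _).
have -> : S j i = S i j by rewrite -[in LHS](Symmx_tr S) mxE.
by field.
Qed.

(** The symmetry of y is what later allows a positive definite y to be regarded as a point of
    [SymPos]. *)
Lemma linear_trform (phi : {linear Sym R n -> R^o}) :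
  exists2 y, y^T = y & forall S, phi S = trform y S.
Proof.
exists (\matrix_(i, j) phi (sym_basis j i)) => [|S].
  apply/matrixP => i j; rewrite !mxE; congr (phi _); apply: val_inj.
  by rewrite /= addrC.
rewrite {1}(sym_basis_sum S) exchange_big linear_sum/=; apply: eq_bigr => i _.
rewrite linear_sum/= mxE; apply: eq_bigr => j _.
by rewrite linearZ/= mxE mulrC.
Qed.

(** Continuity is used only at 1, for a bound near the identity; [gl_hom_ln_det] does the rest. *)
Lemma W0_ln_det (tau : GL R n -> R) : W0 (@orthogonal_group R n) tau ->
  exists s, forall g, tau g = s * ln `|\det g|.
Proof.
move=> [ctau tauM tauO].
pose F (A : 'M[R]_n) := tau (insubd (1%g : GL R n) A).
have FE (g : GL R n) : F g = tau g by rewrite /F (valKd (1%g : GL R n) g).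
have FM A A' : A \in unitmx -> A' \in unitmx -> F (A *m A') = F A + F A'.
  move=> AU AU'; rewrite -[A]/(GLmx (MkGL AU)) -[A']/(GLmx (MkGL AU')).
  by rewrite -[_ *m _]/(GLmx (MkGL AU * MkGL AU')%g) !FE tauM.
have [e e0 eP] : exists2 e : R, 0 < e & forall g : GL R n,
    (forall i j, `|g i j - (1%:M : 'M[R]_n) i j| < e) -> `|tau g| <= 1.
  have tau1 : tau 1%g = 0 by rewrite tauO// orthogonal_group1.
  have : nbhs (1%g : GL R n) (tau @^-1` [set r | `|r| < 1]).
    apply: ctau; rewrite tau1; apply: filterS (nbhsx_ballx (0 : R) 1 ltr01) => r.
    by rewrite /ball/= sub0r normrN.
  move=> /(@initial_nbhs _ _ (@GLmx R n))[W /nbhs_ballP[e e0 eW] WU].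
  exists e => // g ge; apply: ltW; apply: (WU g); apply: eW; split=> // i j.
  by rewrite /ball/= distrC; exact: ge.
have [||s sP] := @gl_hom_ln_det R n F FM e 1 e0.
- by move=> A AU Ae; rewrite -[A]/(GLmx (MkGL AU)) FE; exact: eP.
- move=> A AO; have AU : A \in unitmx by have [] := mulmx1_unit AO.
  by rewrite -[A]/(GLmx (MkGL AU)) FE tauO//; exact/eqP.
by exists s => g; rewrite -FE sP// GLmx_unit.
Qed.

Lemma ln_det_W0 (s : R) : W0 (@orthogonal_group R n) (fun g : GL R n => s * ln `|\det g|).
Proof.
have d0 (g : GL R n) : 0 < `|\det g| by rewrite normr_gt0 -unitfE -unitmxE GLmx_unit.
split.
- have cdet : continuous (fun g : GL R n => \det g).
    apply: continuous_det => i j g.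
    exact: (continuous_comp (@GLmx_continuous R n g) (@coord_continuous _ _ _ i j _)).
  move=> g; have c1 := continuous_comp (cdet g) (@norm_continuous _ _ _).
  have c2 := continuous_comp c1 (continuous_ln (d0 g)).
  exact: (cvgM (cvg_cst s) c2).
- by move=> g g'; rewrite /= det_mulmx normrM lnM ?posrE// mulrDr.
- move=> h /eqP /= /(congr1 determinant); rewrite det_mulmx det_tr det1 -expr2 => h1.
  have -> : `|\det h| = 1; last by rewrite ln1 mulr0.
  by apply/eqP; rewrite -sqrp_eq1// real_normK ?num_real// h1.
Qed.

End characters_and_functionals.

(** * Identification of the family with the Wishart distributions *)

Section wishart_family.
Variables (R : realType) (n : nat).
Hypothesis n0 : (0 < n)%N.
Local Notation X := (coset_space (@orthogonal_group R n)).
Local Notation SP := (borel (SymPos R n)).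

Lemma measurable_coset_gram :
  measurable_fun setT (@coset_gram R n : borel X -> SP).
Proof. by apply: continuous_borel; exact: coset_gram_continuous. Qed.

Lemma coset_invariant_density (nu : {measure set (borel X) -> \bar R}) :
  admissible_measure nu -> exists C r : R, 0 < C /\
  forall h : SymPos R n -> \bar R,
    measurable_fun setT (h : SP -> \bar R) -> (forall z, (0 <= h z)%E) ->
  (\int[nu]_x h (coset_gram x)
   = C%:E * \int[lebP R n]_z ((\det (posmx z) `^ r)%:E * h z))%E.
Proof.
move=> [nuT [nuK _ _] [chi [chi0 nuchi]]].
pose N := image_measure measurable_coset_gram nu.
have [||||C [r [C0 Cr]]] := @SymPos_invariant_density R n n0 N chi.
- exact: chi0.
- move=> g A mA; have mA' : measurable (@coset_gram R n @^-1` A : set (borel X)).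
    by rewrite -[X in measurable X]setTI; exact: measurable_coset_gram.
  have AE : @coset_gram R n @^-1` (pos_act g @^-1` A) = coset_act g @^-1` (@coset_gram R n @^-1` A).
    by apply/seteqP; split=> x /=; rewrite coset_gram_act.
  by rewrite /N [LHS]image_measureE [in RHS]image_measureE AE; exact: nuchi.
- by move=> m m0; rewrite /N image_measureE; apply: nuK; exact: coset_Kset_compact.
- by rewrite /N image_measureE preimage_setT; apply/eqP.
exists C, r; split=> // h mh h0; rewrite -Cr//.
by rewrite -(integral_image measurable_coset_gram nu mh h0).
Qed.

(** The Gram matrix has determinant |det g|^2, so s ln|det g| becomes the power s/2 of it. *)
Lemma exp_density_gram y (s : R) (theta : {linear Sym R n -> R^o} * (GL R n -> R)) (x : X) :
  (forall S, theta.1 S = trform y S) -> (forall g, theta.2 g = s * ln `|\det g|) ->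
  exp_density (congr_rep R n) (Sym1 R n) theta x
  = expR (- \tr (y *m posmx (coset_gram x))) * \det (posmx (coset_gram x)) `^ (s / 2).
Proof.
move=> yE sE; have d0 : 0 < `|\det (repr x)| by rewrite normr_gt0 -unitfE -unitmxE GLmx_unit.
rewrite /exp_density yE sE expRD; congr (_ * _).
have -> : \det (posmx (coset_gram x)) = `|\det (repr x)| `^ 2.
  by rewrite posmx_gram det_mulmx det_tr -expr2 sqr_powR.
rewrite -powRrM mulrCA divff ?mulr1 ?pnatr_eq0//.
by rewrite /powR gt_eqF.
Qed.

Lemma image_val_posdef (A : set SP) (S : Sym R n) :
  ([set val z | z in A] S <-> posdef S /\ A (posret S)).
Proof.
split=> [[z Az <-]|[Sp AS]]; last by exists (posret S) => //; exact: val_posret.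
by rewrite posretK; split=> //; exact: set_mem (valP (z : SymPos R n)).
Qed.

Lemma measurable_image_val (A : set SP) : measurable A ->
  measurable ([set val z | z in A] : set (borel (Sym R n))).
Proof.
move=> mA; rewrite (_ : _ @` _ = @posdef R n `&` @posret R n @^-1` A).
  apply: measurableI; first exact: measurable_posdef.
  by rewrite -[X in measurable X]setTI; exact: measurable_posret.
by apply/seteqP; split=> S /image_val_posdef.
Qed.

Section ptilde_formula.
Variables (nu : {measure set (borel X) -> \bar R}) (C r : R).
Hypothesis Cr : forall h : SymPos R n -> \bar R,
    measurable_fun setT (h : SP -> \bar R) -> (forall z, (0 <= h z)%E) ->
  (\int[nu]_x h (coset_gram x)
   = C%:E * \int[lebP R n]_z ((\det (posmx z) `^ r)%:E * h z))%E.

Lemma ptilde_wker y (s : R) (theta : {linear Sym R n -> R^o} * (GL R n -> R)) (A : set SP) :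
  (forall S, theta.1 S = trform y S) -> (forall g, theta.2 g = s * ln `|\det g|) ->
  measurable A ->
  (ptilde (congr_rep R n) (Sym1 R n) nu theta (@coset_gram R n @^-1` A)
   = C%:E * \int[lebS R n]_(S in [set val z | z in A]) (wker y (s / 2 + r) S)%:E)%E.
Proof.
move=> yE sE mA; rewrite /ptilde.
pose E (z : SymPos R n) : \bar R := (expR (- \tr (y *m posmx z)) * \det (posmx z) `^ (s / 2))%:E.
have E0 z : (0 <= E z)%E by rewrite lee_fin mulr_ge0 ?expR_ge0 ?powR_ge0.
have mE : measurable_fun setT (E : SP -> \bar R).
  apply/measurable_EFinP; apply: measurable_funM.
    apply: measurableT_comp => //; apply: measurableT_comp => //.
    exact: (measurableT_comp (@measurable_tr_Sym R n y) (@measurable_SymPos_val R n)).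
  exact: (measurableT_comp (measurable_powR _) (@measurable_det_posmx R n)).
under eq_integral do rewrite (exp_density_gram _ yE sE).
rewrite integral_mkcond.
transitivity (\int[nu]_x (E \_ A) (coset_gram x))%E.
  apply: eq_integral => x _; rewrite !patchE.
  by have -> : (x \in @coset_gram R n @^-1` A) = (coset_gram x \in A) by apply/idP/idP => /set_mem/mem_set.
have EA0 z : (0 <= (E \_ A) z)%E by rewrite patchE; case: ifP.
have mEA : measurable_fun setT (E \_ A : SP -> \bar R).
  by apply/(measurable_restrictT _ mA); exact: measurable_funTS.
rewrite Cr//; congr (_ * _)%E.
have mr : measurable_fun setT (fun z : SP => (\det (posmx z) `^ r)%:E : \bar R).
  by apply/measurable_EFinP; exact: (measurableT_comp (measurable_powR _) (@measurable_det_posmx R n)).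
rewrite lebP_integral; first last.
- by move=> z; rewrite mule_ge0// lee_fin powR_ge0.
- exact: emeasurable_funM.
rewrite [LHS]integral_mkcond [RHS]integral_mkcond; apply: eq_integral => S _.
rewrite !patchE; case: (boolP (S \in @posdef R n)) => [/set_mem Sp|Sp]; last first.
  rewrite ifN//; apply: contra Sp => /set_mem/image_val_posdef[Sp _].
  exact: mem_set.
have -> : (S \in [set val z | z in A]) = (posret S \in A).
  by apply/idP/idP => /set_mem h; apply/mem_set; [have /image_val_posdef[] := h|apply/image_val_posdef].
case: ifP => _; last by rewrite mule0.
rewrite /E posmx_posret// -EFinM /wker indicE mem_set// mul1r; congr EFin.
have d0 : 0 < \det S by apply: pdmx_det_gt0 => //; exact: Symmx_tr.
rewrite mulrCA addrC; congr (_ * _); rewrite powRD//.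
by rewrite (gt_eqF d0) implybT.
Qed.

End ptilde_formula.

(** The closed-form constant is the reciprocal of the integral of the kernel, so a Wishart
    distribution is the normalization of [wker]. The condition on alpha says that the exponent of
    the determinant exceeds -1. *)
Lemma wishart_wker (z : SymPos R n) (alpha : R) (A : set SP) :
  (n%:R - 1) / 2 < alpha -> measurable A ->
  (wishart z alpha A
   = (fine (\int[lebS R n]_S (wker (posmx z) (alpha - (n%:R + 1) / 2) S)%:E))^-1%:E
     * \int[lebS R n]_(S in [set val z | z in A]) (wker (posmx z) (alpha - (n%:R + 1) / 2) S)%:E)%E.
Proof.
move=> al mA; set b := alpha - _.
have b1 : -1 < b by rewrite /b; move: al; lra.
have w0 S : (0 <= (wker (posmx z) b S)%:E)%E by rewrite lee_fin wker_ge0.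
pose K := pi `^ (n%:R * (n%:R - 1) / 4)
  * \prod_(1 <= k < n.+1) Gamma (alpha - (k%:R - 1) / 2).
have KE : wint n b = K%:E.
  rewrite (wint_fin n b1) /K; do 2!apply: congr1; apply: eq_bigr => k _.
  by rewrite /b subrK.
have K0 : 0 < K by rewrite -lte_fin -KE wint_gt0.
rewrite integral_wker_pd// KE -EFinM [fine _]/= [in _ `^ _]/b subrK.
have k0 : (0 <= ((\det (posmx z) `^ (- alpha) * K)^-1)%:E)%E.
  by rewrite lee_fin invr_ge0 mulr_ge0 ?powR_ge0// ltW.
have mw : measurable_fun ([set val x | x in A] : set (borel (Sym R n))) (fun S : borel (Sym R n) => (wker (posmx z) b S)%:E : \bar R).
  by apply: measurable_funTS; exact: measurable_wker.
rewrite /wishart lebSE.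
rewrite -(ge0_integralZl (lebS R n) (measurable_image_val mA) mw (fun S _ => w0 S) k0).
apply: eq_integral => S /set_mem/image_val_posdef[Sp _].
rewrite -EFinM; congr EFin; rewrite /wishart_density /wker indicE mem_set// mul1r -/K -/b.
have -> : (\det (posmx z) `^ (- alpha) * K)^-1 = \det (posmx z) `^ alpha / K.
  by rewrite invfM powRN invrK.
by rewrite /posmx !mulrA.
Qed.

Lemma integral_wker_val (y : 'M[R]_n) b :
  (\int[lebS R n]_(S in [set val z | z in [set: SymPos R n]]) (wker y b S)%:E
   = \int[lebS R n]_S (wker y b S)%:E)%E.
Proof.
rewrite integral_mkcond; apply: eq_integral => S _; rewrite patchE; case: ifPn => // Sp.
rewrite /wker indicE memNset ?mul0r// => Sp'; move/negP: Sp; apply; apply/mem_set.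
exact/image_val_posdef.
Qed.

Section normalization.
Variables (nu : {measure set (borel X) -> \bar R}) (C r : R).
Hypothesis C0 : 0 < C.
Hypothesis Cr : forall h : SymPos R n -> \bar R,
    measurable_fun setT (h : SP -> \bar R) -> (forall z, (0 <= h z)%E) ->
  (\int[nu]_x h (coset_gram x)
   = C%:E * \int[lebP R n]_z ((\det (posmx z) `^ r)%:E * h z))%E.
Variables (theta : {linear Sym R n -> R^o} * (GL R n -> R)) (s : R).
Hypothesis sE : forall g, theta.2 g = s * ln `|\det g|.

Lemma ptilde_setT y : (forall S, theta.1 S = trform y S) ->
  (ptilde (congr_rep R n) (Sym1 R n) nu theta [set: X]
   = C%:E * \int[lebS R n]_S (wker y (s / 2 + r) S)%:E)%E.
Proof.
move=> yE; rewrite -integral_wker_val -(ptilde_wker Cr yE sE measurableT).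
by rewrite preimage_setT.
Qed.

(** Both sides normalize the same kernel; the constant C of the invariant measure cancels. *)
Lemma p_theta_wishart (z : SymPos R n) (alpha : R) :
  (forall S, theta.1 S = trform (posmx z) S) ->
  alpha = s / 2 + r + (n%:R + 1) / 2 -> (n%:R - 1) / 2 < alpha ->
  (ptilde (congr_rep R n) (Sym1 R n) nu theta [set: X] < +oo)%E /\
  sigL measurable
    (pushforward (p_theta (congr_rep R n) (Sym1 R n) nu theta) (@coset_gram R n : _ -> SP))
  = sigL measurable (wishart z alpha).
Proof.
move=> yE aE al; rewrite (ptilde_setT yE).
have bE : s / 2 + r = alpha - (n%:R + 1) / 2 by rewrite aE addrK.
have [J J0 JE] : exists2 J : R, 0 < J &
    (\int[lebS R n]_S (wker (posmx z) (s / 2 + r) S)%:E)%E = J%:E.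
  have b1 : -1 < s / 2 + r by rewrite bE; move: al; lra.
  rewrite integral_wker_pd//.
  have := wint_gt0 n (s / 2 + r); rewrite wint_fin// lte_fin.
  set K := _ * _ => K0; exists (\det (posmx z) `^ (- (s / 2 + r + (n%:R + 1) / 2)) * K) => //.
  by rewrite mulr_gt0// powR_gt0// det_posmx_gt0.
split; first by rewrite JE -EFinM ltry.
apply/funext => A; have mA : measurable (set_val A) by exact: set_mem (valP A).
rewrite /sigL /= /pushforward /p_theta (ptilde_setT yE) (ptilde_wker Cr yE sE mA).
rewrite wishart_wker// -bE JE -EFinM /= muleA -EFinM; congr (_%:E * _)%E.
by rewrite invfM mulrAC mulVf ?mul1r// gt_eqF.
Qed.

End normalization.

End wishart_family.

(** Measures are compared through [sigL measurable], that is on Borel sets only, because the set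
    functions involved need not agree elsewhere. *)
Theorem proposition4p9 (R : realType) (n : nat) (n_gt0 : (0 < n)%N) :
  [/\ fixed_by (@orthogonal_group R n) (congr_rep R n) (Sym1 R n),
      homeomorphism (@coset_gram R n),
      exists nu : {measure set (borel (coset_space (@orthogonal_group R n)))
                         -> \bar R},
        admissible_measure nu
    & forall nu : {measure set (borel (coset_space (@orthogonal_group R n)))
                         -> \bar R},
        admissible_measure nu ->
        [set sigL measurable
               (pushforward p (@coset_gram R n : _ -> borel (SymPos R n)))
          | p in homogeneous_family (congr_rep R n) (Sym1 R n) nu]
        = [set sigL measurable (wishart ya.1 ya.2)
          | ya in [set ya : SymPos R n * R | (n%:R - 1) / 2 < ya.2]] ].
Proof.
split.
- exact: orthogonal_fixes_Sym1.
- exact: coset_gram_homeomorphism.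
- by exists (coset_lebesgue R n); exact: coset_lebesgue_admissible.
- move=> nu nuA; have [C [r [C0 Cr]]] := coset_invariant_density n_gt0 nuA.
  apply/seteqP; split=> [_ [_ [theta [tauW pty] <-] <-]|_ [[z alpha] /= al <-]].
    have [s sE] := W0_ln_det tauW; have [y ysym yE] := linear_trform theta.1.
    move: pty; rewrite (ptilde_setT Cr sE yE) => pty.
    (* Finiteness of the total mass forces y to be positive definite, and then bounds alpha from
       below. *)
    have ypd : pdmx y.
      apply: contrapT => /(integral_wker_npd (s / 2 + r) n_gt0) yoo.
      by move: pty; rewrite yoo gt0_muley ?lte_fin.
    have yS : y \in @symmetric_mx R n by exact/eqP.
    pose z : SymPos R n := posret (MkSym yS).
    have zE : posmx z = y by rewrite posmx_posret.
    have al : (n%:R - 1) / 2 < s / 2 + r + (n%:R + 1) / 2.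
      rewrite ltNge; apply/negP => al.
      have b1 : s / 2 + r <= -1 by move: al; lra.
      move: pty; rewrite -zE integral_wker_pd// wint_pinfty//.
      by rewrite !gt0_muley ?lte_fin// powR_gt0// det_posmx_gt0.
    exists (z, s / 2 + r + (n%:R + 1) / 2) => //.
    rewrite -zE in yE.
    by have [_ ->] := p_theta_wishart n_gt0 C0 Cr sE yE erefl al.
  (* Solved from alpha = s/2 + r + (n+1)/2. As s is free, every alpha is reached whatever r is, so
     the family does not depend on nu. *)
  pose s := 2 * (alpha - (n%:R + 1) / 2 - r).
  pose theta : {linear Sym R n -> R^o} * (GL R n -> R) :=
    (trform (posmx z) : {linear Sym R n -> R^o}, fun g : GL R n => s * ln `|\det g|).
  have aE : alpha = s / 2 + r + (n%:R + 1) / 2 by rewrite /s; field.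
  have sE g : theta.2 g = s * ln `|\det g| by [].
  have yE S : theta.1 S = trform (posmx z) S by [].
  have [py pE] := p_theta_wishart n_gt0 C0 Cr sE yE aE al.
  exists (p_theta (congr_rep R n) (Sym1 R n) nu theta) => //.
  by exists theta => //; split=> //; exact: ln_det_W0.
Qed.
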